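(* Assume that the Kasner exponents satisfy the subcriticality relation $p_i+p_j-p_k<1$ for all $i,j,k\in\{1,\dots,D\}$ with $i\neq j$. Let $(h_{ij},\kappa_{ij},\phi,\psi,\nu)$ be a smooth solution on $(0,\infty)\times\mathbb{T}^D$ of the linearized Einstein--scalar field system (defined in the context: evolution equations, lapse equation and constraint equations, with zero shift) around the given Kasner background, arising from smooth Cauchy data for $(h_{ij},\kappa_{ij},\phi,\psi)$ at $t=1$ satisfying the constraint equations. Then there exist smooth $(1,1)$ tensors $(\Upsilon_\infty)_i^{\ j}$, $(K_\infty)_i^{\ j}$ and smooth functions $\psi_\infty,\varphi_\infty$ on $\mathbb{T}^D$ such that, as $t\to0$ (no summation over repeated indices): if $p_i=p_j$, $$\kappa_{ij}=\big((K_\infty)_i^{\ j}+2p_i(\Upsilon_\infty)_i^{\ j}\big)t^{2p_i}+2p_i(K_\infty)_i^{\ j}t^{2p_i}\log t+o(t^{2p_i}),$$ $$h_{ij}=-2\big((K_\infty)_i^{\ j}\log t+(\Upsilon_\infty)_i^{\ j}\big)t^{2p_j}+o(t^{2p_j});$$ if $p_i\ne p_j$, $$\kappa_{ij}=-\frac{p_j}{p_i-p_j}(K_\infty)_i^{\ j}t^{2p_j}+\Big(\frac{p_i}{p_i-p_j}(K_\infty)_i^{\ j}+2p_i(\Upsilon_\infty)_j^{\ i}\Big)t^{2p_i}+o\big(t^{\min\{2p_i,2p_j\}}\big),$$ $$h_{ij}=-\Big(\frac{(K_\infty)_i^{\ j}}{p_i-p_j}+2(\Upsilon_\infty)_i^{\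 j}\Big)t^{2p_i}+\frac{(K_\infty)_i^{\ j}}{p_i-p_j}t^{2p_j}+o\big(t^{\min\{2p_i,2p_j\}}\big);$$ and $$\psi=\psi_\infty+o(1),\qquad \phi=\psi_\infty\log t+\varphi_\infty+o(1).$$
   Context: Let $D$ be a positive integer and $\mathbb{T}^D=(\mathbb{R}/2\pi\mathbb{Z})^D$. The Kasner background consists of real numbers $p_1,\dots,p_D,p_\phi$ with $\sum_i p_i=1$ and $\sum_i p_i^2+2p_\phi^2=1$; it is the metric $-dt^2+\sum_i t^{2p_i}(dx^i)^2$ on $(0,\infty)\times\mathbb{T}^D$ with scalar field $p_\phi\log t$. Unknowns: time-dependent $(0,2)$ tensor fields $h_{ij}$ (linearized first fundamental form) and $\kappa_{ij}$ ($t$ times the linearized second fundamental form), scalar functions $\phi$, $\psi$ (linearized scalar field and $t$ times its linearized normal derivative), and $\nu$ (linearized lapse); all real. The gauge is constant mean curvature with vanishing shift. Set $$\eta_i^{\ j}=-\tfrac12t^{-2p_j}h_{ij},\qquad K_i^{\ j}=t^{-2p_j}(\kappa_{ij}+p_ih_{ij})$$ (no summation), $\operatorname{tr}\eta=\sum_i\eta_i^{\ i}$, $\operatorname{tr}K=\sum_iK_i^{\ i}$, $\Delta_t=\sum_at^{-2p_a}\partial_a^2$. All sums below are written explicitly. Linearized Einstein--scalar field system (zero shift): Evolution equations: $$t\partial_t\eta_i^{\ j}=K_i^{\ j}+2(p_i-p_j)\eta_i^{\ j}-p_i\delta_i^{\ j}\nu,$$ $$t\partial_tK_i^{\ j}=t^2\Big(\Delta_t\eta_i^{\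 j}+t^{-2p_j}\partial_i\partial_j\operatorname{tr}\eta-\sum_at^{-2p_a}\partial_i\partial_a\eta_a^{\ j}-t^{-2p_j}\sum_b\partial_j\partial_b\eta_i^{\ b}\Big)-t^{2-2p_j}\partial_i\partial_j\nu+p_i\delta_i^{\ j}\nu,$$ $$t\partial_t\phi=\psi+p_\phi\nu,\qquad t\partial_t\psi=t^2\Delta_t\phi-p_\phi\nu.$$ Lapse equation: $(1-t^2\Delta_t)\nu=-2t^2\Delta_t\operatorname{tr}\eta+2\sum_{a,i}t^{2-2p_a}\partial_i\partial_a\eta_a^{\ i}$. Constraint equations: $\operatorname{tr}K=0$; $$-2t^2\Delta_t\operatorname{tr}\eta+2\sum_{a,i}t^{2-2p_a}\partial_i\partial_a\eta_a^{\ i}-2\sum_ap_aK_a^{\ a}+4p_\phi\psi=0;$$ $$\sum_j\partial_jK_i^{\ j}+\partial_i\Big(-\sum_ap_a\eta_a^{\ a}+2p_\phi\phi\Big)+p_i\partial_i\operatorname{tr}\eta=0;$$ and the symmetry conditions $h_{ij}=h_{ji}$, $\kappa_{ij}=\kappa_{ji}$.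
   Formalization: Assumes D ≥ 2 instead of D positive: for D = 1 (p_1 = 1, p_φ = 0, subcriticality vacuous) the claim fails, since h = κ = ν = 0, φ = cos(log t) cos x, ψ = −sin(log t) cos x is a solution whose ψ has no limit as t → 0. *)

(* Defs.v *)
From HB Require Import structures.
From mathcomp Require Import all_boot all_order all_algebra.
From mathcomp Require Import all_classical all_reals all_analysis.
Import Order.TTheory GRing.Theory Num.Theory.
Import numFieldNormedType.Exports.

Set Implicit Arguments.
Unset Strict Implicit.
Unset Printing Implicit Defensive.

Local Open Scope classical_set_scope.
Local Open Scope ring_scope.

(* C^oo on an open set A: every iterated directional derivative of f is
   continuous, and differentiable in every direction, at each point of A. *)
Definition smooth_on (R : realType) (V : normedModType R) (A : set V)
    (f : V -> R) : Prop :=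
  forall (vs : seq V) (z : V), A z ->
    let g : V -> R := foldr (fun v u => derive u ^~ v) f vs in
    {for z, continuous g} /\ (forall v : V, derivable g z v).

(* Functions on the torus (R / 2 pi Z)^D are represented by functions on R^D
   that are 2 pi-periodic in every coordinate. *)
Definition torus_periodic (R : realType) (D : nat) (f : 'rV[R]_D -> R) : Prop :=
  forall i : 'I_D, periodic f ((2 * pi) *: delta_mx 0 i).

Definition torus_smooth (R : realType) (D : nat) (f : 'rV[R]_D -> R) : Prop :=
  torus_periodic f /\ smooth_on setT f.

(* Smooth functions on (0, +oo) x T^D, jointly in time and space. *)
Definition spacetime_smooth (R : realType) (D : nat)
    (u : R -> 'rV[R]_D -> R) : Prop :=
  (forall t : R, 0 < t -> torus_periodic (u t)) /\
  @smooth_on R (R^o * 'rV[R]_D)%type [set z | (0 : R) < z.1]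
    (fun z => u z.1 z.2).

Definition partial (R : realType) (D : nat) (i : 'I_D) (f : 'rV[R]_D -> R) :
    'rV[R]_D -> R :=
  fun x => derive f x (delta_mx 0 i).

(* Components T_{ij} or T_i^j of a 2-tensor field on the torus; for (1,1)
   tensors the first index is the lower one. *)
Definition tensor (R : realType) (D : nat) : Type :=
  'I_D -> 'I_D -> 'rV[R]_D -> R.

Definition tensor_smooth (R : realType) (D : nat) (T : tensor R D) : Prop :=
  forall i j : 'I_D, torus_smooth (T i j).

Definition tensor_trace (R : realType) (D : nat) (T : tensor R D) :
    'rV[R]_D -> R :=
  fun x => \sum_(i < D) T i i x.

Definition kasner_exponents (R : realType) (D : nat) (p : 'I_D -> R)
    (pphi : R) : Prop :=
  \sum_(i < D) p i = 1 /\ \sum_(i < D) p i ^+ 2 + 2 * pphi ^+ 2 = 1.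

Definition subcritical (R : realType) (D : nat) (p : 'I_D -> R) : Prop :=
  forall i j k : 'I_D, i != j -> p i + p j - p k < 1.

(* The unknowns (h_{ij}, kappa_{ij}, phi, psi) on one time slice. *)
Record state (R : realType) (D : nat) : Type := State {
  st_h : tensor R D;
  st_kappa : tensor R D;
  st_phi : 'rV[R]_D -> R;
  st_psi : 'rV[R]_D -> R
}.

Definition state_smooth (R : realType) (D : nat) (S : state R D) : Prop :=
  [/\ tensor_smooth (st_h S), tensor_smooth (st_kappa S),
      torus_smooth (st_phi S) & torus_smooth (st_psi S)].

Section LinearizedSystem.
Variables (R : realType) (D : nat) (p : 'I_D -> R) (pphi : R).

Definition eta (t : R) (S : state R D) : tensor R D :=
  fun i j x => - 2^-1 * t `^ (- (2 * p j)) * st_h S i j x.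

Definition curvK (t : R) (S : state R D) : tensor R D :=
  fun i j x => t `^ (- (2 * p j)) * (st_kappa S i j x + p i * st_h S i j x).

Definition laplacian (t : R) (f : 'rV[R]_D -> R) : 'rV[R]_D -> R :=
  fun x => \sum_(a < D) t `^ (- (2 * p a)) * partial a (partial a f) x.

Definition constraints (t : R) (S : state R D) : Prop :=
  let h := st_h S in let kappa := st_kappa S in
  let phi := st_phi S in let psi := st_psi S in
  let e := eta t S in let K := curvK t S in
  [/\ forall x, tensor_trace K x = 0,
      forall x,
        - 2 * t ^+ 2 * laplacian t (tensor_trace e) x
        + 2 * (\sum_(a < D) \sum_(i < D)
                 t `^ (2 - 2 * p a) * partial i (partial a (e a i)) x)
        - 2 * (\sum_(a < D) p a * K a a x)
        + 4 * pphi * psi x = 0,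
      forall i x,
        \sum_(j < D) partial j (K i j) x
        + partial i (fun y => - (\sum_(a < D) p a * e a a y)
                              + 2 * pphi * phi y) x
        + p i * partial i (tensor_trace e) x = 0,
      forall i j x, h i j x = h j i x
    & forall i j x, kappa i j x = kappa j i x].

Definition lapse_equation (t : R) (S : state R D) (nu : 'rV[R]_D -> R) : Prop :=
  let e := eta t S in
  forall x,
    nu x - t ^+ 2 * laplacian t nu x =
      - 2 * t ^+ 2 * laplacian t (tensor_trace e) x
      + 2 * (\sum_(a < D) \sum_(i < D)
               t `^ (2 - 2 * p a) * partial i (partial a (e a i)) x).

Definition evolution_equations (S : R -> state R D) (nu : R -> 'rV[R]_D -> R)
    (t : R) : Prop :=
  let e := eta t (S t) in let K := curvK t (S t) in
  [/\ forall i j x,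
        t * derive1 (fun s => eta s (S s) i j x) t =
          K i j x + 2 * (p i - p j) * e i j x - p i * (i == j)%:R * nu t x,
      forall i j x,
        t * derive1 (fun s => curvK s (S s) i j x) t =
          t ^+ 2 *
            (laplacian t (e i j) x
             + t `^ (- (2 * p j)) * partial i (partial j (tensor_trace e)) x
             - \sum_(a < D)
                 t `^ (- (2 * p a)) * partial i (partial a (e a j)) x
             - t `^ (- (2 * p j)) *
                 \sum_(b < D) partial j (partial b (e i b)) x)
          - t `^ (2 - 2 * p j) * partial i (partial j (nu t)) x
          + p i * (i == j)%:R * nu t x,
      forall x,
        t * derive1 (fun s => st_phi (S s) x) t =
          st_psi (S t) x + pphi * nu t x
    & forall x,
        t * derive1 (fun s => st_psi (S s) x) t =
          t ^+ 2 * laplacian t (st_phi (S t)) x - pphi * nu t x].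

Definition smooth_solution (S : R -> state R D) (nu : R -> 'rV[R]_D -> R) :
    Prop :=
  [/\ forall i j, spacetime_smooth (fun t => st_h (S t) i j),
      forall i j, spacetime_smooth (fun t => st_kappa (S t) i j),
      spacetime_smooth (fun t => st_phi (S t)),
      spacetime_smooth (fun t => st_psi (S t))
    & spacetime_smooth nu] /\
  (forall t : R, 0 < t ->
    [/\ evolution_equations S nu t,
        lapse_equation t (S t) (nu t)
      & constraints t (S t)]).

End LinearizedSystem.

(* u(t, x) = o(g(t)) as t -> 0+, uniformly in x. *)
Definition little_o_at0 (R : realType) (D : nat) (u : R -> 'rV[R]_D -> R)
    (g : R -> R) : Prop :=
  forall eps : R, 0 < eps ->
    \forall t \near (0 : R)^'+, forall x, `|u t x| <= eps * `|g t|.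

(* Main.v *)
Require Import Defs.
From HB Require Import structures.
From mathcomp Require Import all_boot all_order all_algebra.
From mathcomp Require Import all_classical all_reals all_analysis.
From mathcomp Require Import ring lra.
Import Order.TTheory GRing.Theory Num.Theory.
Import numFieldNormedType.Exports.

(** Write the unknowns in the orthonormal frame: H_ij = t^(p_j - p_i) eta_i^j,
    L_ij = t^(p_j - p_i) K_i^j and e_i = t^(1 - p_i) d_i. At each time this is
    a system with constant coefficients, and H is symmetric. Let E(t) be the mean
    over the torus of the sum of the squares of H, L, e_a H, phi, psi, e_a phi.
    Then |t E'(t)| <= C E(t) with C depending on the exponents only. Indeed, the
    second derivatives in the equation for L are a wave operator, up to terms
    which, contracted with L and integrated by parts, contain a divergence of L;
    the momentum constraint makes this divergence a first derivative of H and phi,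
    and the lapse is controlled through its elliptic equation
    ([energy_rate_mean_controlled]). Hence E(t) <= t^(-N) E(1) for t <= 1, with
    the same N for all solutions ([energy_growth]).

    The coefficients do not depend on x, so every spatial derivative of the
    solution is again a solution and obeys this bound with the same N. By a Sobolev
    inequality, the spatial derivatives of all orders are pointwise O(t^(-A)) with
    one exponent A ([frame_solution_tame]). From here on derivatives may be lost
    freely, and the equations are read as ordinary differential equations in t with
    the terms containing spatial derivatives as sources. Among the two components
    eta_i^j and eta_j^i, that with p_j <= p_i is expected to be almost bounded, and
    the other one follows by symmetry of h. If these components and phi are
    O(t^(-B)), the sources in the equations for K_i^j (p_j <= p_i), psi and the
    lapse are O(t^(e-B)) for some e > 0: the exponents that occur are 2 - 2 p_a,
    2 - 2 max(p_a, p_b) and 2 - 2 p_j - 2 p_b + 2 p_i with j, b distinct, and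
    subcriticality says that they are positive ([tame_logD_curvK],
    [tame_lapse]). Integrating the equations improves B to B - e as long as
    B > e ([boot_step]), so that finitely many rounds make all sources O(t^(e/2))
    ([boot_end]).

    Such sources are integrable with respect to dt/t. Therefore K_i^j (p_j <= p_i),
    psi, phi - psi log t and, for p_i = p_j, eta_i^j - K_i^j log t converge as t
    tends to 0 together with all derivatives, and the limits are smooth
    ([tame_limit]). For p_j < p_i, the equation for eta_i^j forces it to tend to
    - K_i^j / (2 (p_i - p_j)) ([eta_curvK_vanishing]). These are the asymptotics of
    the theorem; for p_i and p_j distinct they only see the leading power, and the
    limit tensors are chosen so that the coefficient of the other power vanishes.

    The mean over the torus is an iterated limit of Riemann sums along a free
    ultrafilter. It is a positive linear functional on bounded functions which, on
    smooth periodic functions, annihilates derivatives, commutes with d/dt and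
    satisfies a Sobolev inequality; the energy method needs nothing else. *)

Set Implicit Arguments.
Unset Strict Implicit.
Unset Printing Implicit Defensive.

Local Open Scope classical_set_scope.
Local Open Scope ring_scope.

(** * Calculus of smooth functions on an open set *)

Section Smooth.
Variables (R : realType) (V : normedModType R) (A : set V).
Implicit Types (f g : V -> R) (v : V) (vs : seq V).

Lemma smooth_on_continuous f z : smooth_on A f -> A z -> {for z, continuous f}.
Proof. by move=> sf Az; have [] := sf [::] z Az. Qed.

Lemma smooth_on_derivable f z v : smooth_on A f -> A z -> derivable f z v.
Proof. by move=> sf Az; have [_] := sf [::] z Az; exact. Qed.

Lemma smooth_on_derive f v : smooth_on A f -> smooth_on A (derive f ^~ v).
Proof. by move=> sf vs z Az; have := sf (rcons vs v) z Az; rewrite foldr_rcons. Qed.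

Hypothesis openA : open A.

Lemma derive_eq_on f g z v :
  A z -> (forall y, A y -> f y = g y) -> 'D_v f z = 'D_v g z.
Proof.
move=> Az fg; have [->|v0] := eqVneq v 0; first by rewrite !derive0.
apply: near_eq_derive => //.
by apply: filterS (open_nbhs_nbhs (conj openA Az)) => y /fg.
Qed.

Lemma derivable_eq_on f g z v :
  A z -> (forall y, A y -> f y = g y) -> derivable f z v -> derivable g z v.
Proof.
move=> Az fg; have [->|v0] := eqVneq v 0; first by move=> _; exact: derivable0.
apply: near_eq_derivable => //.
by apply: filterS (open_nbhs_nbhs (conj openA Az)) => y /fg.
Qed.

Lemma continuous_eq_on f g z :
  A z -> (forall y, A y -> f y = g y) -> {for z, continuous f} ->
  {for z, continuous g}.
Proof.
move=> Az fg cf; rewrite /prop_for /continuous_at -fg//.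
apply: cvg_trans cf; apply: near_eq_cvg.
by apply: filterS (open_nbhs_nbhs (conj openA Az)) => y /fg ->.
Qed.

(** Smoothness quantifies over all iterated derivatives, so it is proved by
    exhibiting a class of functions stable under differentiation. Stability is
    only asked up to equality on A, because the differentiation rules for the
    closed forms that occur hold on A only. *)
Lemma smooth_on_coind (P : (V -> R) -> Prop) :
  (forall f, P f ->
     (forall z, A z -> {for z, continuous f} /\ forall v, derivable f z v) /\
     forall v, exists2 g, P g & forall z, A z -> 'D_v f z = g z) ->
  forall f, P f -> smooth_on A f.
Proof.
move=> PP f Pf vs z Az.
suff [g [Pg fg]] : exists g, P g /\
    forall y, A y -> foldr (fun v u => derive u ^~ v) f vs y = g y.
  have [/(_ z Az)[cg dg] _] := PP _ Pg.
  split; first by apply: continuous_eq_on cg => // y /fg.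
  by move=> v; apply: derivable_eq_on (dg v) => // y /fg.
elim: vs => [|v vs [g [Pg fg]]]; first by exists f.
have [_ /(_ v)[g' Pg' gg']] := PP _ Pg.
by exists g'; split=> // y Ay /=; rewrite (derive_eq_on _ Ay fg) gg'.
Qed.

Lemma smooth_on_eq f g :
  (forall y, A y -> f y = g y) -> smooth_on A f -> smooth_on A g.
Proof.
move=> fg sf.
apply: (@smooth_on_coind (fun g => exists2 f, smooth_on A f &
   forall y, A y -> f y = g y)); last by exists f.
move=> {f g fg sf} g [f sf fg]; split=> [z Az|v].
  split; first by apply: continuous_eq_on fg _ => //; exact: smooth_on_continuous.
  by move=> v; apply: derivable_eq_on fg _ => //; exact: smooth_on_derivable.
exists (derive f ^~ v); last by move=> z Az; rewrite (derive_eq_on _ Az fg).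
by exists (derive f ^~ v) => //; exact: smooth_on_derive.
Qed.

(** The class to which coinduction is applied for sums and products: a derivative
    of a product is not a product, but it stays in this algebra. *)
Inductive smooth_alg : (V -> R) -> Prop :=
| smooth_alg_base f : smooth_on A f -> smooth_alg f
| smooth_alg_add f g : smooth_alg f -> smooth_alg g -> smooth_alg (f + g)
| smooth_alg_mul f g : smooth_alg f -> smooth_alg g -> smooth_alg (f * g).

Lemma smooth_alg_smooth f : smooth_alg f -> smooth_on A f.
Proof.
apply: smooth_on_coind => {}f; elim=> {f}
    [f sf|f g sf [rf df] sg [rg dg]|f g sf [rf df] sg [rg dg]].
- split; first by move=> z Az; split=> [|v];
    [exact: smooth_on_continuous|exact: smooth_on_derivable].
  by move=> v; exists (derive f ^~ v) => //; apply/smooth_alg_base/smooth_on_derive.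
- split.
    move=> z Az; have [cf ddf] := rf z Az; have [cg ddg] := rg z Az.
    split; first exact: continuousD.
    by move=> v; exact: derivableD.
  move=> v; have [f' sf' ff'] := df v; have [g' sg' gg'] := dg v.
  exists (f' + g'); first exact: smooth_alg_add.
  move=> z Az; have [cf ddf] := rf z Az; have [cg ddg] := rg z Az.
  by rewrite deriveD// ff'// gg'.
- split.
    move=> z Az; have [cf ddf] := rf z Az; have [cg ddg] := rg z Az.
    split; first exact: continuousM.
    by move=> v; exact: derivableM.
  move=> v; have [f' sf' ff'] := df v; have [g' sg' gg'] := dg v.
  exists (f * g' + g * f').
    by apply: smooth_alg_add; exact: smooth_alg_mul.
  move=> z Az; have [cf ddf] := rf z Az; have [cg ddg] := rg z Az.
  by rewrite deriveM// ff'// gg'.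
Qed.

Lemma smooth_on_cst (c : R) : smooth_on A (cst c).
Proof.
apply: (@smooth_on_coind (fun f => exists c, f = cst c)); last by exists c.
move=> f [{}c ->]; split=> [z Az|v]; first by split=> [|v]; [exact: cst_continuous|exact: derivable_cst].
by exists (cst 0) => [|z _]; [exists 0|rewrite derive_cst].
Qed.

Lemma smooth_onD f g : smooth_on A f -> smooth_on A g -> smooth_on A (f + g).
Proof. by move=> sf sg; apply/smooth_alg_smooth/smooth_alg_add; exact: smooth_alg_base. Qed.

Lemma smooth_onM f g : smooth_on A f -> smooth_on A g -> smooth_on A (f * g).
Proof. by move=> sf sg; apply/smooth_alg_smooth/smooth_alg_mul; exact: smooth_alg_base. Qed.

Lemma is_derive_line f z v s : derivable f (s *: v + z) v ->
  is_derive s (1:R) (fun s => f (s *: v + z)) ('D_v f (s *: v + z)).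
Proof.
have e : (fun h : R => h^-1 *: (((fun s0 : R => f (s0 *: v + z)) \o shift s) (h *: 1)
    - f (s *: v + z))) =
  (fun h : R => h^-1 *: ((f \o shift (s *: v + z)) (h *: v) - f (s *: v + z))).
  by apply/funext => h /=; rewrite scaler1 scalerDl addrA.
by move=> df; split; rewrite /derivable /derive /= e.
Qed.

(** Smoothness is expressed by directional derivatives; the mean value theorem on
    lines is how they control the increments of a function. *)
Lemma MVT_line f z v (h : R) : 0 < h ->
  (forall s, 0 <= s <= h -> derivable f (s *: v + z) v) ->
  exists2 s, 0 <= s <= h & f (h *: v + z) - f z = h * 'D_v f (s *: v + z).
Proof.
move=> h0 df.
have [||s shs E] := @MVT_segment R (fun s => f (s *: v + z))
   (fun s => 'D_v f (s *: v + z)) 0 h (ltW h0).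
- move=> s; rewrite in_itv/= => /andP[s0 sh].
  by apply: is_derive_line; apply: df; rewrite !ltW.
- apply: derivable_within_continuous => s; rewrite in_itv/= => hs.
  by have [] := is_derive_line (df s hs).
- exists s; first by move: shs; rewrite in_itv.
  by move: E; rewrite scale0r add0r subr0 mulrC.
Qed.

Lemma growth_rate_shift f z y v :
  (fun h : R => h^-1 *: (((fun x => f (y + x)) \o shift z) (h *: v) - f (y + z)))
  = (fun h : R => h^-1 *: ((f \o shift (y + z)) (h *: v) - f (y + z))).
Proof. by apply/funext => h /=; rewrite addrCA. Qed.

Lemma derive_shift_line f z y v : 'D_v (fun x => f (y + x)) z = 'D_v f (y + z).
Proof. by rewrite /derive growth_rate_shift. Qed.

Lemma derivable_shift_line f z y v :
  derivable f (y + z) v -> derivable (fun x => f (y + x)) z v.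
Proof. by rewrite /derivable growth_rate_shift. Qed.

Definition parallelogram z v w (h : R) (y : V) := exists s t : R,
  [/\ 0 <= s <= h, 0 <= t <= h & y = s *: v + (t *: w + z)].

Lemma parallelogramC z v w h y : parallelogram z v w h y -> parallelogram z w v h y.
Proof. by move=> [s [t [hs ht ->]]]; exists t, s; split=> //; exact: addrCA. Qed.

(** Two applications of the mean value theorem. The left-hand side is symmetric
    in v and w, and the symmetry of second derivatives follows. *)
Lemma second_difference f z v w (h : R) : smooth_on A f -> 0 < h ->
  (forall y, parallelogram z v w h y -> A y) ->
  exists2 y, parallelogram z v w h y &
    f (h *: v + (h *: w + z)) - f (h *: w + z) - (f (h *: v + z) - f z) =
    h * (h * 'D_v ('D_w f) y).
Proof.
move=> sf h0 hA'.
have hA s t : 0 <= s <= h -> 0 <= t <= h -> A (s *: v + (t *: w + z)).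
  by move=> hs ht; apply: hA'; exists s, t.
have hh : 0 <= h <= h by rewrite lexx ltW.
have h00 : 0 <= (0 : R) <= h by rewrite lexx ltW.
have Aw t : 0 <= t <= h -> A (t *: w + z).
  by move=> ht; have := hA 0 t h00 ht; rewrite scale0r add0r.
have d1 t : 0 <= t <= h -> derivable (fun y => f (h *: v + y)) (t *: w + z) w.
  move=> ht; apply: derivable_shift_line; apply: smooth_on_derivable => //.
  exact: hA.
have [|t ht E] := @MVT_line (fun y => f (h *: v + y) - f y) z w h h0.
  move=> t ht; apply: derivableB; first exact: d1.
  by apply: smooth_on_derivable => //; exact: Aw.
have [|s hs E'] := @MVT_line ('D_w f) (t *: w + z) v h h0.
  by move=> s hs; apply: smooth_on_derivable; [exact: smooth_on_derive|exact: hA].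
exists (s *: v + (t *: w + z)); first by exists s, t.
rewrite -E' E deriveB ?derive_shift_line//; first exact: d1.
by apply: smooth_on_derivable => //; exact: Aw.
Qed.

(** The two mixed derivatives take a common value at two points that are a priori
    different but both tend to z with h. *)
Lemma eq_of_nearby_values (g1 g2 : V -> R) z v w : A z ->
  {for z, continuous g1} -> {for z, continuous g2} ->
  (forall h : R, 0 < h -> (forall y, parallelogram z v w h y -> A y) ->
    exists y1 y2, [/\ parallelogram z v w h y1, parallelogram z v w h y2 &
      g1 y1 = g2 y2]) ->
  g1 z = g2 z.
Proof.
move=> Az c1 c2 hE.
apply/eqP; rewrite -subr_eq0 -normr_le0; apply/ler_addgt0Pr => e e0.
rewrite add0r; have e20 : 0 < e / 2 by rewrite divr_gt0.
pose F (st : R^o * R^o) := st.1 *: v + (st.2 *: w + z) : V.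
have F0 : F (0, 0) = z by rewrite /F /= !scale0r !add0r.
have cF : F @ (0, 0) --> z.
  rewrite -[X in _ --> X]F0; apply: cvgD; first by apply: cvgZr_tmp; exact: cvg_fst.
  apply: cvgD; last exact: cvg_cst.
  by apply: cvgZr_tmp; exact: cvg_snd.
have nA : \forall st \near ((0, 0) : R^o * R^o), A (F st).
  by apply: cF; exact: (open_nbhs_nbhs (conj openA Az)).
have n1 : \forall st \near ((0, 0) : R^o * R^o), `|g1 z - g1 (F st)| < e / 2.
  by move/cvgrPdist_lt : c1 => /(_ _ e20) /cF.
have n2 : \forall st \near ((0, 0) : R^o * R^o), `|g2 z - g2 (F st)| < e / 2.
  by move/cvgrPdist_lt : c2 => /(_ _ e20) /cF.
have [[U1 U2] /= [/nbhs_ballP[d1 /= d10 dU1] /nbhs_ballP[d2 /= d20 dU2]] UP] :=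
  filterI nA (filterI n1 n2).
pose h := Num.min d1 d2 / 2.
have m0 : 0 < Num.min d1 d2 by rewrite lt_min d10.
have h0 : 0 < h by rewrite divr_gt0.
have hd : h < Num.min d1 d2 by rewrite ltr_pdivrMr// ltr_pMr// ltr1n.
have hP y : parallelogram z v w h y -> [/\ A y,
    `|g1 z - g1 y| < e / 2 & `|g2 z - g2 y| < e / 2].
  move=> [s [t [/andP[s0 sh] /andP[t0 th] ->]]].
  have [] := UP (s, t); last by move=> ? [].
  move: hd; rewrite lt_min => /andP[hd1 hd2].
  by split; [apply: dU1|apply: dU2];
    rewrite /ball/= sub0r normrN ger0_norm// (le_lt_trans _ hd1, le_lt_trans _ hd2).
have [|y1 [y2 [hy1 hy2 E]]] := hE h h0; first by move=> y /hP[].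
have [_ i1 _] := hP _ hy1; have [_ _] := hP _ hy2.
rewrite -E distrC => i2.
rewrite [e]splitr (le_trans _ (lerD (ltW i1) (ltW i2)))//.
by rewrite (le_trans _ (ler_normD _ _))// addrA subrK.
Qed.

Lemma derive_schwarz f z v w : smooth_on A f -> A z ->
  'D_v ('D_w f) z = 'D_w ('D_v f) z.
Proof.
move=> sf Az; have cD a b : {for z, continuous ('D_a ('D_b f))}.
  exact: (smooth_on_continuous (smooth_on_derive a (smooth_on_derive b sf)) Az).
apply: (@eq_of_nearby_values ('D_v ('D_w f)) ('D_w ('D_v f)) z v w Az (cD v w) (cD w v)).
move=> h h0 hA.
have [y1 hy1 D1] := @second_difference f z v w h sf h0 hA.
have [y hy|y2 hy2 D2] := @second_difference f z w v h sf h0.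
  exact/hA/parallelogramC.
exists y1, y2; split; [exact: hy1|exact: parallelogramC|].
have hI (a b : R) : h * (h * a) = h * (h * b) -> a = b.
  by move=> /mulfI - /(_ (lt0r_neq0 h0)) /mulfI; apply; exact: lt0r_neq0.
apply: hI; rewrite -[LHS]D1 -[RHS]D2.
have -> : h *: w + (h *: v + z) = h *: v + (h *: w + z) := addrCA _ _ _.
move: (f _) (f _) (f _) (f _) => a b c d; ring.
Qed.

End Smooth.

(** * Smooth functions on the torus and on spacetime *)

Section Torus.
Variables (R : realType) (D : nat).
Local Notation V := 'rV[R]_D.
Implicit Types (f g : V -> R) (v w : V).

(** A named derivative on time slices, so that rewriting never has to look
    through the limit that defines it. *)
Definition dirD v f : V -> R := fun x => 'D_v f x.

Lemma torus_smooth_continuous f : torus_smooth f -> continuous f.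
Proof. by move=> [_ sf] x; exact: (smooth_on_continuous sf I). Qed.

Lemma torus_smooth_is_derive f v x : torus_smooth f -> is_derive x v f (dirD v f x).
Proof. by move=> [_ sf]; apply: derivableP; exact: (@smooth_on_derivable _ _ _ _ x v sf I). Qed.

Lemma torus_smooth_dirD v f : torus_smooth f -> torus_smooth (dirD v f).
Proof.
move=> [pf sf]; split; last exact: smooth_on_derive.
move=> i x; rewrite /dirD /derive.
(* the difference quotients at x and at its translate agree *)
have -> : (fun h : R => h^-1 *: ((f \o shift (x + (2 * pi) *: delta_mx 0 i)) (h *: v)
      - f (x + (2 * pi) *: delta_mx 0 i))) =
  (fun h : R => h^-1 *: ((f \o shift x) (h *: v) - f x)); last by [].
by apply/funext => h /=; rewrite addrA !pf.
Qed.

Lemma torus_smooth_cst (c : R) : torus_smooth (fun _ : V => c).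
Proof. by split=> //; apply: smooth_on_cst; exact: openT. Qed.

Lemma torus_smoothD f g : torus_smooth f -> torus_smooth g ->
  torus_smooth (fun x => f x + g x).
Proof.
move=> [pf sf] [pg sg]; split; first by move=> i x; rewrite pf pg.
by apply: smooth_onD; [exact: openT|exact: sf|exact: sg].
Qed.

Lemma torus_smoothM f g : torus_smooth f -> torus_smooth g ->
  torus_smooth (fun x => f x * g x).
Proof.
move=> [pf sf] [pg sg]; split; first by move=> i x; rewrite pf pg.
by apply: smooth_onM; [exact: openT|exact: sf|exact: sg].
Qed.

Lemma torus_smoothZ c f : torus_smooth f -> torus_smooth (fun x => c * f x).
Proof. by move=> sf; exact: (torus_smoothM (torus_smooth_cst c) sf). Qed.

Lemma torus_smoothN f : torus_smooth f -> torus_smooth (fun x => - f x).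
Proof.
move=> sf; have := torus_smoothZ (-1) sf.
by congr torus_smooth; apply/funext => x; rewrite mulN1r.
Qed.

Lemma torus_smoothB f g : torus_smooth f -> torus_smooth g ->
  torus_smooth (fun x => f x - g x).
Proof. by move=> sf sg; exact: (torus_smoothD sf (torus_smoothN sg)). Qed.

Lemma torus_smooth_sum (I : Type) (r : seq I) (F : I -> V -> R) :
  (forall i, torus_smooth (F i)) -> torus_smooth (fun x => \sum_(i <- r) F i x).
Proof.
move=> sF; elim: r => [|i r IH].
  have := torus_smooth_cst 0; congr torus_smooth.
  by apply/funext => x; rewrite big_nil.
have := torus_smoothD (sF i) IH; congr torus_smooth.
by apply/funext => x; rewrite big_cons.
Qed.

Lemma dirD_cst v (c : R) : dirD v (fun=> c) = fun=> 0.
Proof. by apply/funext => x; exact: derive_cst. Qed.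

Lemma dirDD v f g : torus_smooth f -> torus_smooth g ->
  dirD v (fun x => f x + g x) = fun x => dirD v f x + dirD v g x.
Proof.
move=> sf sg; apply/funext => x.
have df := torus_smooth_is_derive v x sf; have dg := torus_smooth_is_derive v x sg.
exact: (@derive_val _ _ _ _ _ _ _ (is_deriveD df dg)).
Qed.

Lemma dirDM v f g : torus_smooth f -> torus_smooth g ->
  dirD v (fun x => f x * g x) = fun x => f x * dirD v g x + g x * dirD v f x.
Proof.
move=> sf sg; apply/funext => x.
have df := torus_smooth_is_derive v x sf; have dg := torus_smooth_is_derive v x sg.
exact: (@derive_val _ _ _ _ _ _ _ (is_deriveM df dg)).
Qed.

Lemma dirDZ v c f : torus_smooth f ->
  dirD v (fun x => c * f x) = fun x => c * dirD v f x.
Proof.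
move=> sf; rewrite (dirDM v (torus_smooth_cst c) sf) dirD_cst.
by apply/funext => x; rewrite mulr0 addr0.
Qed.

Lemma dirDN v f : torus_smooth f ->
  dirD v (fun x => - f x) = fun x => - dirD v f x.
Proof.
move=> sf; rewrite (_ : (fun x => - f x) = (fun x => -1 * f x)).
  by rewrite dirDZ//; apply/funext => x; rewrite mulN1r.
by apply/funext => x; rewrite mulN1r.
Qed.

Lemma dirDB v f g : torus_smooth f -> torus_smooth g ->
  dirD v (fun x => f x - g x) = fun x => dirD v f x - dirD v g x.
Proof. by move=> sf sg; rewrite (dirDD v sf (torus_smoothN sg)) (dirDN v sg). Qed.

Lemma dirD_sum v (I : Type) (r : seq I) (F : I -> V -> R) :
  (forall i, torus_smooth (F i)) ->
  dirD v (fun x => \sum_(i <- r) F i x) = fun x => \sum_(i <- r) dirD v (F i) x.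
Proof.
move=> sF; elim: r => [|i r IH].
  rewrite (_ : (fun x => _) = fun=> 0) ?dirD_cst.
    by apply/funext => x; rewrite big_nil.
  by apply/funext => x; rewrite big_nil.
rewrite (_ : (fun x => _) = fun x => F i x + \sum_(i <- r) F i x).
  rewrite dirDD ?IH//; last exact: torus_smooth_sum.
  by apply/funext => x; rewrite big_cons.
by apply/funext => x; rewrite big_cons.
Qed.

Lemma dirDC v w f : torus_smooth f -> dirD v (dirD w f) = dirD w (dirD v f).
Proof.
by move=> [_ sf]; apply/funext => x; exact: (derive_schwarz (@openT _) v w sf I).
Qed.

End Torus.

Section Spacetime.
Variables (R : realType) (D : nat).
Local Notation V := 'rV[R]_D.
Implicit Types (u w : R -> V -> R) (v : V) (t : R).

Definition uncurried u : (R^o * V)%type -> R := fun z => u z.1 z.2.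
(** The domain of spacetime fields, as a subset of the normed space in which
    their joint smoothness is expressed. *)
Definition future : set (R^o * V)%type := [set z | (0 : R) < z.1].

Definition spaceD v u : R -> V -> R := fun t => dirD v (u t).
Definition timeD u : R -> V -> R := fun t x => derive1 (u^~ x) t.

Lemma open_future : open future.
Proof.
have -> : future = (@fst R^o V) @^-1` [set t : R | 0 < t] by [].
by apply: open_comp => [z _|]; [exact: cvg_fst|exact: open_gt].
Qed.

Lemma spaceD_uncurried v u t x : spaceD v u t x = 'D_(0, v) (uncurried u) (t, x).
Proof.
rewrite /spaceD /dirD /derive.
suff -> : (fun h : R => h^-1 *: ((uncurried u \o shift (t, x)) (h *: (0, v))
   - uncurried u (t, x))) = (fun h => h^-1 *: ((u t \o shift x) (h *: v) - u t x)) by [].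
by apply/funext => h; rewrite /uncurried/= scaler0 add0r.
Qed.

Lemma timeD_uncurried u t x : timeD u t x = 'D_(1, 0) (uncurried u) (t, x).
Proof.
rewrite /timeD derive1E /derive.
suff -> : (fun h : R => h^-1 *: ((uncurried u \o shift ((t : R^o), x)) (h *: (1, 0))
   - uncurried u (t, x))) =
   (fun h : R => h^-1 *: ((u^~ x \o shift t) (h *: 1) - u t x)) by [].
by apply/funext => h; rewrite /uncurried/= scaler0 add0r.
Qed.

Lemma spacetime_smooth_eq u w : (forall t x, 0 < t -> u t x = w t x) ->
  spacetime_smooth u -> spacetime_smooth w.
Proof.
move=> uw [pu su]; split.
  by move=> t t0 i x; rewrite -!uw// pu.
by apply: (smooth_on_eq open_future _ su) => z z0; exact: uw.
Qed.

Lemma spacetime_smooth_continuous u t x : spacetime_smooth u -> 0 < t ->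
  {for (t, x), continuous (uncurried u)}.
Proof. by move=> [_ su] t0; exact: (smooth_on_continuous su). Qed.

Lemma spacetime_smooth_spaceD v u : spacetime_smooth u -> spacetime_smooth (spaceD v u).
Proof.
move=> [pu su]; split.
  move=> t t0 i x; rewrite /spaceD /dirD /derive.
  have -> : (fun h : R => h^-1 *: ((u t \o shift (x + (2 * pi) *: delta_mx 0 i)) (h *: v)
      - u t (x + (2 * pi) *: delta_mx 0 i))) =
    (fun h : R => h^-1 *: ((u t \o shift x) (h *: v) - u t x)); last by [].
  by apply/funext => h /=; rewrite addrA !pu.
have sd := smooth_on_derive ((0 : R^o), v) su.
apply: (@smooth_on_eq _ _ _ open_future _ (uncurried (spaceD v u)) _ sd) => -[t x] _.
by rewrite /uncurried /= spaceD_uncurried.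
Qed.

Lemma spacetime_smooth_timeD u : spacetime_smooth u -> spacetime_smooth (timeD u).
Proof.
move=> [pu su]; split.
  move=> t t0 i x; rewrite /timeD !derive1E; apply: near_eq_derive.
  by near=> s; apply: pu; near: s; exact: lt_nbhsr.
have sd := smooth_on_derive ((1 : R^o), (0 : V)) su.
apply: (@smooth_on_eq _ _ _ open_future _ (uncurried (timeD u)) _ sd) => -[t x] _.
by rewrite /uncurried /= timeD_uncurried.
Unshelve. all: by end_near. Qed.

Lemma spacetime_smooth_slice u t : spacetime_smooth u -> 0 < t -> torus_smooth (u t).
Proof.
move=> su t0; split; first by case: su => pu _; exact: pu.
apply: (@smooth_on_coind _ _ _ (@openT _)
  (fun f => exists2 u, spacetime_smooth u & f = u t)); last by exists u.
move=> {u su} _ [u su ->]; split=> [x _|v]; last first.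
  exists (spaceD v u t); last by [].
  by exists (spaceD v u); [exact: spacetime_smooth_spaceD|].
split=> [|v].
  have c : {for x, continuous (fun y : V => ((t : R^o), y))}.
    exact: (cvg_pair (@cvg_cst _ (t : R^o) _ _ _) (@cvg_id _ (nbhs x))).
  exact: (@continuous_comp _ _ _ (fun y : V => ((t : R^o), y)) (uncurried u) x c
    (spacetime_smooth_continuous su t0)).
case: su => _ /(@smooth_on_derivable _ _ _ _ (t, x) (0, v)) /(_ t0).
rewrite /derivable.
suff -> : (fun h : R => h^-1 *: (((fun z => u z.1 z.2) \o shift ((t : R^o), x)) (h *: (0, v))
   - u t x)) = (fun h : R => h^-1 *: ((u t \o shift x) (h *: v) - u t x)) by [].
by apply/funext => h; rewrite /= scaler0 add0r.
Qed.

Lemma spacetime_smooth_is_derive u t x : spacetime_smooth u -> 0 < t ->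
  is_derive t (1 : R) (u^~ x) (timeD u t x).
Proof.
move=> [_ su] t0; have := @smooth_on_derivable _ _ _ _ (t, x) (1, 0) su t0.
have E : (fun h : R => h^-1 *: (((fun z => u z.1 z.2) \o shift ((t : R^o), x)) (h *: (1, 0))
   - u t x)) = (fun h : R => h^-1 *: ((u^~ x \o shift t) (h *: 1) - u t x)).
  by apply/funext => h; rewrite /= scaler0 add0r.
rewrite /derivable E => d.
by rewrite /timeD derive1E; apply: derivableP.
Qed.

Lemma timeD_spaceD v u t x : spacetime_smooth u -> 0 < t ->
  timeD (spaceD v u) t x = spaceD v (timeD u) t x.
Proof.
move=> [_ su] t0; rewrite timeD_uncurried spaceD_uncurried.
have -> : uncurried (spaceD v u) = 'D_(0, v) (uncurried u).
  by apply/funext => -[s y]; rewrite -spaceD_uncurried.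
have -> : uncurried (timeD u) = 'D_(1, 0) (uncurried u).
  by apply/funext => -[s y]; rewrite -timeD_uncurried.
exact: (derive_schwarz open_future).
Qed.

Lemma spacetime_smoothD u w : spacetime_smooth u -> spacetime_smooth w ->
  spacetime_smooth (fun t x => u t x + w t x).
Proof.
move=> [pu su] [pw sw]; split; first by move=> t t0 i x; rewrite pu// pw.
by apply: smooth_onD; [exact: open_future|exact: su|exact: sw].
Qed.

Lemma spacetime_smoothM u w : spacetime_smooth u -> spacetime_smooth w ->
  spacetime_smooth (fun t x => u t x * w t x).
Proof.
move=> [pu su] [pw sw]; split; first by move=> t t0 i x; rewrite pu// pw.
by apply: smooth_onM; [exact: open_future|exact: su|exact: sw].
Qed.

Lemma spacetime_smooth_cst c : spacetime_smooth (fun (_ : R) (_ : V) => c).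
Proof. by split=> //; apply: smooth_on_cst; exact: open_future. Qed.

Lemma spacetime_smoothZ c u : spacetime_smooth u ->
  spacetime_smooth (fun t x => c * u t x).
Proof. by move=> su; exact: (spacetime_smoothM (spacetime_smooth_cst c) su). Qed.

Lemma spacetime_smoothN u : spacetime_smooth u -> spacetime_smooth (fun t x => - u t x).
Proof.
move=> su; apply: spacetime_smooth_eq (spacetime_smoothZ (-1) su) => t x _.
by rewrite mulN1r.
Qed.

Lemma spacetime_smoothB u w : spacetime_smooth u -> spacetime_smooth w ->
  spacetime_smooth (fun t x => u t x - w t x).
Proof. by move=> su sw; exact: (spacetime_smoothD su (spacetime_smoothN sw)). Qed.

Lemma spacetime_smooth_sum (I : Type) (r : seq I) (F : I -> R -> V -> R) :
  (forall i, spacetime_smooth (F i)) ->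
  spacetime_smooth (fun t x => \sum_(i <- r) F i t x).
Proof.
move=> sF; elim: r => [|i r IH].
  by apply: spacetime_smooth_eq (spacetime_smooth_cst 0) => t x _; rewrite big_nil.
by apply: spacetime_smooth_eq (spacetime_smoothD (sF i) IH) => t x _; rewrite big_cons.
Qed.

Lemma is_derive_fst (a : R -> R) (t : R) (x : V) (w : R^o * V) (a' : R) :
  is_derive t (1 : R) a a' ->
  is_derive ((t : R^o), x) w (fun z : R^o * V => a z.1) (w.1 * a').
Proof.
move=> da.
have E : (fun h : R => h^-1 *: (((fun z : R^o * V => a z.1) \o shift ((t : R^o), x)) (h *: w)
   - a t)) = (fun h : R => h^-1 *: ((a \o shift t) (h *: w.1) - a t)) by [].
have d : is_derive t w.1 a (w.1 * a').
  have /derivable1_diffP dif : derivable a t 1 by [].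
  split; first exact: diff_derivable.
  by rewrite deriveE// deriv1E// derive1E (@derive_val _ _ _ _ _ _ _ da).
split; first by rewrite /derivable E; case: d.
by rewrite /derive E; case: d.
Qed.

Lemma spacetime_smooth_powR c : spacetime_smooth (fun (t : R) (_ : V) => t `^ c).
Proof.
split=> //; apply: (@smooth_on_coind _ _ _ open_future (fun f => exists k c,
  f = fun z : R^o * V => k * z.1 `^ c)); last first.
  by exists 1, c; apply/funext => z; rewrite mul1r.
move=> _ [k [{}c ->]].
have d (z : R^o * V) (w : R^o * V) : 0 < z.1 ->
    is_derive z w (fun z : R^o * V => k * z.1 `^ c) ((w.1 * k * c) * z.1 `^ (c - 1)).
  case: z => t x /= t0.
  have dk : is_derive t (1 : R) (fun t => k * t `^ c) (k * (c * t `^ (c - 1))).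
    have dp := is_derive1_powR c t0; apply: is_derive_eq.
    by [].
  have := is_derive_fst x w dk; by rewrite !mulrA.
split=> [z z0|w].
  split; last by move=> w; have [] := d z w z0.
  have c1 : {for z.1, continuous (fun t : R => k * t `^ c)}.
    have := d (z.1, 0) (1, 0) z0 => dd.
    apply/differentiable_continuous/derivable1_diffP.
    apply: derivableM; first exact: derivable_cst.
    by have [] := is_derive1_powR c z0.
  exact: (@continuous_comp _ _ _ (@fst R^o V) (fun t : R => k * t `^ c) z (@cvg_fst _ _ _ _ _) c1).
exists (fun z => w.1 * k * c * z.1 `^ (c - 1)); first by exists (w.1 * k * c), (c - 1).
by move=> z z0; have [] := d z w z0.
Qed.

Lemma spacetime_smooth_ln : spacetime_smooth (fun (t : R) (_ : V) => ln t).
Proof.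
split=> //; apply: (@smooth_on_coind _ _ _ open_future (fun f =>
  smooth_on future f \/ f = fun z : R^o * V => ln z.1)); last by right.
have d (z : R^o * V) (w : R^o * V) : 0 < z.1 ->
    is_derive z w (fun z : R^o * V => ln z.1) (w.1 * z.1 `^ (-1)).
  case: z => t x /= t0; have := is_derive_fst x w (is_derive1_ln t0).
  by rewrite powRN powRr1 ?ltW.
move=> f [sf|->]; split=> [z z0|w].
- by split=> [|v]; [exact: (smooth_on_continuous sf z0)|exact: (smooth_on_derivable sf z0)].
- by exists ('D_w f) => //; left; exact: smooth_on_derive.
- split; last by move=> w; have [] := d z w z0.
  exact: (@continuous_comp _ _ _ (@fst R^o V) (@ln R) z (@cvg_fst _ _ _ _ _) (continuous_ln z0)).
- exists (fun z => w.1 * z.1 `^ (-1)); last by move=> z z0; have [] := d z w z0.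
  left; have [_ s] := spacetime_smoothZ w.1 (spacetime_smooth_powR (-1)).
  exact: s.
Qed.

Lemma timeDD u w t x : spacetime_smooth u -> spacetime_smooth w -> 0 < t ->
  timeD (fun t x => u t x + w t x) t x = timeD u t x + timeD w t x.
Proof.
move=> su sw t0.
have du := spacetime_smooth_is_derive x su t0.
have dw := spacetime_smooth_is_derive x sw t0.
rewrite [LHS]/timeD derive1E.
exact: (@derive_val _ _ _ _ _ _ _ (is_deriveD du dw)).
Qed.

Lemma timeDM u w t x : spacetime_smooth u -> spacetime_smooth w -> 0 < t ->
  timeD (fun t x => u t x * w t x) t x = u t x * timeD w t x + w t x * timeD u t x.
Proof.
move=> su sw t0.
have du := spacetime_smooth_is_derive x su t0.
have dw := spacetime_smooth_is_derive x sw t0.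
rewrite [LHS]/timeD derive1E.
exact: (@derive_val _ _ _ _ _ _ _ (is_deriveM du dw)).
Qed.

Lemma timeD_eq u w t x : (forall t x, 0 < t -> u t x = w t x) -> 0 < t ->
  timeD u t x = timeD w t x.
Proof.
move=> uw t0; rewrite /timeD !derive1E; apply: near_eq_derive.
by near=> s; apply: uw; near: s; exact: lt_nbhsr.
Unshelve. all: by end_near. Qed.

Lemma timeDZ c u t x : spacetime_smooth u -> 0 < t ->
  timeD (fun t x => c * u t x) t x = c * timeD u t x.
Proof.
move=> su t0; rewrite (timeDM x (spacetime_smooth_cst c) su t0).
by rewrite /timeD derive1_cst mulr0 addr0.
Qed.

Lemma timeD_sum (I : Type) (r : seq I) (F : I -> R -> V -> R) t x :
  (forall i, spacetime_smooth (F i)) -> 0 < t ->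
  timeD (fun t x => \sum_(i <- r) F i t x) t x = \sum_(i <- r) timeD (F i) t x.
Proof.
move=> sF t0; elim: r => [|i r IH].
  rewrite big_nil (@timeD_eq _ (fun _ _ => 0))//; last by move=> *; rewrite big_nil.
  by rewrite /timeD derive1_cst.
rewrite big_cons -IH -timeDD//; last exact: spacetime_smooth_sum.
by apply: timeD_eq => // s y _; rewrite big_cons.
Qed.

Lemma timeD_powR c t x : 0 < t -> timeD (fun t (_ : V) => t `^ c) t x = c * t `^ (c - 1).
Proof.
by move=> t0; rewrite /timeD derive1E (@derive_val _ _ _ _ _ _ _ (is_derive1_powR c t0)).
Qed.

Lemma timeD_ln t x : 0 < t -> timeD (fun t (_ : V) => ln t) t x = t^-1.
Proof.
by move=> t0; rewrite /timeD derive1E (@derive_val _ _ _ _ _ _ _ (is_derive1_ln t0)).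
Qed.

End Spacetime.

(** * The mean over the torus *)

(** Limits along a free ultrafilter exist for all bounded sequences and are
    linear and monotone. The means built from them are therefore defined on all
    bounded functions and need no measurability or integrability. *)
Definition free_ultrafilter : set_system nat :=
  sval (cid (ultraFilterLemma (eventually_filter))).

Instance free_ultrafilter_ultra : UltraFilter free_ultrafilter.
Proof. by rewrite /free_ultrafilter; case: cid => U []. Qed.

Lemma free_ultrafilter_near (P : set nat) :
  (\forall n \near \oo, P n) -> free_ultrafilter P.
Proof. by rewrite /free_ultrafilter; case: cid => U [] /= _; exact. Qed.

Section Ulim.
Variable R : realType.
Implicit Types a b : nat -> R.

Definition ulim a : R := lim (a @ free_ultrafilter).
Definition bounded_seq a := exists B : R, forall n, `|a n| <= B.

(** Compactness gives a cluster point, and an ultrafilter converges to each of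
    its cluster points. *)
Lemma ulim_cvg a : bounded_seq a -> a @ free_ultrafilter --> ulim a.
Proof.
move=> [B aB]; apply/cvg_ex.
have cK := @segment_compact R (- B) B.
have FK : (a @ free_ultrafilter) `[- B, B]%classic.
  change (free_ultrafilter (a @^-1` `[- B, B]%classic)). 
  apply: (@filterS _ _ _ setT); first by move=> n _ /=; rewrite in_itv/= -ler_norml.
  exact: filterT.
have [p [_ clp]] := cK (a @ free_ultrafilter) _ FK.
exists p => W Wp.
have [//|nW] := in_ultra_setVsetC (a @^-1` W) free_ultrafilter_ultra.
by have [x []] := clp (~` W) W nW Wp.
Qed.

Lemma ulim_le a b : bounded_seq a -> bounded_seq b ->
  (\forall n \near \oo, a n <= b n) -> ulim a <= ulim b.
Proof.
move=> ba bb ab; apply: (ler_cvg_to (ulim_cvg ba) (ulim_cvg bb)).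
exact: free_ultrafilter_near.
Qed.

Lemma bounded_seqD a b : bounded_seq a -> bounded_seq b -> bounded_seq (fun n => a n + b n).
Proof.
move=> [A aA] [B bB]; exists (A + B) => n.
by rewrite (le_trans (ler_normD _ _))// lerD.
Qed.

Lemma bounded_seqZ c a : bounded_seq a -> bounded_seq (fun n => c * a n).
Proof. by move=> [A aA]; exists (`|c| * A) => n; rewrite normrM ler_wpM2l. Qed.

Lemma ulimD a b : bounded_seq a -> bounded_seq b ->
  ulim (fun n => a n + b n) = ulim a + ulim b.
Proof. by move=> ba bb; apply/cvg_lim => //; apply: cvgD; exact: ulim_cvg. Qed.

Lemma ulimZ c a : bounded_seq a -> ulim (fun n => c * a n) = c * ulim a.
Proof. by move=> ba; apply/cvg_lim => //; apply: cvgMl_tmp; exact: ulim_cvg. Qed.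

Lemma ulim_cst c : ulim (fun=> c) = c.
Proof. by apply/cvg_lim => //; exact: cvg_cst. Qed.

End Ulim.

Section Mean.
Variables (R : realType) (D : nat).
Local Notation V := 'rV[R]_D.
Implicit Types (f g : V -> R) (v x y : V) (i : 'I_D) (r : seq 'I_D).

Definition bounded_fct f := exists B : R, forall x, `|f x| <= B.

Lemma bounded_fctD f g : bounded_fct f -> bounded_fct g ->
  bounded_fct (fun x => f x + g x).
Proof.
move=> [A aA] [B bB]; exists (A + B) => x.
by rewrite (le_trans (ler_normD _ _))// lerD.
Qed.

Lemma bounded_fctZ c f : bounded_fct f -> bounded_fct (fun x => c * f x).
Proof. by move=> [A aA]; exists (`|c| * A) => x; rewrite normrM ler_wpM2l. Qed.

Lemma bounded_fct_cst c : bounded_fct (fun=> c).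
Proof. by exists `|c|. Qed.


Lemma bounded_fct_norm f : bounded_fct f -> bounded_fct (fun x => `|f x|).
Proof. by move=> [A aA]; exists A => x; rewrite normr_id. Qed.

Definition mesh (n : nat) : R := 2 * pi / n.+1%:R.

Definition riemann_mean i (n : nat) f x : R :=
  n.+1%:R^-1 * \sum_(k < n.+1) f (x + (k%:R * mesh n) *: delta_mx 0 i).

(** The mean along the i-th coordinate circle through x; it is the normalized
    Riemann integral when f is continuous and periodic. *)
Definition coord_mean i f x : R := ulim (fun n => riemann_mean i n f x).

Lemma mesh_gt0 n : 0 < mesh n.
Proof. by rewrite divr_gt0// mulr_gt0// pi_gt0. Qed.

Lemma riemann_mean_le i n f g x : (forall y, f y <= g y) ->
  riemann_mean i n f x <= riemann_mean i n g x.
Proof. by move=> fg; rewrite ler_wpM2l// ler_sum. Qed.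

Lemma riemann_mean_cst i n c x : riemann_mean i n (fun=> c) x = c.
Proof. by rewrite /riemann_mean sumr_const card_ord -[c *+ _]mulr_natl mulKf// pnatr_eq0. Qed.

Lemma riemann_mean_norm i n f B x : (forall y, `|f y| <= B) ->
  `|riemann_mean i n f x| <= B.
Proof.
move=> fB; rewrite ler_norml.
rewrite -[- B](riemann_mean_cst i n _ x) -[X in _ <= _ <= X](riemann_mean_cst i n _ x).
by apply/andP; split; apply: riemann_mean_le => y; have := fB y; rewrite ler_norml => /andP[].
Qed.

Lemma riemann_meanD i n f g x :
  riemann_mean i n (fun y => f y + g y) x = riemann_mean i n f x + riemann_mean i n g x.
Proof. by rewrite /riemann_mean big_split mulrDr. Qed.

Lemma riemann_meanZ i n c f x :
  riemann_mean i n (fun y => c * f y) x = c * riemann_mean i n f x.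
Proof. by rewrite /riemann_mean -mulr_sumr mulrCA. Qed.

Lemma bounded_riemann_mean i f x : bounded_fct f ->
  bounded_seq (fun n => riemann_mean i n f x).
Proof. by move=> [B fB]; exists B => n; exact: riemann_mean_norm. Qed.

Lemma coord_mean_le i f g x : bounded_fct f -> bounded_fct g ->
  (forall y, f y <= g y) -> coord_mean i f x <= coord_mean i g x.
Proof.
move=> bf bg fg; apply: ulim_le; [exact: bounded_riemann_mean..|].
by apply: nearW => n; exact: riemann_mean_le.
Qed.

Lemma coord_mean_cst i c x : coord_mean i (fun=> c) x = c.
Proof.
rewrite -[RHS](ulim_cst c); congr ulim; apply/funext => n.
exact: riemann_mean_cst.
Qed.

Lemma coord_meanD i f g x : bounded_fct f -> bounded_fct g ->
  coord_mean i (fun y => f y + g y) x = coord_mean i f x + coord_mean i g x.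
Proof.
move=> bf bg; rewrite -ulimD; [|exact: bounded_riemann_mean..].
by congr ulim; apply/funext => n; exact: riemann_meanD.
Qed.

Lemma coord_meanZ i c f x : bounded_fct f ->
  coord_mean i (fun y => c * f y) x = c * coord_mean i f x.
Proof.
move=> bf; rewrite -ulimZ; last exact: bounded_riemann_mean.
by congr ulim; apply/funext => n; exact: riemann_meanZ.
Qed.

Lemma coord_mean_norm i f B x : (forall y, `|f y| <= B) -> `|coord_mean i f x| <= B.
Proof.
move=> fB; have bf : bounded_fct f by exists B.
rewrite ler_norml -[- B](coord_mean_cst i _ x) -[X in _ <= _ <= X](coord_mean_cst i _ x).
by apply/andP; split; apply: coord_mean_le => //;
  [exact: bounded_fct_cst| |exact: bounded_fct_cst|] => y;
  have := fB y; rewrite ler_norml => /andP[].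
Qed.

Lemma bounded_coord_mean i f : bounded_fct f -> bounded_fct (coord_mean i f).
Proof. by move=> [B fB]; exists B => x; exact: coord_mean_norm. Qed.

Lemma coord_mean_shift i f y x :
  coord_mean i (fun z => f (z + y)) x = coord_mean i f (x + y).
Proof.
congr ulim; apply/funext => n; congr (_ * _); apply: eq_bigr => k _.
by rewrite addrAC.
Qed.

Lemma periodic_coord_mean i f : torus_periodic f -> torus_periodic (coord_mean i f).
Proof.
move=> pf j x; rewrite -coord_mean_shift; congr coord_mean.
by apply/funext => y; exact: pf.
Qed.

(** One-sided difference quotients that converge uniformly in x. This form of
    differentiability passes through means and can be summed along a grid,
    in contrast with pointwise differentiability. *)
Definition unif_derive v f g := forall e, 0 < e -> exists2 d, 0 < d &
  forall h x, 0 < h < d -> `|f (x + h *: v) - f x - h * g x| <= h * e.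

Lemma unif_derive_coord_mean i v f g : bounded_fct f -> bounded_fct g ->
  unif_derive v f g -> unif_derive v (coord_mean i f) (coord_mean i g).
Proof.
move=> bf bg fg e e0; have [d d0 fd] := fg e e0; exists d => // h x hd.
have bs : bounded_fct (fun y => f (y + h *: v)).
  by case: bf => B fB; exists B => y.
have bd : bounded_fct (fun y => -1 * f y + - h * g y).
  by apply: bounded_fctD; exact: bounded_fctZ.
have -> : coord_mean i f (x + h *: v) - coord_mean i f x - h * coord_mean i g x =
    coord_mean i (fun y => f (y + h *: v) + (-1 * f y + - h * g y)) x.
  rewrite coord_meanD// coord_meanD; [|exact: bounded_fctZ..].
  by rewrite !coord_meanZ// coord_mean_shift mulN1r mulNr addrA.
apply: coord_mean_norm => y; apply: le_trans (fd h y hd).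
by rewrite mulN1r mulNr addrA.
Qed.

(** Shared by the two facts on means that follow: over a full period the
    increments of a periodic f cancel, and over a part of it they compare
    values of f at two points of the circle. *)
Lemma telescope_grid i n f x (m : nat) :
  \sum_(k < m) (f (x + (k.+1%:R * mesh n) *: delta_mx 0 i) -
                f (x + (k%:R * mesh n) *: delta_mx 0 i)) =
  f (x + (m%:R * mesh n) *: delta_mx 0 i) - f x.
Proof.
elim: m => [|m IH]; first by rewrite big_ord0 mul0r scale0r addr0 subrr.
by rewrite big_ord_recr/= IH addrC subrKA.
Qed.

Lemma grid_step i n (k : nat) x :
  x + (k.+1%:R * mesh n) *: delta_mx 0 i =
  x + (k%:R * mesh n) *: delta_mx 0 i + mesh n *: delta_mx 0 i.
Proof. by rewrite -natr1 mulrDl mul1r scalerDl addrA. Qed.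

Lemma mesh_near d : 0 < d -> \forall n \near \oo, mesh n < d.
Proof.
move=> d0; apply: filterS (nbhs_infty_gtr (2 * pi / d)) => n.
rewrite ltr_pdivrMr// => hn; rewrite /mesh ltr_pdivrMr//; apply: (lt_trans hn).
by rewrite [ltRHS]mulrC ltr_pM2r// ltr_nat.
Qed.

(** A Riemann sum of g is, up to the uniform error, a telescoping sum of
    increments of the periodic function f. *)
Lemma coord_mean_derive0 i f g x : torus_periodic f -> bounded_fct g ->
  unif_derive (delta_mx 0 i) f g -> coord_mean i g x = 0.
Proof.
move=> pf bg fg; apply/eqP; rewrite -normr_le0; apply/ler_addgt0Pr => e e0.
rewrite add0r; have [d d0 fd] := fg e e0.
have key n : mesh n < d -> `|riemann_mean i n g x| <= e.
  move=> nd; have md : 0 < mesh n < d by rewrite mesh_gt0.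
  pose y k := x + (k%:R * mesh n) *: delta_mx 0 i.
  (* periodicity closes the telescoping sum *)
  have T0 : \sum_(k < n.+1) (f (y k.+1) - f (y k)) = 0.
    rewrite telescope_grid /mesh mulrCA divff ?pnatr_eq0// mulr1.
    by rewrite pf subrr.
  have E : mesh n * \sum_(k < n.+1) g (y k) =
     - \sum_(k < n.+1) (f (y k.+1) - f (y k) - mesh n * g (y k)).
    by rewrite sumrB T0 sub0r opprK mulr_sumr.
  have B : `|mesh n * \sum_(k < n.+1) g (y k)| <= \sum_(k < n.+1) (mesh n * e).
    rewrite E normrN (le_trans (ler_norm_sum _ _ _))// ler_sum// => k _.
    by rewrite {1}/y grid_step; exact: (fd _ (y k) md).
  rewrite /riemann_mean normrM ger0_norm ?invr_ge0// mulrC ler_pdivrMr//.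
  move: B; rewrite normrM (ger0_norm (ltW (mesh_gt0 n))) sumr_const card_ord.
  by rewrite -mulrnAr ler_pM2l ?mesh_gt0// mulr_natr.
have bn : bounded_seq (fun n => riemann_mean i n g x) by exact: bounded_riemann_mean.
have near_key : \forall n \near \oo, `|riemann_mean i n g x| <= e.
  by apply: filterS (mesh_near d0) => n; exact: key.
rewrite ler_norml -[- e](ulim_cst (- e)) -[X in _ <= _ <= X](ulim_cst e).
have bc c : bounded_seq (fun _ : nat => c : R) by exists `|c|.
by apply/andP; split; apply: ulim_le => //; apply: filterS near_key => n;
  rewrite ler_norml => /andP[].
Qed.

(** The value f x exceeds each value of f on the grid by at most 2 pi times the
    Riemann mean of |g|, up to the uniform error; then average over the grid. *)
Lemma coord_sobolev i f g x : torus_periodic f -> bounded_fct f -> bounded_fct g ->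
  unif_derive (delta_mx 0 i) f g ->
  f x <= coord_mean i f x + 2 * pi * coord_mean i (fun y => `|g y|) x.
Proof.
move=> pf bf bg fg; have pi2 : 0 < 2 * pi :> R by rewrite mulr_gt0// pi_gt0.
apply/ler_addgt0Pr => e e0.
have e'0 : 0 < e / (2 * pi) by rewrite divr_gt0.
have [d d0 fd] := fg _ e'0.
have bng := bounded_fct_norm bg.
have key n : mesh n < d ->
    f x <= riemann_mean i n f x + 2 * pi * riemann_mean i n (fun y => `|g y|) x + e.
  move=> nd; have md : 0 < mesh n < d by rewrite mesh_gt0.
  pose y k := x + (k%:R * mesh n) *: delta_mx 0 i.
  have step (m : 'I_n.+1) :
     f x <= f (y m) + \sum_(k < n.+1) (mesh n * `|g (y k)| + mesh n * (e / (2 * pi))).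
    have -> : f x = f (y m) - \sum_(k < m) (f (y k.+1) - f (y k)).
      by rewrite telescope_grid opprB addrC subrK.
    rewrite lerD2l -sumrN.
    apply: (@le_trans _ _ (\sum_(k < m) (mesh n * `|g (y k)| + mesh n * (e / (2 * pi))))).
      apply: ler_sum => k _; rewrite (le_trans (ler_norm _))// normrN /y grid_step.
      rewrite -lerBlDl; apply: le_trans (fd _ (y k) md).
      have -> : mesh n * `|g (y k)| = `|mesh n * g (y k)|.
        by rewrite normrM (ger0_norm (ltW (mesh_gt0 n))).
      exact: lerB_dist.
    have p0 k : 0 <= mesh n * `|g (y k)| + mesh n * (e / (2 * pi)).
      by rewrite addr_ge0// mulr_ge0// ltW// mesh_gt0.
    rewrite -(big_mkord xpredT (fun k => mesh n * `|g (y k)| + mesh n * (e / (2 * pi)))).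
    rewrite -(big_mkord xpredT (fun k => mesh n * `|g (y k)| + mesh n * (e / (2 * pi)))).
    by rewrite (@big_cat_nat _ _ _ m 0 n.+1)//= ?lerDl ?sumr_ge0// ltnW.
  have := @riemann_mean_cst i n (f x) x => <-; rewrite -addrA.
  have -> : 2 * pi * riemann_mean i n (fun y => `|g y|) x + e =
     \sum_(k < n.+1) (mesh n * `|g (y k)| + mesh n * (e / (2 * pi))).
    rewrite big_split/= sumr_const card_ord -!mulr_sumr /riemann_mean mulrA.
    have pi0 : pi != 0 :> R by rewrite gt_eqF ?pi_gt0.
    have n0 : n.+1%:R != 0 :> R by rewrite pnatr_eq0.
    congr (_ + _); rewrite -[RHS]mulr_natl /mesh.
    by move: pi n.+1%:R pi0 n0 => P N P0 N0; field; rewrite P0 N0.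
  rewrite -[X in _ + X](@riemann_mean_cst i n _ x) -riemann_meanD.
  rewrite /riemann_mean ler_wpM2l// ler_sum// => k _.
  exact: step.
have b1 : bounded_seq (fun n => riemann_mean i n f x) by exact: bounded_riemann_mean.
have b2 : bounded_seq (fun n => riemann_mean i n (fun y => `|g y|) x).
  exact: bounded_riemann_mean.
have bc c : bounded_seq (fun _ : nat => c : R) by exists `|c|.
rewrite /coord_mean -ulimZ// -ulimD//; last exact: bounded_seqZ.
rewrite -[X in _ <= _ + X](ulim_cst e) -ulimD//; last first.
  by apply: bounded_seqD => //; exact: bounded_seqZ.
rewrite -[X in X <= _](ulim_cst (f x)); apply: ulim_le => //.
  by do 2 apply: bounded_seqD => //; exact: bounded_seqZ.
by apply: filterS (mesh_near d0) => n; exact: key.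
Qed.

Definition iter_mean r f : V -> R := foldr coord_mean f r.

Lemma bounded_iter_mean r f : bounded_fct f -> bounded_fct (iter_mean r f).
Proof. by move=> bf; elim: r => //= i r IH; exact: bounded_coord_mean. Qed.

Lemma iter_mean_le r f g x : bounded_fct f -> bounded_fct g ->
  (forall y, f y <= g y) -> iter_mean r f x <= iter_mean r g x.
Proof.
move=> bf bg fg; elim: r x => //= i r IH x.
by apply: coord_mean_le => //; exact: bounded_iter_mean.
Qed.

Lemma iter_meanD r f g x : bounded_fct f -> bounded_fct g ->
  iter_mean r (fun y => f y + g y) x = iter_mean r f x + iter_mean r g x.
Proof.
move=> bf bg; elim: r x => //= i r IH x.
rewrite -coord_meanD; [|exact: bounded_iter_mean..].
by congr coord_mean; apply/funext.
Qed.

Lemma iter_meanZ r c f x : bounded_fct f ->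
  iter_mean r (fun y => c * f y) x = c * iter_mean r f x.
Proof.
move=> bf; elim: r x => //= i r IH x.
rewrite -coord_meanZ; last exact: bounded_iter_mean.
by congr coord_mean; apply/funext.
Qed.

Lemma iter_mean_cst r c x : iter_mean r (fun=> c) x = c.
Proof.
elim: r x => //= i r IH x; rewrite -[RHS](coord_mean_cst i c x).
by congr coord_mean; apply/funext.
Qed.

Lemma iter_mean_norm r f B x : (forall y, `|f y| <= B) -> `|iter_mean r f x| <= B.
Proof. by move=> fB; elim: r x => //= i r IH x; exact: coord_mean_norm. Qed.

Lemma periodic_iter_mean r f : torus_periodic f -> torus_periodic (iter_mean r f).
Proof. by move=> pf; elim: r => //= i r IH; exact: periodic_coord_mean. Qed.

Lemma unif_derive_iter_mean r v f g : bounded_fct f -> bounded_fct g ->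
  unif_derive v f g -> unif_derive v (iter_mean r f) (iter_mean r g).
Proof.
move=> bf bg fg; elim: r => //= i r IH.
by apply: unif_derive_coord_mean => //; exact: bounded_iter_mean.
Qed.

(** The means taken before the i-th coordinate preserve the relation between f
    and its derivative, the i-th one annihilates the derivative, and the means
    taken after it preserve 0. *)
Lemma iter_mean_derive0 i r f g x : i \in r -> torus_periodic f ->
  bounded_fct f -> bounded_fct g -> unif_derive (delta_mx 0 i) f g ->
  iter_mean r g x = 0.
Proof.
move=> + pf bf bg fg; elim: r x => //= j r IH x; rewrite inE => /orP[/eqP <-|ir].
  apply: (coord_mean_derive0 (f := iter_mean r f)).
  - exact: periodic_iter_mean.
  - exact: bounded_iter_mean.
  - exact: unif_derive_iter_mean.
rewrite -[RHS](coord_mean_cst j 0 x); congr coord_mean.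
by apply/funext => y; exact: IH.
Qed.

End Mean.

(** * Uniformity by compactness of the torus *)

Section Compact.
Variables (R : realType) (D : nat).
Local Notation V := 'rV[R]_D.
Implicit Types (f g : V -> R) (v x y : V) (i : 'I_D) (t : R).

Lemma periodic_lattice1 f i (m : int) x : torus_periodic f ->
  f (x + (2 * pi * m%:~R) *: delta_mx 0 i) = f x.
Proof.
move=> pf.
have nat_case (n : nat) y : f (y + (2 * pi * n%:R) *: delta_mx 0 i) = f y.
  rewrite -[RHS](periodicn (pf i) n) -[X in _ = f (_ + X)]scaler_nat scalerA.
  by congr (f (_ + _ *: _)); rewrite mulrC.
case: m => n; first exact: nat_case.
rewrite NegzE mulrNz mulrN scaleNr.
by rewrite -(nat_case n.+1 (x - _)) subrK.
Qed.

Lemma periodic_lattice f (m : 'I_D -> int) (r : seq 'I_D) x : torus_periodic f ->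
  f (x + \sum_(i <- r) (2 * pi * (m i)%:~R) *: delta_mx 0 i) = f x.
Proof.
move=> pf; elim: r x => [|i r IH] x; first by rewrite big_nil addr0.
by rewrite big_cons addrA IH periodic_lattice1.
Qed.

Definition torus_cube : set V := [set y | forall i, `[0, 2 * pi]%classic (y ord0 i)].

Lemma torus_cube_compact : compact torus_cube.
Proof.
apply: (@rV_compact _ _ (fun=> `[0, 2 * pi]%classic)) => _.
exact: segment_compact.
Qed.

(** Functions on the torus are functions on R^D with periods, so compactness is
    only available on this fundamental cube. *)
Lemma torus_cube_rep x :
  exists2 y, torus_cube y & forall f, torus_periodic f -> f x = f y.
Proof.
have pi2 : 0 < 2 * pi :> R by rewrite mulr_gt0// pi_gt0.
pose m i : int := - Num.floor (x ord0 i / (2 * pi)).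
exists (x + \sum_(i < D) (2 * pi * (m i)%:~R) *: delta_mx 0 i); last first.
  by move=> f pf; rewrite periodic_lattice.
move=> i /=; rewrite in_itv/= mxE summxE (bigD1 i)//= big1 => [|j ji]; last first.
  by rewrite !mxE eqxx /= (negbTE (_ : i != j)) ?mulr0// eq_sym.
rewrite addr0 !mxE !eqxx mulr1 /m mulrNz mulrN.
have := Num.Theory.floor_itv (x ord0 i / (2 * pi)).
move: (Num.floor _) => k /andP[h1 h2].
rewrite ler_pdivlMr// in h1; rewrite ltr_pdivrMr// intrD in h2.
by apply/andP; split; nra.
Qed.

(** The tube lemma: a bound that holds near each point of a compact set, for
    parameters near a filter, holds on the whole set at once. *)
Lemma torus_uniform_small (T : Type) (F : set_system T) {FF : Filter F}
    (G : T -> V -> R) (e : R) :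
  (\forall s \near F, torus_periodic (G s)) ->
  (forall x, \forall y \near x & s \near F, `|G s y| < e) ->
  \forall s \near F, forall x, `|G s x| < e.
Proof.
move=> pG Ge.
have /compact_near_coveringP cK := torus_cube_compact.
have H := cK _ F (fun s y => `|G s y| < e) FF (fun x _ => Ge x).
near=> s => x.
have [y Ky ->] := torus_cube_rep x; last by near: s.
by move: y Ky; near: s.
Unshelve. all: by end_near. Qed.

Lemma torus_bounded f : torus_periodic f -> continuous f -> bounded_fct f.
Proof.
move=> pf cf.
have /compact_bounded[B [_ fB]] : compact (f @` torus_cube).
  apply: continuous_compact torus_cube_compact.
  exact: continuous_subspaceT.
exists (B + 1) => x; have [y Ky ->//] := torus_cube_rep x.
by apply: (fB (B + 1)); [rewrite ltrDl|exists y].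
Qed.

Lemma torus_smooth_bounded f : torus_smooth f -> bounded_fct f.
Proof.
move=> sf; apply: torus_bounded; last exact: torus_smooth_continuous.
by case: sf.
Qed.

Lemma torus_uniform_continuous f v (e : R) : torus_periodic f -> continuous f ->
  0 < e -> \forall h \near (0 : R), forall x, `|f (x + h *: v) - f x| < e.
Proof.
move=> pf cf e0; apply: (@torus_uniform_small R (nbhs (0 : R)) _ (fun h x => f (x + h *: v) - f x) e).
  by apply: nearW => h i x; rewrite addrAC !pf.
move=> x; pose g (z : V * R) := f (z.1 + z.2 *: v) - f z.1.
have cg : g @ (x, 0 : R) --> g (x, 0).
  have c1 : {for (x, 0 : R), continuous (fun z : V * R => z.1 + z.2 *: v)}.
    apply: cvgD; first exact: cvg_fst.
    by apply: cvgZr_tmp; exact: cvg_snd.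
  apply: cvgB.
    exact: (@continuous_comp _ _ _ (fun z : V * R => z.1 + z.2 *: v) f (x, 0) c1 (cf _)).
  exact: (@continuous_comp _ _ _ fst f (x, 0) (@cvg_fst _ _ _ _ _) (cf _)).
rewrite {2}/g /= scale0r addr0 subrr in cg.
by move/cvgr0_norm_lt : cg => /(_ _ e0).
Qed.

Lemma torus_smooth_unif_derive v f : torus_smooth f -> unif_derive v f (dirD v f).
Proof.
move=> sf e e0; have sg := torus_smooth_dirD v sf.
have [pg _] := sg.
have /nbhs_ballP[d /= d0 dP] :=
  torus_uniform_continuous v pg (torus_smooth_continuous sg) e0.
exists d => // h x /andP[h0 hd].
have [|s /andP[s0 sh] E] := @MVT_line _ _ f x v h h0.
  by move=> s _; have [] := torus_smooth_is_derive v (s *: v + x) sf.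
rewrite [x + _]addrC E -mulrBr normrM (ger0_norm (ltW h0)) (ler_wpM2l (ltW h0))//.
apply: ltW; rewrite [s *: v + x]addrC; apply: dP.
by rewrite /ball/= sub0r normrN ger0_norm// (le_lt_trans sh).
Qed.

Lemma spacetime_uniform_continuous (u : R -> V -> R) t (e : R) : spacetime_smooth u ->
  0 < t -> 0 < e -> \forall s \near t, forall x, `|u s x - u t x| < e.
Proof.
move=> su t0 e0; apply: (@torus_uniform_small R (nbhs t) _ (fun s x => u s x - u t x) e).
  by near=> s => i x; case: (su) => pu _; rewrite !pu//; near: s; exact: lt_nbhsr.
move=> x; pose g (z : V * R^o) := u z.2 z.1 - u t z.1.
have cg : g @ (x, (t : R^o)) --> g (x, t).
  have c1 : {for (x, (t : R^o)), continuous (fun z : V * R^o => (z.2, z.1))}.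
    exact: (cvg_pair (@cvg_snd _ _ _ _ _) (@cvg_fst _ _ _ _ _)).
  have c2 : {for (t, x), continuous (uncurried u)} := spacetime_smooth_continuous su t0.
  apply: cvgB.
    exact: (@continuous_comp _ _ _ (fun z : V * R^o => (z.2, z.1)) (uncurried u)
      (x, (t : R^o)) c1 c2).
  have cu := torus_smooth_continuous (spacetime_smooth_slice su t0).
  exact: (@continuous_comp _ _ _ fst (u t) (x, (t : R^o)) (@cvg_fst _ _ _ _ _) (cu _)).
rewrite {2}/g /= subrr in cg.
by move/cvgr0_norm_lt : cg => /(_ _ e0).
Unshelve. all: by end_near. Qed.

(** By the mean value theorem the quotient is the time derivative at a nearby
    time, and that derivative is uniformly continuous on the torus. *)
Lemma spacetime_unif_time_derive (u : R -> V -> R) t (e : R) : spacetime_smooth u ->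
  0 < t -> 0 < e -> \forall h \near (0 : R)^',
    forall x, `|h^-1 * u (h + t) x - h^-1 * u t x - timeD u t x| <= e.
Proof.
move=> su t0 e0.
have /nbhs_ballP[d /= d0 dP] :=
  spacetime_uniform_continuous (spacetime_smooth_timeD su) t0 e0.
have [d1 d10 d1P] : exists2 d1 : R, 0 < d1 & d1 <= d /\ d1 < t.
  exists (Num.min d (t / 2)); first by rewrite lt_min d0 divr_gt0.
  by rewrite ge_min lexx; split=> //; rewrite gt_min ltr_pdivrMr// ltr_pMr// ltr1n orbT.
apply/nbhs_ballP; exists d1 => //= h; rewrite /ball/= sub0r normrN => hd h0 x.
(* d1 < t keeps the segment between t and h + t inside the domain *)
have hpos s : `|s - t| <= `|h| -> 0 < s.
  rewrite ler_norml => /andP[+ _]; case: d1P => _; lra.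
have MV (a b : R) : a < b -> (forall s, a <= s <= b -> `|s - t| <= `|h|) ->
    exists2 c, `|c - t| <= `|h| & u b x - u a x = timeD u c x * (b - a).
  move=> ab H.
  have [||c + E] := @MVT R (u^~ x) (fun s => timeD u s x) a b ab.
  - move=> s; rewrite in_itv/= => /andP[h1 h2].
    by apply: spacetime_smooth_is_derive => //; apply/hpos/H; rewrite !ltW.
  - apply: derivable_within_continuous => s; rewrite in_itv/= => hs.
    by have [] := spacetime_smooth_is_derive x su (hpos s (H _ hs)).
  - by rewrite in_itv/= => /andP[h1 h2]; exists c => //; apply: H; rewrite !ltW.
have [c hc E] : exists2 c, `|c - t| <= `|h| & u (h + t) x - u t x = timeD u c x * h.
  have [hp|hn|hh] := ltgtP 0 h; last by rewrite -hh eqxx in h0.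
  - have [||c hc E] := MV t (h + t); [by rewrite ltrDr| |].
      by move=> s; rewrite (ger0_norm (ltW hp)) ler_norml; lra.
    by exists c => //; rewrite E addrK.
  - have [||c hc E] := MV (h + t) t; [by rewrite gtrDr| |].
      by move=> s; rewrite (ltr0_norm hn) ler_norml; lra.
    by exists c => //; rewrite -opprB E; ring.
rewrite -mulrBr E mulrC mulfK//; apply/ltW/dP.
rewrite /ball/= distrC (le_lt_trans hc)// (lt_le_trans hd)//.
by case: d1P.
Qed.

End Compact.

(** * Integration by parts, time derivatives and Sobolev inequality *)

Section TorusMean.
Variables (R : realType) (D : nat).
Local Notation V := 'rV[R]_D.
Implicit Types (f g : V -> R) (v x y : V) (i : 'I_D) (t : R).

(** The base point x is a parameter because the Sobolev inequality produces the
    mean at the point where the function is evaluated; all estimates are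
    uniform in x. *)
Definition mean x f : R := iter_mean (enum 'I_D) f x.

Lemma mean_le x f g : torus_smooth f -> torus_smooth g ->
  (forall y, f y <= g y) -> mean x f <= mean x g.
Proof. by move=> sf sg; apply: iter_mean_le; exact: torus_smooth_bounded. Qed.

Lemma meanD x f g : torus_smooth f -> torus_smooth g ->
  mean x (fun y => f y + g y) = mean x f + mean x g.
Proof. by move=> sf sg; apply: iter_meanD; exact: torus_smooth_bounded. Qed.

Lemma meanZ x c f : torus_smooth f -> mean x (fun y => c * f y) = c * mean x f.
Proof. by move=> sf; apply: iter_meanZ; exact: torus_smooth_bounded. Qed.

Lemma mean_cst x c : mean x (fun=> c) = c.
Proof. exact: iter_mean_cst. Qed.

Lemma mean_norm x f B : (forall y, `|f y| <= B) -> `|mean x f| <= B.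
Proof. exact: iter_mean_norm. Qed.

Lemma meanN x f : torus_smooth f -> mean x (fun y => - f y) = - mean x f.
Proof.
move=> sf; rewrite -mulN1r -meanZ//; congr mean.
by apply/funext => y; rewrite mulN1r.
Qed.

Lemma mean_sum x (I : Type) (r : seq I) (F : I -> V -> R) :
  (forall i : I, torus_smooth (F i)) ->
  mean x (fun y => \sum_(i <- r) F i y) = \sum_(i <- r) mean x (F i).
Proof.
move=> sF; elim: r => [|i r IH].
  rewrite big_nil -[RHS](mean_cst x 0); congr mean.
  by apply/funext => y; rewrite big_nil.
rewrite big_cons -IH -meanD//; last exact: torus_smooth_sum.
by congr mean; apply/funext => y; rewrite big_cons.
Qed.

Lemma mean_ge0 x f : torus_smooth f -> (forall y, 0 <= f y) -> 0 <= mean x f.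
Proof.
by move=> sf f0; rewrite -[X in X <= _](mean_cst x 0); apply: (mean_le _ (torus_smooth_cst _ _) sf).
Qed.

Lemma mean_dirD0 x i f : torus_smooth f -> mean x (dirD (delta_mx 0 i) f) = 0.
Proof.
move=> sf; apply: (@iter_mean_derive0 _ _ i _ f).
- by rewrite mem_enum.
- by case: sf.
- exact: torus_smooth_bounded.
- exact/torus_smooth_bounded/torus_smooth_dirD.
- exact: torus_smooth_unif_derive.
Qed.


(** Differentiation under the mean, by uniform convergence of the difference
    quotients. *)
Lemma mean_is_derive x (u : R -> V -> R) t : spacetime_smooth u -> 0 < t ->
  is_derive t (1 : R) (fun s => mean x (u s)) (mean x (timeD u t)).
Proof.
move=> su t0.
suff H : (fun h : R => h^-1 *: (((fun s => mean x (u s)) \o shift t) (h *: 1)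
    - mean x (u t))) @ 0^' --> mean x (timeD u t).
  by split; [apply/cvg_ex; exists (mean x (timeD u t))|exact/cvg_lim].
have st := spacetime_smooth_slice su t0.
have sd := spacetime_smooth_slice (spacetime_smooth_timeD su) t0.
apply/cvgrPdist_le => e e0.
have nh : \forall h \near (0 : R)^', 0 < h + t.
  apply/nbhs_ballP; exists t => //= h; rewrite /ball/= sub0r normrN ltr_norml.
  by move=> /andP[h1 _] _; rewrite -ltrBlDr sub0r.
have n2 := spacetime_unif_time_derive su t0 e0.
apply: filterS (filterI nh n2) => h [ht hE].
rewrite distrC /= scaler1.
have sh := spacetime_smooth_slice su ht.
have s1 := torus_smoothB (torus_smoothZ h^-1 sh) (torus_smoothZ h^-1 st).
have -> : h^-1 *: (mean x (u (h + t)) - mean x (u t)) - mean x (timeD u t) =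
  mean x (fun y => h^-1 * u (h + t) y - h^-1 * u t y - timeD u t y).
  rewrite (meanD x s1 (torus_smoothN sd)) (meanN _ sd).
  rewrite (meanD x (torus_smoothZ h^-1 sh) (torus_smoothN (torus_smoothZ h^-1 st))).
  rewrite (meanN _ (torus_smoothZ h^-1 st)) (meanZ _ _ sh) (meanZ _ _ st).
  by rewrite -mulrBr.
exact: mean_norm.
Qed.

Definition iterD (vs : seq V) f : V -> R := foldr (@dirD R D) f vs.

Lemma torus_smooth_iterD vs f : torus_smooth f -> torus_smooth (iterD vs f).
Proof. by move=> sf; elim: vs => [|v vs IH]; [exact: sf|exact: (torus_smooth_dirD v IH)]. Qed.

(** The one-dimensional inequality for f^2, whose derivative 2 f f' is at most
    f^2 + f'^2, is applied one coordinate after the other; each step adds one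
    derivative to every function already present. *)
Lemma sobolev_iter (r : seq 'I_D) : exists (C : R) (L : seq (seq V)), 0 <= C /\
  forall f x, torus_smooth f ->
    f x ^+ 2 <= C * \sum_(vs <- L) iter_mean r (fun y => iterD vs f y ^+ 2) x.
Proof.
elim: r => [|i r [C [L [C0 IH]]]].
  by exists 1, [:: [::]]; split=> // f x sf; rewrite big_seq1 mul1r.
have pi0 : 0 <= 2 * pi :> R by rewrite mulr_ge0// pi_ge0.
exists ((1 + 2 * pi) * C), (L ++ [seq rcons vs (delta_mx 0 i) | vs <- L]).
split; first by rewrite mulr_ge0// addr_ge0.
have sqs f : torus_smooth f -> torus_smooth (fun y => f y ^+ 2).
  by move=> sf; exact: (torus_smoothM sf sf).
have step f x : torus_smooth f ->
   coord_mean i (fun y => f y ^+ 2) x <=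
   C * \sum_(vs <- L) iter_mean (i :: r) (fun y => iterD vs f y ^+ 2) x.
  move=> sf.
  have bb vs : bounded_fct (iter_mean r (fun y => iterD vs f y ^+ 2)).
    exact/bounded_iter_mean/torus_smooth_bounded/sqs/torus_smooth_iterD.
  have bs (l : seq (seq V)) :
     bounded_fct (fun z => \sum_(vs <- l) iter_mean r (fun y => iterD vs f y ^+ 2) z) /\
     coord_mean i (fun z => \sum_(vs <- l) iter_mean r (fun y => iterD vs f y ^+ 2) z) x
     = \sum_(vs <- l) iter_mean (i :: r) (fun y => iterD vs f y ^+ 2) x.
    elim: l => [|vs l [IH1 IH2]].
      rewrite big_nil (_ : (fun z => _) = fun=> 0).
        by split; [exact: bounded_fct_cst|exact: coord_mean_cst].
      by apply/funext => z; rewrite big_nil.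
    rewrite big_cons -IH2 -[iter_mean (i :: r) _ x]/(coord_mean i _ x).
    rewrite -(coord_meanD _ _ (bb vs) IH1) (_ : (fun z => _) = (fun z =>
      iter_mean r (fun y => iterD vs f y ^+ 2) z +
      \sum_(ws <- l) iter_mean r (fun y => iterD ws f y ^+ 2) z)).
      by split; [exact: bounded_fctD|].
    by apply/funext => z; rewrite big_cons.
  have [b1 <-] := bs L.
  rewrite -(coord_meanZ _ _ _ b1); apply: coord_mean_le.
  - exact/torus_smooth_bounded/sqs.
  - exact: bounded_fctZ.
  - by move=> y; exact: IH.
move=> f x sf.
have sg := torus_smooth_dirD (delta_mx 0 i) sf.
have sf2 := sqs _ sf; have sg2 := sqs _ sg.
have bf2 := torus_smooth_bounded sf2; have bg2 := torus_smooth_bounded sg2.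
have d2 : dirD (delta_mx 0 i) (fun y => f y ^+ 2) =
    fun y => f y * dirD (delta_mx 0 i) f y + f y * dirD (delta_mx 0 i) f y.
  exact: (dirDM _ sf sf).
have sd2 := torus_smooth_dirD (delta_mx 0 i) sf2.
have bd2 := torus_smooth_bounded sd2.
apply: (le_trans (coord_sobolev x (proj1 sf2) bf2 bd2
  (torus_smooth_unif_derive (delta_mx 0 i) sf2))).
rewrite big_cat/= big_map.
have -> : \sum_(vs <- L) coord_mean i (iter_mean r
    (fun y => iterD (rcons vs (delta_mx 0 i)) f y ^+ 2)) x =
  \sum_(vs <- L) iter_mean (i :: r)
    (fun y => iterD vs (dirD (delta_mx 0 i) f) y ^+ 2) x.
  by apply: eq_bigr => vs _; rewrite /iterD foldr_rcons.
have h1 := step f x sf; have h2 := step _ x sg.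
rewrite -[X in _ <= X]mulrA [X in _ <= _ * X]mulrDr.
apply: (@le_trans _ _ ((1 + 2 * pi) * (coord_mean i (fun y => f y ^+ 2) x +
   coord_mean i (fun y => dirD (delta_mx 0 i) f y ^+ 2) x))); last first.
  by rewrite ler_wpM2l ?addr_ge0// lerD.
rewrite [X in _ <= X]mulrDl [X in _ <= X + _]mul1r lerD//.
  rewrite lerDl -(coord_mean_cst i 0 x); apply: coord_mean_le => //.
    exact: bounded_fct_cst.
  by move=> y; exact: sqr_ge0.
rewrite ler_wpM2l// -coord_meanD//; apply: coord_mean_le.
- exact/bounded_fct_norm/torus_smooth_bounded.
- exact: bounded_fctD.
- move=> y; rewrite d2 ler_norml; set a := f y; set b := dirD _ _ _.
  by apply/andP; split; [have := sqr_ge0 (a + b)|have := sqr_ge0 (a - b)]; nra.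
Qed.

Lemma sobolev : exists (C : R) (L : seq (seq V)), 0 <= C /\
  forall f x, torus_smooth f ->
    f x ^+ 2 <= C * \sum_(vs <- L) mean x (fun y => iterD vs f y ^+ 2).
Proof. exact: sobolev_iter. Qed.

End TorusMean.

(** * The system in an orthonormal frame *)

Section Frame.
Variables (R : realType) (D : nat).
Local Notation V := 'rV[R]_D.
Implicit Types (f g : V -> R) (x y v : V) (i j a b : 'I_D) (s : 'I_D -> R).

(** At a fixed time the orthonormal frame is e_i = s_i d_i with constants
    s_i = t^(1 - p_i); a factor t is included, so that the estimates are those
    of a wave equation in log t. *)
Definition frameD s i f : V -> R := fun x => s i * dirD (delta_mx 0 i) f x.

Lemma torus_smooth_frameD s i f : torus_smooth f -> torus_smooth (frameD s i f).
Proof. by move=> sf; exact: (torus_smoothZ _ (torus_smooth_dirD _ sf)). Qed.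

Lemma frameDD s i f g : torus_smooth f -> torus_smooth g ->
  frameD s i (fun x => f x + g x) = fun x => frameD s i f x + frameD s i g x.
Proof. by move=> sf sg; apply/funext => x; rewrite /frameD (dirDD _ sf sg) mulrDr. Qed.

Lemma frameDB s i f g : torus_smooth f -> torus_smooth g ->
  frameD s i (fun x => f x - g x) = fun x => frameD s i f x - frameD s i g x.
Proof. by move=> sf sg; apply/funext => x; rewrite /frameD (dirDB _ sf sg) mulrBr. Qed.

Lemma frameDZ s i c f : torus_smooth f ->
  frameD s i (fun x => c * f x) = fun x => c * frameD s i f x.
Proof. by move=> sf; apply/funext => x; rewrite /frameD (dirDZ _ _ sf) mulrCA. Qed.

Lemma frameD_sum s i (I : Type) (r : seq I) (F : I -> V -> R) :
  (forall k, torus_smooth (F k)) ->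
  frameD s i (fun x => \sum_(k <- r) F k x) = fun x => \sum_(k <- r) frameD s i (F k) x.
Proof. by move=> sF; apply/funext => x; rewrite /frameD (dirD_sum _ _ sF) mulr_sumr. Qed.

Lemma frameDC s i j f : torus_smooth f ->
  frameD s i (frameD s j f) = frameD s j (frameD s i f).
Proof.
move=> sf; apply/funext => x; rewrite /frameD.
rewrite (dirDZ _ _ (torus_smooth_dirD _ sf)) (dirDZ _ _ (torus_smooth_dirD _ sf)).
by rewrite (dirDC _ _ sf) mulrCA.
Qed.

Lemma dirD_frameD v s i f : torus_smooth f ->
  dirD v (frameD s i f) = frameD s i (dirD v f).
Proof.
move=> sf; rewrite /frameD (dirDZ _ _ (torus_smooth_dirD _ sf)).
by rewrite (dirDC _ _ sf).
Qed.

Lemma mean_frameD0 x s i f : torus_smooth f -> mean x (frameD s i f) = 0.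
Proof.
move=> sf; rewrite /frameD (meanZ _ _ (torus_smooth_dirD _ sf)).
by rewrite mean_dirD0// mulr0.
Qed.

Lemma frameDM s i f g : torus_smooth f -> torus_smooth g ->
  frameD s i (fun x => f x * g x) = fun x => f x * frameD s i g x + g x * frameD s i f x.
Proof.
move=> sf sg; apply/funext => x; rewrite /frameD (dirDM _ sf sg); ring.
Qed.

Lemma mean_frame_ibp x s i f g : torus_smooth f -> torus_smooth g ->
  mean x (fun y => f y * frameD s i g y) = - mean x (fun y => frameD s i f y * g y).
Proof.
move=> sf sg; have := mean_frameD0 x s i (torus_smoothM sf sg).
have sf' := torus_smooth_frameD s i sf; have sg' := torus_smooth_frameD s i sg.
rewrite (frameDM _ _ sf sg) (meanD _ (torus_smoothM sf sg') (torus_smoothM sg sf')).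
move/eqP; rewrite addr_eq0 => /eqP ->; congr (- mean x _).
by apply/funext => y; rewrite mulrC.
Qed.

(** The equation is tested against nu; the cross term is absorbed by the Cauchy
    inequality. *)
Lemma elliptic_mean x s (f nu : V -> R) : torus_smooth f -> torus_smooth nu ->
  (forall y, nu y - \sum_(a < D) frameD s a (frameD s a nu) y = f y) ->
  mean x (fun y => nu y ^+ 2) + 2 * \sum_(a < D) mean x (fun y => frameD s a nu y ^+ 2)
    <= mean x (fun y => f y ^+ 2).
Proof.
move=> sf sn E.
have se a := torus_smooth_frameD s a sn.
have see a := torus_smooth_frameD s a (se a).
have h : mean x (fun y => nu y ^+ 2) =
   - \sum_(a < D) mean x (fun y => frameD s a nu y ^+ 2) + mean x (fun y => nu y * f y).
  have -> : (fun y => nu y ^+ 2) = (fun y =>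
      \sum_(a < D) nu y * frameD s a (frameD s a nu) y + nu y * f y).
    by apply/funext => y; rewrite -mulr_sumr -mulrDr -E addrC subrK.
  rewrite (meanD _ (torus_smooth_sum _ (fun a => torus_smoothM sn (see a)))
    (torus_smoothM sn sf)); congr (_ + _).
  rewrite (mean_sum _ _ (fun a => torus_smoothM sn (see a))) -sumrN.
  by apply: eq_bigr => a _; rewrite (mean_frame_ibp _ _ _ sn (se a)).
have h2 : 2 * mean x (fun y => nu y * f y) <=
    mean x (fun y => nu y ^+ 2) + mean x (fun y => f y ^+ 2).
  rewrite -(meanZ _ _ (torus_smoothM sn sf)) -(meanD _ (torus_smoothM sn sn) (torus_smoothM sf sf)).
  apply: mean_le.
  - exact: (torus_smoothZ _ (torus_smoothM sn sf)).
  - exact: (torus_smoothD (torus_smoothM sn sn) (torus_smoothM sf sf)).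
  - by move=> y; have := sqr_ge0 (nu y - f y); nra.
move: h h2; move: (mean _ _) (mean _ _) (mean _ _) (\sum_(_ < _) _) => A B C S; lra.
Qed.

(** The unknowns in the orthonormal frame: H and L are the frame components of
    eta and K, which makes H symmetric. *)
Record fields := Fields {
  fH : 'I_D -> 'I_D -> V -> R; fL : 'I_D -> 'I_D -> V -> R;
  fphi : V -> R; fpsi : V -> R; fnu : V -> R }.

Definition fields_smooth (F : fields) :=
  [/\ forall i j, torus_smooth (fH F i j), forall i j, torus_smooth (fL F i j),
      torus_smooth (fphi F), torus_smooth (fpsi F) & torus_smooth (fnu F)].

Definition trH (F : fields) x := \sum_(a < D) fH F a a x.
Definition divH s (F : fields) j x := \sum_(a < D) frameD s a (fH F a j) x.

Variables (p : 'I_D -> R) (pphi : R).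

Definition momentum_source (F : fields) i x :=
  \sum_(a < D) (p i - p a) * fH F a a x + 2 * pphi * fphi F x.

(** The right-hand side of the lapse equation is the divergence of this first
    order expression, so that it can be integrated by parts against nu. *)
Definition lapse_flux s (F : fields) a x :=
  -2 * frameD s a (trH F) x + 2 * divH s F a x.

(** What the energy estimate uses on one time slice. *)
Record frame_constraints s (F : fields) : Prop := FrameConstraints {
  fc_symH : forall i j x, fH F i j x = fH F j i x;
  fc_symL : forall i j x, fL F i j x = fL F j i x - 2 * (p i - p j) * fH F i j x;
  fc_momentum : forall i x,
    \sum_(j < D) frameD s j (fL F i j) x + frameD s i (momentum_source F i) x = 0;
  fc_lapse : forall x, fnu F x - \sum_(a < D) frameD s a (frameD s a (fnu F)) x =
    \sum_(a < D) frameD s a (lapse_flux s F a) x }.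

Definition rateH s (F : fields) i j x :=
  fL F i j x + (p i - p j) * fH F i j x - p i * (i == j)%:R * fnu F x.

(** Grouping the three terms of the L equation that are of the form e_j of
    something: summed against L, they only see the divergence of L in its second
    index. *)
Definition potential s (F : fields) i x :=
  frameD s i (trH F) x - divH s F i x - frameD s i (fnu F) x.

Definition rateL s (F : fields) i j x :=
  (p j - p i) * fL F i j x + \sum_(a < D) frameD s a (frameD s a (fH F i j)) x
  + frameD s j (potential s F i) x - frameD s i (divH s F j) x
  + p i * (i == j)%:R * fnu F x.

Definition rate_phi (F : fields) x := fpsi F x + pphi * fnu F x.
Definition rate_psi s (F : fields) x :=
  \sum_(a < D) frameD s a (frameD s a (fphi F)) x - pphi * fnu F x.

Definition energy_density s (F : fields) x :=
  \sum_(i < D) \sum_(j < D) (fH F i j x ^+ 2 + fL F i j x ^+ 2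
     + \sum_(a < D) frameD s a (fH F i j) x ^+ 2)
  + (fphi F x ^+ 2 + fpsi F x ^+ 2 + \sum_(a < D) frameD s a (fphi F) x ^+ 2).

(** Half of t d/dt of the energy density, after substitution of the evolution
    equations. *)
Definition energy_rate s (F : fields) x :=
  \sum_(i < D) \sum_(j < D) (fH F i j x * rateH s F i j x + fL F i j x * rateL s F i j x
     + \sum_(a < D) frameD s a (fH F i j) x *
         ((1 - p a) * frameD s a (fH F i j) x + frameD s a (rateH s F i j) x))
  + (fphi F x * rate_phi F x + fpsi F x * rate_psi s F x
     + \sum_(a < D) frameD s a (fphi F) x *
         ((1 - p a) * frameD s a (fphi F) x + frameD s a (rate_phi F) x)).

End Frame.

(** * The energy estimate on one time slice *)

Section StaticEnergy.
Variables (R : realType) (D : nat) (p : 'I_D -> R) (pphi : R).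
Local Notation V := 'rV[R]_D.
Implicit Types (i j a b : 'I_D).

Definition config : Type := (('I_D -> R) * fields R D * V)%type.
Definition admissible (d : config) : Prop :=
  fields_smooth d.1.2 /\ frame_constraints p pphi d.1.1 d.1.2.
(** Constants in the energy estimate must not depend on the solution, the time or
    the base point. Expressions are therefore treated as functions of a whole
    configuration (scales, fields, base point), and the predicates below
    quantify the constant before the configuration. *)
Definition observable : Type := config -> V -> R.
Implicit Types u w : observable.

Definition smooth_obs u := forall d, admissible d -> torus_smooth (u d).
Definition energy (d : config) : R := mean d.2 (energy_density d.1.1 d.1.2).

(** Satisfied by the unknowns and by the frame derivatives of H, phi and nu. *)
Definition controlled u := smooth_obs u /\ exists2 C : R, 0 <= C &
  forall d, admissible d -> mean d.2 (fun y => u d y ^+ 2) <= C * energy d.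

(** Satisfied by the products of two controlled observables, and by products with
    a second derivative once an integration by parts has removed it. *)
Definition mean_controlled u := smooth_obs u /\ exists2 C : R, 0 <= C &
  forall d, admissible d -> `|mean d.2 (u d)| <= C * energy d.

Definition oH i j : observable := fun d => fH d.1.2 i j.
Definition oL i j : observable := fun d => fL d.1.2 i j.
Definition ophi : observable := fun d => fphi d.1.2.
Definition opsi : observable := fun d => fpsi d.1.2.
Definition onu : observable := fun d => fnu d.1.2.
Definition oD i u : observable := fun d => frameD d.1.1 i (u d).

Lemma smooth_oD i u : smooth_obs u -> smooth_obs (oD i u).
Proof. by move=> su d ok; exact: (torus_smooth_frameD _ _ (su d ok)). Qed.

Lemma smooth_oH i j : smooth_obs (oH i j).
Proof. by move=> d [[sH _ _ _ _] _]; exact: sH. Qed.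
Lemma smooth_oL i j : smooth_obs (oL i j).
Proof. by move=> d [[_ sL _ _ _] _]; exact: sL. Qed.
Lemma smooth_ophi : smooth_obs ophi.
Proof. by move=> d [[_ _ sphi _ _] _]; exact: sphi. Qed.
Lemma smooth_opsi : smooth_obs opsi.
Proof. by move=> d [[_ _ _ spsi _] _]; exact: spsi. Qed.
Lemma smooth_onu : smooth_obs onu.
Proof. by move=> d [[_ _ _ _ snu] _]; exact: snu. Qed.

Lemma smooth_obsD u w : smooth_obs u -> smooth_obs w ->
  smooth_obs (fun d y => u d y + w d y).
Proof. by move=> su sw d ok; exact: (torus_smoothD (su d ok) (sw d ok)). Qed.
Lemma smooth_obsM u w : smooth_obs u -> smooth_obs w ->
  smooth_obs (fun d y => u d y * w d y).
Proof. by move=> su sw d ok; exact: (torus_smoothM (su d ok) (sw d ok)). Qed.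
Lemma smooth_obsZ c u : smooth_obs u -> smooth_obs (fun d y => c * u d y).
Proof. by move=> su d ok; exact: (torus_smoothZ _ (su d ok)). Qed.
Lemma smooth_obs_sum (w : 'I_D -> observable) :
  (forall a, smooth_obs (w a)) -> smooth_obs (fun d y => \sum_(a < D) w a d y).
Proof. by move=> sw d ok; exact: (torus_smooth_sum _ (fun a => sw a d ok)). Qed.

Lemma smooth_energy_density d : admissible d ->
  torus_smooth (energy_density d.1.1 d.1.2).
Proof.
move=> ok; apply: torus_smoothD.
  apply: torus_smooth_sum => i; apply: torus_smooth_sum => j.
  apply: torus_smoothD.
    apply: torus_smoothD.
      by exact: (torus_smoothM (smooth_oH i j ok) (smooth_oH i j ok)).
    by exact: (torus_smoothM (smooth_oL i j ok) (smooth_oL i j ok)).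
  apply: torus_smooth_sum => a.
  have sD := torus_smooth_frameD d.1.1 a (smooth_oH i j ok).
  exact: (torus_smoothM sD sD).
apply: torus_smoothD.
  by exact: (torus_smoothD (torus_smoothM (smooth_ophi ok) (smooth_ophi ok))
    (torus_smoothM (smooth_opsi ok) (smooth_opsi ok))).
apply: torus_smooth_sum => a.
have sD := torus_smooth_frameD d.1.1 a (smooth_ophi ok).
exact: (torus_smoothM sD sD).
Qed.


Lemma controlled_eq u w : controlled u -> (forall d, admissible d -> u d = w d) ->
  controlled w.
Proof.
move=> [su [C C0 uC]] uw; split; first by move=> d ok; rewrite -(uw _ ok); exact: su.
by exists C => // d ok; rewrite -(uw _ ok); exact: uC.
Qed.

Lemma controlledD u w : controlled u -> controlled w ->
  controlled (fun d y => u d y + w d y).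
Proof.
move=> [su [A A0 uA]] [sw [B B0 wB]]; split; first exact: smooth_obsD.
exists (2 * A + 2 * B); first by rewrite addr_ge0// mulr_ge0.
move=> d ok; have [su' sw'] := (su d ok, sw d ok).
have su2 := torus_smoothM su' su'; have sw2 := torus_smoothM sw' sw'.
have suw := torus_smoothD su' sw'.
apply: (@le_trans _ _ (mean d.2 (fun y => 2 * u d y ^+ 2 + 2 * w d y ^+ 2))).
  apply: (mean_le _ (torus_smoothM suw suw)
    (torus_smoothD (torus_smoothZ 2 su2) (torus_smoothZ 2 sw2))) => y.
  by have := sqr_ge0 (u d y - w d y); nra.
rewrite (meanD _ (torus_smoothZ 2 su2) (torus_smoothZ 2 sw2)).
rewrite (meanZ _ _ su2) (meanZ _ _ sw2) [X in _ <= X]mulrDl -!mulrA.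
by rewrite lerD// ler_wpM2l//; [exact: uA|exact: wB].
Qed.

Lemma controlledZ c u : controlled u -> controlled (fun d y => c * u d y).
Proof.
move=> [su [A A0 uA]]; split; first exact: smooth_obsZ.
exists (c ^+ 2 * A); first by rewrite mulr_ge0// sqr_ge0.
move=> d ok; have su' := su d ok.
rewrite (_ : (fun y => _) = fun y => c ^+ 2 * u d y ^+ 2); last first.
  by apply/funext => y; rewrite exprMn.
rewrite (meanZ _ _ (torus_smoothM su' su')) -mulrA ler_wpM2l ?sqr_ge0//.
exact: uA.
Qed.

Lemma controlledN u : controlled u -> controlled (fun d y => - u d y).
Proof.
move=> cu; apply: controlled_eq (controlledZ (-1) cu) _ => d _.
by apply/funext => y; rewrite mulN1r.
Qed.

Lemma controlledB u w : controlled u -> controlled w ->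
  controlled (fun d y => u d y - w d y).
Proof. by move=> cu cw; exact: (controlledD cu (controlledN cw)). Qed.

Lemma controlled0 : controlled (fun _ _ => 0).
Proof.
split; first by move=> d _; exact: torus_smooth_cst.
exists 0 => // d _; rewrite mul0r (_ : (fun y => _) = fun=> 0) ?mean_cst//.
by apply/funext => y; rewrite expr0n.
Qed.

Lemma controlled_sum (r : seq 'I_D) (w : 'I_D -> observable) :
  (forall a, controlled (w a)) -> controlled (fun d y => \sum_(a <- r) w a d y).
Proof.
move=> cw; elim: r => [|a r IH].
  apply: controlled_eq controlled0 _ => d _.
  by apply/funext => y; rewrite big_nil.
apply: controlled_eq (controlledD (cw a) IH) _ => d _.
by apply/funext => y; rewrite big_cons.
Qed.

Lemma controlled_le u : smooth_obs u ->
  (forall d, admissible d -> forall y, u d y ^+ 2 <= energy_density d.1.1 d.1.2 y) ->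
  controlled u.
Proof.
move=> su uE; split=> //; exists 1 => // d ok; rewrite mul1r.
apply: mean_le; [exact: (torus_smoothM (su d ok) (su d ok))| |exact: uE].
exact: smooth_energy_density.
Qed.

Lemma le_sum_term (h : 'I_D -> R) a : (forall b, 0 <= h b) -> h a <= \sum_(b < D) h b.
Proof. by move=> h0; rewrite (bigD1 a)//= lerDl sumr_ge0. Qed.

Lemma le_sum_sqr (h : 'I_D -> R) a : h a ^+ 2 <= \sum_(b < D) h b ^+ 2.
Proof. by apply: (@le_sum_term (fun b => h b ^+ 2)) => b; exact: sqr_ge0. Qed.

Lemma sum_sqr_ge0 (h : 'I_D -> R) : 0 <= \sum_(b < D) h b ^+ 2.
Proof. by rewrite sumr_ge0// => b _; exact: sqr_ge0. Qed.

Lemma energy_density_geH (d : config) i j y :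
  fH d.1.2 i j y ^+ 2 + fL d.1.2 i j y ^+ 2 +
    \sum_(a < D) frameD d.1.1 a (fH d.1.2 i j) y ^+ 2
  <= energy_density d.1.1 d.1.2 y.
Proof.
pose X i j := fH d.1.2 i j y ^+ 2 + fL d.1.2 i j y ^+ 2 +
    \sum_(a < D) frameD d.1.1 a (fH d.1.2 i j) y ^+ 2.
have X0 k l : 0 <= X k l.
  by rewrite !addr_ge0 ?sqr_ge0//; exact: (sum_sqr_ge0 (fun a => frameD _ a _ y)).
rewrite -/(X i j); apply: (le_trans (le_sum_term j (X0 i))).
apply: (le_trans (le_sum_term (h := fun i => \sum_(j < D) X i j) i _)).
  by move=> k; exact: sumr_ge0.
rewrite lerDl !addr_ge0 ?sqr_ge0//; exact: (sum_sqr_ge0 (fun a => frameD _ a _ y)).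
Qed.

Lemma energy_density_gephi (d : config) y :
  fphi d.1.2 y ^+ 2 + fpsi d.1.2 y ^+ 2 +
    \sum_(a < D) frameD d.1.1 a (fphi d.1.2) y ^+ 2
  <= energy_density d.1.1 d.1.2 y.
Proof.
rewrite /energy_density lerDr; apply: sumr_ge0 => b _; apply: sumr_ge0 => c _.
by rewrite !addr_ge0 ?sqr_ge0//; apply: sumr_ge0 => a _; exact: sqr_ge0.
Qed.

Lemma controlled_oH i j : controlled (oH i j).
Proof.
apply: controlled_le (smooth_oH i j) _ => d _ y; apply: le_trans (energy_density_geH d i j y).
by rewrite -addrA lerDl addr_ge0 ?sqr_ge0 ?sum_sqr_ge0.
Qed.

Lemma controlled_oL i j : controlled (oL i j).
Proof.
apply: controlled_le (smooth_oL i j) _ => d _ y; apply: le_trans (energy_density_geH d i j y).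
by rewrite addrAC lerDr addr_ge0 ?sqr_ge0 ?sum_sqr_ge0.
Qed.

Lemma controlled_oDH a i j : controlled (oD a (oH i j)).
Proof.
apply: controlled_le (smooth_oD a (smooth_oH i j)) _ => d _ y.
apply: le_trans (energy_density_geH d i j y).
apply: (le_trans (le_sum_sqr (fun a => frameD d.1.1 a (fH d.1.2 i j) y) a)).
by rewrite lerDr addr_ge0 ?sqr_ge0.
Qed.

Lemma controlled_ophi : controlled ophi.
Proof.
apply: controlled_le smooth_ophi _ => d _ y; apply: le_trans (energy_density_gephi d y).
by rewrite -addrA lerDl addr_ge0 ?sqr_ge0 ?sum_sqr_ge0.
Qed.

Lemma controlled_opsi : controlled opsi.
Proof.
apply: controlled_le smooth_opsi _ => d _ y; apply: le_trans (energy_density_gephi d y).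
by rewrite addrAC lerDr addr_ge0 ?sqr_ge0 ?sum_sqr_ge0.
Qed.

Lemma controlled_oDphi a : controlled (oD a ophi).
Proof.
apply: controlled_le (smooth_oD a smooth_ophi) _ => d _ y.
apply: le_trans (energy_density_gephi d y).
apply: (le_trans (le_sum_sqr (fun a => frameD d.1.1 a (fphi d.1.2) y) a)).
by rewrite lerDr addr_ge0 ?sqr_ge0.
Qed.

Lemma mean_controlled_eq u w : mean_controlled u ->
  (forall d, admissible d -> u d = w d) -> mean_controlled w.
Proof.
move=> [su [C C0 uC]] uw; split; first by move=> d ok; rewrite -(uw _ ok); exact: su.
by exists C => // d ok; rewrite -(uw _ ok); exact: uC.
Qed.

Lemma mean_controlled_mean u w : smooth_obs w -> mean_controlled u ->
  (forall d, admissible d -> mean d.2 (w d) = - mean d.2 (u d)) -> mean_controlled w.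
Proof.
move=> sw [su [C C0 uC]] uw; split=> //.
by exists C => // d ok; rewrite (uw _ ok) normrN; exact: uC.
Qed.

Lemma mean_controlledD u w : mean_controlled u -> mean_controlled w ->
  mean_controlled (fun d y => u d y + w d y).
Proof.
move=> [su [A A0 uA]] [sw [B B0 wB]]; split; first exact: smooth_obsD.
exists (A + B); first exact: addr_ge0.
move=> d ok; rewrite (meanD _ (su d ok) (sw d ok)) mulrDl.
by rewrite (le_trans (ler_normD _ _))// lerD//; [exact: uA|exact: wB].
Qed.

Lemma mean_controlledZ c u : mean_controlled u -> mean_controlled (fun d y => c * u d y).
Proof.
move=> [su [A A0 uA]]; split; first exact: smooth_obsZ.
exists (`|c| * A); first exact: mulr_ge0.
by move=> d ok; rewrite (meanZ _ _ (su d ok)) normrM -mulrA ler_wpM2l//; exact: uA.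
Qed.

Lemma mean_controlled0 : mean_controlled (fun _ _ => 0).
Proof.
split; first by move=> d _; exact: torus_smooth_cst.
by exists 0 => // d _; rewrite mul0r mean_cst normr0.
Qed.

Lemma mean_controlled_sum (r : seq 'I_D) (w : 'I_D -> observable) :
  (forall a, mean_controlled (w a)) -> mean_controlled (fun d y => \sum_(a <- r) w a d y).
Proof.
move=> cw; elim: r => [|a r IH].
  apply: mean_controlled_eq mean_controlled0 _ => d _.
  by apply/funext => y; rewrite big_nil.
apply: mean_controlled_eq (mean_controlledD (cw a) IH) _ => d _.
by apply/funext => y; rewrite big_cons.
Qed.

Lemma controlledM u w : controlled u -> controlled w ->
  mean_controlled (fun d y => u d y * w d y).
Proof.
move=> [su [A A0 uA]] [sw [B B0 wB]]; split; first exact: smooth_obsM.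
exists (A + B); first exact: addr_ge0.
move=> d ok; have [su' sw'] := (su d ok, sw d ok).
have [uA' wB'] := (uA d ok, wB d ok).
have suw := torus_smoothM su' sw'.
have su2 := torus_smoothM su' su'; have sw2 := torus_smoothM sw' sw'.
have s2 := torus_smoothD su2 sw2.
rewrite mulrDl; apply: le_trans (lerD uA' wB').
rewrite -(meanD _ su2 sw2) ler_norml -(meanN _ s2).
apply/andP; split; [apply: (mean_le _ (torus_smoothN s2) suw)|
                    apply: (mean_le _ suw s2)] => y.
- have := sqr_ge0 (u d y + w d y).
  by have := sqr_ge0 (u d y); have := sqr_ge0 (w d y); nra.
- have := sqr_ge0 (u d y - w d y).
  by have := sqr_ge0 (u d y); have := sqr_ge0 (w d y); nra.
Qed.


Lemma mean_controlled_divergence a u : smooth_obs u -> mean_controlled (oD a u).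
Proof.
move=> su; split; first exact: smooth_oD.
by exists 0 => // d ok; rewrite mean_frameD0 ?normr0 ?mul0r//; exact: su.
Qed.

(** A second derivative of the unknowns is harmless when contracted with a field
    whose divergence is of first order. *)
Lemma mean_controlled_flux (w : 'I_D -> observable) u : (forall a, smooth_obs (w a)) ->
  controlled (fun d y => \sum_(a < D) oD a (w a) d y) -> controlled u ->
  mean_controlled (fun d y => \sum_(a < D) w a d y * oD a u d y).
Proof.
move=> sw cdiv cu; have [su _] := cu.
have sfl := smooth_obs_sum (fun a => smooth_obsM (sw a) (smooth_oD a su)).
apply: (mean_controlled_mean sfl (controlledM cdiv cu)) => d ok.
have s1 a := torus_smoothM (sw a d ok) (smooth_oD a su ok).
rewrite (mean_sum _ _ s1) (_ : (fun y => (\sum_(a < D) _) * _) =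
  (fun y => \sum_(a < D) oD a (w a) d y * u d y)); last first.
  by apply/funext => y; rewrite mulr_suml.
have s2 a := torus_smoothM (smooth_oD a (sw a) ok) (su d ok).
rewrite (mean_sum _ _ s2) -sumrN; apply: eq_bigr => a _.
by rewrite (mean_frame_ibp _ _ _ (sw a d ok) (su d ok)).
Qed.

Definition otrH : observable := fun d => trH d.1.2.
Definition odivH j : observable := fun d => divH d.1.1 d.1.2 j.


Lemma controlled_oDtrH i : controlled (oD i otrH).
Proof.
apply: controlled_eq (controlled_sum (index_enum _) (fun a => controlled_oDH i a a)) _.
by move=> d ok; rewrite /oD /otrH /trH (frameD_sum _ _ _ (fun a => smooth_oH a a ok)).
Qed.

Lemma controlled_odivH j : controlled (odivH j).
Proof. exact: (controlled_sum _ (fun a => controlled_oDH a a j)). Qed.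

(** This is where the momentum constraint enters: it replaces the divergence of L
    by first derivatives of H and phi. *)
Lemma controlled_divL i : controlled (fun d y => \sum_(j < D) oD j (oL i j) d y).
Proof.
have c := controlledN (controlledD
  (controlled_sum (index_enum _) (fun a => controlledZ (p i - p a) (controlled_oDH i a a)))
  (controlledZ (2 * pphi) (controlled_oDphi i))).
apply: (controlled_eq c) => d ok; apply/funext => y.
have [_ [_ _ /(_ i y) mom _]] := ok.
apply/eqP; rewrite eq_sym -addr_eq0 -[X in _ == X]mom; apply/eqP; congr (_ + _).
have sH a := torus_smoothZ (p i - p a) (smooth_oH a a ok).
rewrite /momentum_source (frameDD _ _ (torus_smooth_sum _ sH)
  (torus_smoothZ (2 * pphi) (smooth_ophi ok))) (frameD_sum _ _ _ sH).
rewrite (frameDZ _ _ _ (smooth_ophi ok)); congr (_ + _); apply: eq_bigr => a _.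
by rewrite (frameDZ _ _ _ (smooth_oH a a ok)).
Qed.

(** The divergence in the other index, from the symmetry of the second
    fundamental form: L is symmetric up to a multiple of H. *)
Lemma controlled_divLT j : controlled (fun d y => \sum_(i < D) oD i (oL i j) d y).
Proof.
have c := controlledB (controlled_divL j)
  (controlled_sum (index_enum _)
    (fun i => controlledZ (2 * (p i - p j)) (controlled_oDH i i j))).
apply: (controlled_eq c) => d ok; apply/funext => y.
have [_ [_ symL _ _]] := ok.
rewrite -sumrB; apply: eq_bigr => i _.
rewrite /oD (_ : oL i j d = fun z => oL j i d z - 2 * (p i - p j) * oH i j d z); last first.
  by apply/funext => z; exact: symL.
rewrite (frameDB _ _ (smooth_oL j i ok) (torus_smoothZ _ (smooth_oH i j ok))).
by rewrite (frameDZ _ _ _ (smooth_oH i j ok)).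
Qed.

Definition olapse_flux a : observable := fun d => lapse_flux d.1.1 d.1.2 a.

Lemma controlled_lapse_flux a : controlled (olapse_flux a).
Proof.
exact: (controlledD (controlledZ (-2) (controlled_oDtrH a))
  (controlledZ 2 (controlled_odivH a))).
Qed.

(** The lapse equation is nu = sum_a e_a (e_a nu + flux_a); it is tested against
    nu and the square of e_a nu + flux_a is completed. *)
Lemma lapse_estimate d : admissible d ->
  2 * mean d.2 (fun y => onu d y ^+ 2) +
    \sum_(a < D) mean d.2 (fun y => oD a onu d y ^+ 2) <=
  \sum_(a < D) mean d.2 (fun y => olapse_flux a d y ^+ 2).
Proof.
move=> ok; have sn := smooth_onu ok.
have sF a : torus_smooth (olapse_flux a d) by have [s _] := controlled_lapse_flux a; exact: s.
have sDn a := torus_smooth_frameD d.1.1 a sn.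
have [_ [_ _ _ lap]] := ok.
have E : mean d.2 (fun y => onu d y ^+ 2) = - \sum_(a < D)
   mean d.2 (fun y => oD a onu d y * (oD a onu d y + olapse_flux a d y)).
  have s2 a := torus_smoothD (sDn a) (sF a).
  have s3 a := torus_smoothM sn (torus_smooth_frameD d.1.1 a (s2 a)).
  rewrite (_ : (fun y => onu d y ^+ 2) = (fun y => \sum_(a < D) onu d y *
      frameD d.1.1 a (fun z => oD a onu d z + olapse_flux a d z) y)).
    rewrite (mean_sum _ _ s3) -sumrN; apply: eq_bigr => a _.
    by rewrite (mean_frame_ibp _ _ _ sn (s2 a)).
  apply/funext => y; rewrite -mulr_sumr expr2; congr (_ * _).
  have /eqP := lap y; rewrite subr_eq addrC => /eqP lapy.
  rewrite [LHS]lapy -big_split /=.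
  by apply: eq_bigr => a _; rewrite (frameDD _ _ (sDn a) (sF a)).
rewrite E mulrN mulr_sumr addrC -sumrB; apply: ler_sum => a _.
have sX := torus_smoothD (sDn a) (sF a).
rewrite -(meanZ _ _ (torus_smoothM (sDn a) sX)).
have sX2 := torus_smoothZ 2 (torus_smoothM (sDn a) sX).
have sD2 := torus_smoothM (sDn a) (sDn a).
rewrite -(meanN _ sX2) -(meanD _ sD2 (torus_smoothN sX2)).
apply: (mean_le _ (torus_smoothB sD2 sX2) (torus_smoothM (sF a) (sF a))) => y.
have := sqr_ge0 (oD a onu d y + olapse_flux a d y); rewrite /oD; nra.
Qed.

Lemma lapse_controlled : controlled onu /\ forall a, controlled (oD a onu).
Proof.
have [C C0 CP] : exists2 C : R, 0 <= C & forall d, admissible d ->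
    \sum_(a < D) mean d.2 (fun y => olapse_flux a d y ^+ 2) <= C * energy d.
  elim: (index_enum _) => [|a r [C C0 IH]].
    by exists 0 => // d ok; rewrite big_nil mul0r.
  have [_ [C' C'0 H]] := controlled_lapse_flux a.
  exists (C' + C); first exact: addr_ge0.
  by move=> d ok; rewrite big_cons mulrDl lerD//; [exact: H|exact: IH].
have m0 u d : smooth_obs u -> admissible d -> 0 <= mean d.2 (fun y => u d y ^+ 2).
  move=> su ok; apply: (mean_ge0 _ (torus_smoothM (su d ok) (su d ok))) => y.
  exact: sqr_ge0.
have sD a := smooth_oD a smooth_onu.
split=> [|a]; split; [exact: smooth_onu| |exact: sD|]; exists C => // d ok;
  apply: (le_trans _ (CP d ok)); apply: (le_trans _ (lapse_estimate ok)).
  have h1 := m0 onu d smooth_onu ok.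
  have h2 : 0 <= \sum_(a < D) mean d.2 (fun y => oD a onu d y ^+ 2).
    by apply: sumr_ge0 => a _; exact: (m0 _ _ (sD a)).
  by move: h1 h2; move: (mean _ _) (\sum_(_ < _) _) => A B; lra.
rewrite (bigD1 a)//= addrCA lerDl addr_ge0//.
  by rewrite mulr_ge0// (m0 onu d smooth_onu ok).
by apply: sumr_ge0 => b _; exact: (m0 _ _ (sD b)).
Qed.

End StaticEnergy.

Section EnergyRate.
Variables (R : realType) (D : nat) (p : 'I_D -> R) (pphi : R).
Local Notation V := 'rV[R]_D.
Implicit Types (i j a b : 'I_D).
Local Notation admissible := (@admissible R D p pphi).
Local Notation controlled := (@controlled R D p pphi).
Local Notation mean_controlled := (@mean_controlled R D p pphi).
Local Notation config := (config R D).

Definition orateH i j (d : config) := rateH p d.1.1 d.1.2 i j.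
Definition opotential i (d : config) := potential d.1.1 d.1.2 i.
Definition orate_phi (d : config) := rate_phi pphi d.1.2.
Definition kron i j : R := (i == j)%:R.

Lemma frameD_rateH a i j d : admissible d ->
  frameD d.1.1 a (orateH i j d) = fun y => oD a (@oL R D i j) d y
    + (p i - p j) * oD a (@oH R D i j) d y - p i * kron i j * oD a (@onu R D) d y.
Proof.
move=> ok; have [[sH sL _ _ sn] _] := ok.
rewrite /orateH /rateH (frameDB _ _ (torus_smoothD (sL i j) (torus_smoothZ _ (sH i j)))
  (torus_smoothZ _ sn)) (frameDD _ _ (sL i j) (torus_smoothZ _ (sH i j))).
by rewrite (frameDZ _ _ _ (sH i j)) (frameDZ _ _ _ sn).
Qed.

Lemma frameD_rate_phi a d : admissible d ->
  frameD d.1.1 a (orate_phi d) = fun y => oD a (@opsi R D) d y + pphi * oD a (@onu R D) d y.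
Proof.
move=> [[_ _ _ sp sn] _].
by rewrite /orate_phi /rate_phi (frameDD _ _ sp (torus_smoothZ _ sn)) (frameDZ _ _ _ sn).
Qed.

Lemma controlled_potential i : controlled (opotential i).
Proof.
have [_ cDnu] := lapse_controlled p pphi.
exact: (controlledB (controlledB (controlled_oDtrH _ _ i) (controlled_odivH _ _ i)) (cDnu i)).
Qed.

(** The principal parts e_a e_a H . L + e_a H . e_a L form a divergence, as for
    the wave equation. The other second order terms of the L equation are
    e_j (potential_i) and e_i (div H)_j contracted with L_ij, hence fluxes
    against the divergence of L. *)
Lemma energy_rate_mean_controlled :
  mean_controlled (fun d => energy_rate p pphi d.1.1 d.1.2).
Proof.
have [cnu cDnu] := lapse_controlled p pphi.
have cH := controlled_oH p pphi; have cL := controlled_oL p pphi.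
have cDH := controlled_oDH p pphi; have cphi := controlled_ophi p pphi.
have cpsi := controlled_opsi p pphi; have cDphi := controlled_oDphi p pphi.
have sH i j := @smooth_oH R D p pphi i j; have sL i j := @smooth_oL R D p pphi i j.
have q1 i j : mean_controlled (fun d y => oH i j d y *
    (oL i j d y + (p i - p j) * oH i j d y - p i * kron i j * onu d y)).
  exact: (controlledM (cH i j) (controlledB (controlledD (cL i j)
    (controlledZ (p i - p j) (cH i j))) (controlledZ (p i * kron i j) cnu))).
have q2 i j : mean_controlled (fun d y => oL i j d y *
    ((p j - p i) * oL i j d y + p i * kron i j * onu d y)).
  exact: (controlledM (cL i j) (controlledD
    (controlledZ (p j - p i) (cL i j)) (controlledZ (p i * kron i j) cnu))).
have q3 i j : mean_controlled (fun d y => \sum_(a < D) oD a (oH i j) d y *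
    ((1 - p a + (p i - p j)) * oD a (oH i j) d y - p i * kron i j * oD a (@onu R D) d y)).
  exact: (mean_controlled_sum _ (fun a => controlledM (cDH a i j) (controlledB
    (controlledZ (1 - p a + (p i - p j)) (cDH a i j))
    (controlledZ (p i * kron i j) (cDnu a))))).
have q4 i j : mean_controlled (fun d y =>
    \sum_(a < D) oD a (fun d z => oL i j d z * oD a (oH i j) d z) d y).
  exact: (mean_controlled_sum _ (fun a => mean_controlled_divergence a
    (smooth_obsM (sL i j) (smooth_oD a (sH i j))))).
have f1 i : mean_controlled (fun d y => \sum_(j < D) oL i j d y * oD j (opotential i) d y).
  exact: (mean_controlled_flux (sL i) (controlled_divL _ _ i) (controlled_potential i)).
have f2 j : mean_controlled (fun d y => \sum_(i < D) oL i j d y * oD i (odivH j) d y).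
  exact: (mean_controlled_flux (sL ^~ j) (controlled_divLT _ _ j) (controlled_odivH _ _ j)).
have m1 : mean_controlled (fun d y => ophi d y * (opsi d y + pphi * onu d y)).
  exact: (controlledM cphi (controlledD cpsi (controlledZ pphi cnu))).
have m2 : mean_controlled (fun d y => opsi d y * (- pphi * onu d y)).
  exact: (controlledM cpsi (controlledZ (- pphi) cnu)).
have m3 : mean_controlled (fun d y => \sum_(a < D) oD a (@ophi R D) d y *
    ((1 - p a) * oD a (@ophi R D) d y + pphi * oD a (@onu R D) d y)).
  exact: (mean_controlled_sum _ (fun a => controlledM (cDphi a) (controlledD
    (controlledZ (1 - p a) (cDphi a)) (controlledZ pphi (cDnu a))))).
have m4 : mean_controlled (fun d y =>
    \sum_(a < D) oD a (fun d z => opsi d z * oD a (@ophi R D) d z) d y).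
  exact: (mean_controlled_sum _ (fun a => mean_controlled_divergence a
    (smooth_obsM (@smooth_opsi R D p pphi) (smooth_oD a (@smooth_ophi R D p pphi))))).
have N1 := mean_controlled_sum (index_enum _) (fun i => mean_controlled_sum (index_enum _) (fun j =>
  mean_controlledD (mean_controlledD (q1 i j) (q2 i j)) (mean_controlledD (q3 i j) (q4 i j)))).
have N2 := mean_controlledD (mean_controlled_sum (index_enum _) f1)
  (mean_controlledZ (-1) (mean_controlled_sum (index_enum _) f2)).
have N3 := mean_controlledD (mean_controlledD m1 m2) (mean_controlledD m3 m4).
apply: (mean_controlled_eq (mean_controlledD (mean_controlledD N1 N2) N3)) => d ok; apply/funext => y.
rewrite /energy_rate; congr (_ + _); last first.
  have E : \sum_(a < D) frameD d.1.1 a (fphi d.1.2) y *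
      ((1 - p a) * frameD d.1.1 a (fphi d.1.2) y + frameD d.1.1 a (rate_phi pphi d.1.2) y)
    + opsi d y * \sum_(a < D) frameD d.1.1 a (frameD d.1.1 a (fphi d.1.2)) y =
    \sum_(a < D) oD a (@ophi R D) d y *
      ((1 - p a) * oD a (@ophi R D) d y + pphi * oD a (@onu R D) d y)
    + \sum_(a < D) oD a (fun d z => opsi d z * oD a (@ophi R D) d z) d y.
    rewrite mulr_sumr -!big_split /=; apply: eq_bigr => a _.
    have := frameD_rate_phi a ok; rewrite /orate_phi => ->.
    have [[_ _ sphi spsi _] _] := ok.
    rewrite /oD (frameDM _ _ spsi (torus_smooth_frameD _ _ sphi)) /opsi /ophi; ring.
  rewrite -E /rate_psi /rate_phi /opsi /ophi /onu.
  move: (\sum_(a < D) _) (\sum_(a < D) _) => S1 S2; ring.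
rewrite [X in _ + (_ + -1 * X)]exchange_big mulN1r.
rewrite -sumrB -big_split /=; apply: eq_bigr => i _.
rewrite -sumrB -big_split /=; apply: eq_bigr => j _.
have E : \sum_(a < D) frameD d.1.1 a (fH d.1.2 i j) y *
    ((1 - p a) * frameD d.1.1 a (fH d.1.2 i j) y + frameD d.1.1 a (rateH p d.1.1 d.1.2 i j) y)
  + oL i j d y * \sum_(a < D) frameD d.1.1 a (frameD d.1.1 a (fH d.1.2 i j)) y =
  \sum_(a < D) oD a (oH i j) d y * ((1 - p a + (p i - p j)) * oD a (oH i j) d y -
     p i * kron i j * oD a (@onu R D) d y) +
  \sum_(a < D) oD a (fun d z => oL i j d z * oD a (oH i j) d z) d y.
  rewrite mulr_sumr -!big_split /=; apply: eq_bigr => a _.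
  have := frameD_rateH a i j ok; rewrite /orateH => ->.
  have [[sH' sL' _ _ _] _] := ok.
  rewrite /oD (frameDM _ _ (sL' i j) (torus_smooth_frameD _ _ (sH' i j))) /oH /oL /onu; ring.
rewrite -E /rateL /rateH -/(kron i j) /oD /oL /oH /onu /opotential /odivH.
move: (\sum_(a < D) _) (\sum_(a < D) _) => S1 S2; ring.
Qed.

End EnergyRate.

(** * Growth of the energy in time *)

Section TimeEnergy.
Variables (R : realType) (D : nat) (p : 'I_D -> R) (pphi : R).
Local Notation V := 'rV[R]_D.
Implicit Types (i j a b : 'I_D) (F : R -> fields R D) (u : R -> V -> R) (t : R).

Definition scale t i : R := t `^ (1 - p i).

(** All coefficients are functions of time alone, so this notion is inherited by
    spatial derivatives. *)
Record frame_solution F : Prop := FrameSolution {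
  fs_H : forall i j, spacetime_smooth (fun t => fH (F t) i j);
  fs_L : forall i j, spacetime_smooth (fun t => fL (F t) i j);
  fs_phi : spacetime_smooth (fun t => fphi (F t));
  fs_psi : spacetime_smooth (fun t => fpsi (F t));
  fs_nu : spacetime_smooth (fun t => fnu (F t));
  fs_constraints : forall t, 0 < t -> frame_constraints p pphi (scale t) (F t);
  fs_evolH : forall t x i j, 0 < t ->
    t * timeD (fun s => fH (F s) i j) t x = rateH p (scale t) (F t) i j x;
  fs_evolL : forall t x i j, 0 < t ->
    t * timeD (fun s => fL (F s) i j) t x = rateL p (scale t) (F t) i j x;
  fs_evolphi : forall t x, 0 < t ->
    t * timeD (fun s => fphi (F s)) t x = rate_phi pphi (F t) x;
  fs_evolpsi : forall t x, 0 < t ->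
    t * timeD (fun s => fpsi (F s)) t x = rate_psi pphi (scale t) (F t) x }.

Lemma frame_solution_smooth F t : frame_solution F -> 0 < t -> fields_smooth (F t).
Proof.
move=> [sH sL sphi spsi snu _ _ _ _ _] t0; split=> [i j|i j|||].
- exact: (spacetime_smooth_slice (sH i j) t0).
- exact: (spacetime_smooth_slice (sL i j) t0).
- exact: (spacetime_smooth_slice sphi t0).
- exact: (spacetime_smooth_slice spsi t0).
- exact: (spacetime_smooth_slice snu t0).
Qed.

Lemma frame_solution_admissible F t (x : V) : frame_solution F -> 0 < t ->
  admissible p pphi (scale t, F t, x).
Proof.
move=> sF t0; split; [exact: frame_solution_smooth|exact: (fs_constraints sF)].
Qed.

Definition fieldsD v (F : fields R D) : fields R D :=
  Fields (fun i j => dirD v (fH F i j)) (fun i j => dirD v (fL F i j))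
    (dirD v (fphi F)) (dirD v (fpsi F)) (dirD v (fnu F)).

Section FieldsD.
Variables (s : 'I_D -> R) (F : fields R D) (v : V).
Hypothesis sF : fields_smooth F.

Let sH i j : torus_smooth (fH F i j).
Proof. by case: sF => sH _ _ _ _; exact: sH. Qed.
Let sL i j : torus_smooth (fL F i j).
Proof. by case: sF => _ sL _ _ _; exact: sL. Qed.
Let sphi : torus_smooth (fphi F). Proof. by case: sF. Qed.
Let spsi : torus_smooth (fpsi F). Proof. by case: sF. Qed.
Let snu : torus_smooth (fnu F). Proof. by case: sF. Qed.
Let sD a f (sf : torus_smooth f) := torus_smooth_frameD s a sf.

Let strH : torus_smooth (trH F).
Proof. exact: (torus_smooth_sum _ (fun a => sH a a)). Qed.

Let sdivH j : torus_smooth (divH s F j).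
Proof. exact: (torus_smooth_sum _ (fun a => sD a (sH a j))). Qed.

Lemma dirD_laplacian f : torus_smooth f ->
  dirD v (fun x => \sum_(a < D) frameD s a (frameD s a f) x) =
  fun x => \sum_(a < D) frameD s a (frameD s a (dirD v f)) x.
Proof.
move=> sf; rewrite (dirD_sum _ _ (fun a => sD a (sD a sf))); apply/funext => x.
by apply: eq_bigr => a _; rewrite (dirD_frameD _ _ _ (sD a sf)) (dirD_frameD _ _ _ sf).
Qed.

Lemma dirD_trH : dirD v (trH F) = trH (fieldsD v F).
Proof. by rewrite /trH (dirD_sum _ _ (fun a => sH a a)). Qed.

Lemma dirD_divH j : dirD v (divH s F j) = divH s (fieldsD v F) j.
Proof.
rewrite /divH (dirD_sum _ _ (fun a => sD a (sH a j))); apply/funext => x.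
by apply: eq_bigr => a _; rewrite (dirD_frameD _ _ _ (sH a j)).
Qed.

Let smom i : torus_smooth (momentum_source p pphi F i).
Proof.
exact: (torus_smoothD (torus_smooth_sum _ (fun a => torus_smoothZ _ (sH a a)))
  (torus_smoothZ _ sphi)).
Qed.

Let sflux a : torus_smooth (lapse_flux s F a).
Proof. exact: (torus_smoothD (torus_smoothZ _ (sD a strH)) (torus_smoothZ _ (sdivH a))). Qed.

Lemma dirD_momentum_source i :
  dirD v (momentum_source p pphi F i) = momentum_source p pphi (fieldsD v F) i.
Proof.
have s1 a := torus_smoothZ (p i - p a) (sH a a).
rewrite /momentum_source (dirDD _ (torus_smooth_sum _ s1) (torus_smoothZ _ sphi)).
rewrite (dirD_sum _ _ s1) (dirDZ _ _ sphi); apply/funext => x; congr (_ + _).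
by apply: eq_bigr => a _; rewrite (dirDZ _ _ (sH a a)).
Qed.

Lemma dirD_lapse_flux a : dirD v (lapse_flux s F a) = lapse_flux s (fieldsD v F) a.
Proof.
rewrite /lapse_flux (dirDD _ (torus_smoothZ _ (sD a strH)) (torus_smoothZ _ (sdivH a))).
rewrite (dirDZ _ _ (sD a strH)) (dirDZ _ _ (sdivH a)) (dirD_frameD _ _ _ strH).
by rewrite dirD_trH dirD_divH.
Qed.

Lemma frame_constraintsD : frame_constraints p pphi s F ->
  frame_constraints p pphi s (fieldsD v F).
Proof.
move=> [symH symL mom lap]; split.
- by move=> i j x; congr (dirD v _ x); apply/funext => y; exact: symH.
- move=> i j x /=.
  have -> : fL F i j = fun y => fL F j i y - 2 * (p i - p j) * fH F i j y.
    by apply/funext => y; exact: symL.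
  by rewrite (dirDB _ (sL j i) (torus_smoothZ _ (sH i j))) (dirDZ _ _ (sH i j)).
- move=> i x; rewrite -dirD_momentum_source /=.
  have s1 j := sD j (sL i j).
  have -> : \sum_(j < D) frameD s j (dirD v (fL F i j)) x =
      dirD v (fun y => \sum_(j < D) frameD s j (fL F i j) y) x.
    rewrite (dirD_sum _ _ s1); apply: eq_bigr => j _.
    by rewrite (dirD_frameD _ _ _ (sL i j)).
  rewrite -(dirD_frameD _ _ _ (smom i)).
  have Ex := congr1 (fun f => f x) (dirDD v (torus_smooth_sum _ s1) (sD i (smom i))).
  rewrite -[LHS]Ex.
  rewrite (_ : (fun x => _ + _) = fun=> 0) ?dirD_cst//.
  by apply/funext => y; exact: mom.
- move=> x /=; have e : (fun y => fnu F y - \sum_(a < D) frameD s a (frameD s a (fnu F)) y) =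
      (fun y => \sum_(a < D) frameD s a (lapse_flux s F a) y).
    by apply/funext => y; exact: lap.
  have := congr1 (fun f => dirD v f x) e.
  rewrite (dirDB _ snu (torus_smooth_sum _ (fun a => sD a (sD a snu)))).
  rewrite (dirD_laplacian snu) (dirD_sum _ _ (fun a => sD a (sflux a))) => ->.
  by apply: eq_bigr => a _; rewrite (dirD_frameD _ _ _ (sflux a)) dirD_lapse_flux.
Qed.

Lemma dirD_rateH i j : dirD v (rateH p s F i j) = rateH p s (fieldsD v F) i j.
Proof.
rewrite /rateH (dirDB _ (torus_smoothD (sL i j) (torus_smoothZ _ (sH i j)))
  (torus_smoothZ _ snu)) (dirDD _ (sL i j) (torus_smoothZ _ (sH i j))).
by rewrite (dirDZ _ _ (sH i j)) (dirDZ _ _ snu).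
Qed.

Let spot i : torus_smooth (potential s F i).
Proof. exact: (torus_smoothB (torus_smoothB (sD i strH) (sdivH i)) (sD i snu)). Qed.

Lemma dirD_potential i : dirD v (potential s F i) = potential s (fieldsD v F) i.
Proof.
rewrite /potential (dirDB _ (torus_smoothB (sD i strH) (sdivH i)) (sD i snu)).
rewrite (dirDB _ (sD i strH) (sdivH i)) dirD_divH (dirD_frameD _ _ _ strH).
by rewrite (dirD_frameD _ _ _ snu) dirD_trH.
Qed.

Lemma dirD_rateL i j : dirD v (rateL p s F i j) = rateL p s (fieldsD v F) i j.
Proof.
have s1 := torus_smoothZ (p j - p i) (sL i j).
have s2 := torus_smooth_sum (index_enum _) (fun a => sD a (sD a (sH i j))).
have s3 := sD j (spot i); have s4 := sD i (sdivH j).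
have s5 := torus_smoothZ (p i * (i == j)%:R) snu.
rewrite /rateL (dirDD _ (torus_smoothB (torus_smoothD (torus_smoothD s1 s2) s3) s4) s5).
rewrite (dirDB _ (torus_smoothD (torus_smoothD s1 s2) s3) s4).
rewrite (dirDD _ (torus_smoothD s1 s2) s3) (dirDD _ s1 s2) (dirDZ _ _ (sL i j)).
rewrite (dirD_laplacian (sH i j)) (dirD_frameD _ _ _ (spot i)) (dirD_frameD _ _ _ (sdivH j)).
by rewrite (dirDZ _ _ snu) dirD_potential dirD_divH.
Qed.

Lemma dirD_rate_phi : dirD v (rate_phi pphi F) = rate_phi pphi (fieldsD v F).
Proof. by rewrite /rate_phi (dirDD _ spsi (torus_smoothZ _ snu)) (dirDZ _ _ snu). Qed.

Lemma dirD_rate_psi : dirD v (rate_psi pphi s F) = rate_psi pphi s (fieldsD v F).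
Proof.
have s2 := torus_smooth_sum (index_enum _) (fun a => sD a (sD a sphi)).
by rewrite /rate_psi (dirDB _ s2 (torus_smoothZ _ snu)) (dirDZ _ _ snu) (dirD_laplacian sphi).
Qed.

End FieldsD.

Lemma timeD_dirD u (w : V -> R) v t x : spacetime_smooth u -> 0 < t ->
  (forall y, t * timeD u t y = w y) -> t * timeD (spaceD v u) t x = dirD v w x.
Proof.
move=> su t0 E; rewrite (timeD_spaceD _ _ su t0).
have -> : w = fun y => t * timeD u t y by apply/funext => y.
by rewrite (dirDZ _ _ (spacetime_smooth_slice (spacetime_smooth_timeD su) t0)).
Qed.

(** With this lemma the energy estimate, which concerns undifferentiated fields,
    applies to derivatives of every order with the same exponent. *)
Lemma frame_solutionD v F : frame_solution F -> frame_solution (fun t => fieldsD v (F t)).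
Proof.
move=> sF; have [sH sL sphi spsi snu con eH eL ephi epsi] := sF.
split.
- by move=> i j; exact: (spacetime_smooth_spaceD v (sH i j)).
- by move=> i j; exact: (spacetime_smooth_spaceD v (sL i j)).
- exact: (spacetime_smooth_spaceD v sphi).
- exact: (spacetime_smooth_spaceD v spsi).
- exact: (spacetime_smooth_spaceD v snu).
- move=> t t0; apply: frame_constraintsD; [exact: frame_solution_smooth|exact: con].
- move=> t x i j t0; rewrite -(dirD_rateH _ _ (frame_solution_smooth sF t0)).
  by apply: (timeD_dirD _ _ (sH i j) t0) => y; exact: eH.
- move=> t x i j t0; rewrite -(dirD_rateL _ _ (frame_solution_smooth sF t0)).
  by apply: (timeD_dirD _ _ (sL i j) t0) => y; exact: eL.
- move=> t x t0; rewrite -(dirD_rate_phi _ (frame_solution_smooth sF t0)).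
  by apply: (timeD_dirD _ _ sphi t0) => y; exact: ephi.
- move=> t x t0; rewrite -(dirD_rate_psi _ _ (frame_solution_smooth sF t0)).
  by apply: (timeD_dirD _ _ spsi t0) => y; exact: epsi.
Qed.

Lemma powR_pred (c t : R) : 0 < t -> t * t `^ (c - 1) = t `^ c.
Proof.
move=> t0; rewrite -[X in X * _](powRr1 (ltW t0)) -powRD; last first.
  by rewrite (gt_eqF t0) implybT.
by rewrite addrC subrK.
Qed.

Definition frameD_time a u : R -> V -> R := fun t => frameD (scale t) a (u t).

Lemma spacetime_smooth_frameD a u : spacetime_smooth u -> spacetime_smooth (frameD_time a u).
Proof.
move=> su; exact: (spacetime_smoothM (spacetime_smooth_powR _ (1 - p a))
  (spacetime_smooth_spaceD (delta_mx 0 a) su)).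
Qed.

Lemma timeD_frameD a u (w : V -> R) t x : spacetime_smooth u -> 0 < t ->
  (forall y, t * timeD u t y = w y) ->
  t * timeD (frameD_time a u) t x =
    (1 - p a) * frameD (scale t) a (u t) x + frameD (scale t) a w x.
Proof.
move=> su t0 E.
have := timeDM x (spacetime_smooth_powR D (1 - p a))
  (spacetime_smooth_spaceD (delta_mx 0 a) su) t0.
rewrite (timeD_powR _ x t0) => ->.
rewrite /frameD /scale -(timeD_dirD (delta_mx 0 a) x su t0 E) -(powR_pred (1 - p a) t0).
rewrite {2}/spaceD; ring.
Qed.

Lemma timeD_sqr u c t x : spacetime_smooth u -> 0 < t -> t * timeD u t x = c ->
  t * timeD (fun t x => u t x ^+ 2) t x = 2 * (u t x * c).
Proof.
move=> su t0 E; have := timeDM x su su t0 => /= ->.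
by rewrite -E; ring.
Qed.

Lemma timeD_energy_density F t x : frame_solution F -> 0 < t ->
  spacetime_smooth (fun t => energy_density (scale t) (F t)) /\
  t * timeD (fun t => energy_density (scale t) (F t)) t x =
  2 * energy_rate p pphi (scale t) (F t) x.
Proof.
move=> sF t0; have [sH sL sphi spsi snu con eH eL ephi epsi] := sF.
have sq u (su : spacetime_smooth u) := spacetime_smoothM su su.
have sDH a i j := spacetime_smooth_frameD a (sH i j).
have sDphi a := spacetime_smooth_frameD a sphi.
have s1 i j := spacetime_smoothD (spacetime_smoothD (sq _ (sH i j)) (sq _ (sL i j)))
  (spacetime_smooth_sum (index_enum _) (fun a => sq _ (sDH a i j))).
have s2 := spacetime_smoothD (spacetime_smoothD (sq _ sphi) (sq _ spsi))
  (spacetime_smooth_sum (index_enum _) (fun a => sq _ (sDphi a))).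
have s3 := spacetime_smooth_sum (index_enum _) (fun i =>
  spacetime_smooth_sum (index_enum _) (s1 i)).
split; first exact: (spacetime_smoothD s3 s2).
rewrite (timeDD x s3 s2 t0) mulrDr /energy_rate [RHS]mulrDr; congr (_ + _); last first.
  rewrite (timeDD x (spacetime_smoothD (sq _ sphi) (sq _ spsi))
    (spacetime_smooth_sum (index_enum _) (fun a => sq _ (sDphi a))) t0).
  rewrite (timeDD x (sq _ sphi) (sq _ spsi) t0).
  rewrite (timeD_sum _ x (fun a => sq _ (sDphi a)) t0) [LHS]mulrDr [X in X + _ = _]mulrDr.
  rewrite [RHS]mulrDr [X in _ = X + _]mulrDr mulr_sumr.
  rewrite (timeD_sqr sphi t0 (ephi t x t0)) (timeD_sqr spsi t0 (epsi t x t0)).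
  rewrite [X in _ = _ + X]mulr_sumr; congr (_ + _); apply: eq_bigr => a _.
  exact: (timeD_sqr (sDphi a) t0 (timeD_frameD a x sphi t0 (fun y => ephi t y t0))).
rewrite (timeD_sum _ x (fun i => spacetime_smooth_sum (index_enum _) (s1 i)) t0).
rewrite mulr_sumr [RHS]mulr_sumr; apply: eq_bigr => i _.
rewrite (timeD_sum _ x (s1 i) t0) mulr_sumr [RHS]mulr_sumr; apply: eq_bigr => j _.
rewrite (timeDD x (spacetime_smoothD (sq _ (sH i j)) (sq _ (sL i j)))
    (spacetime_smooth_sum (index_enum _) (fun a => sq _ (sDH a i j))) t0).
rewrite (timeDD x (sq _ (sH i j)) (sq _ (sL i j)) t0).
rewrite (timeD_sum _ x (fun a => sq _ (sDH a i j)) t0) [LHS]mulrDr [X in X + _ = _]mulrDr.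
  rewrite [RHS]mulrDr [X in _ = X + _]mulrDr mulr_sumr.
rewrite (timeD_sqr (sH i j) t0 (eH t x i j t0)) (timeD_sqr (sL i j) t0 (eL t x i j t0)).
rewrite [X in _ = _ + X]mulr_sumr; congr (_ + _); apply: eq_bigr => a _.
exact: (timeD_sqr (sDH a i j) t0
  (timeD_frameD a x (sH i j) t0 (fun y => eH t y i j t0))).
Qed.

(** Monotonicity of t^N E(t). The exponent N is chosen before the solution, as
    the improvement of the decay rate below needs bounds on all
    derivatives with a common power. *)
Lemma energy_growth : exists2 N : R, 0 <= N & forall F, frame_solution F ->
  forall x t, 0 < t <= 1 ->
  mean x (energy_density (scale t) (F t)) <=
    t `^ (- N) * mean x (energy_density (scale 1) (F 1)).
Proof.
have [_ [C C0 CP]] := energy_rate_mean_controlled p pphi.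
exists (2 * C); first by rewrite mulr_ge0.
move=> F sF x t /andP[t0 t1].
pose G := fun t => energy_density (scale t) (F t).
have sG : spacetime_smooth G by have [] := timeD_energy_density x sF ltr01.
pose E t := mean x (G t).
have dE (s : R) : 0 < s -> is_derive s (1 : R) E (mean x (timeD G s)).
  exact: mean_is_derive.
have bE (s : R) : 0 < s -> - (2 * C) * E s <= s * mean x (timeD G s).
  move=> s0; have ok := frame_solution_admissible x sF s0.
  have st := spacetime_smooth_slice (spacetime_smooth_timeD sG) s0.
  have sr : torus_smooth (energy_rate p pphi (scale s) (F s)).
    by have [sr _] := energy_rate_mean_controlled p pphi; exact: (sr _ ok).
  rewrite -(meanZ _ _ st) (_ : (fun y => _) = fun y =>
      2 * energy_rate p pphi (scale s) (F s) y); last first.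
    by apply/funext => y; have [] := timeD_energy_density y sF s0.
  rewrite (meanZ _ _ sr); have := CP _ ok; rewrite ler_norml => /andP[+ _].
  by rewrite /energy /= -/(G s) -/(E s); nra.
(* t E' >= - 2 C E, so this weight makes the energy nondecreasing *)
pose W (s : R) := s `^ (2 * C) * E s.
have dW (s : R) : 0 < s -> is_derive s (1 : R) W
    (s `^ (2 * C) * mean x (timeD G s) + E s * (2 * C * s `^ (2 * C - 1))).
  move=> s0; have d1 := is_derive1_powR (2 * C) s0; have d2 := dE s s0.
  exact: (is_deriveM d1 d2).
have W1 : W t <= W 1.
  have := @ger0_derive1_le_cc R W t 1; apply; rewrite ?in_itv/= ?lexx ?t1//.
  - by move=> s; rewrite in_itv/= => /andP[ts _]; have [] := dW s (lt_trans t0 ts).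
  - move=> s; rewrite in_itv/= => /andP[ts _]; have s0 := lt_trans t0 ts.
    rewrite derive1E; have [_ ->] := dW s s0.
    rewrite -(powR_pred (2 * C) s0); have := bE s s0.
    have := powR_ge0 s (2 * C - 1); move: (s `^ _) (mean _ _) (E s) => P M Es; nra.
  - apply: derivable_within_continuous => s; rewrite in_itv/= => /andP[ts _].
    by have [] := dW s (lt_le_trans t0 ts).
rewrite /W powR1 mul1r in W1.
rewrite -/(G t) -/(G 1) -/(E t) -/(E 1).
by rewrite powRN mulrC ler_pdivlMr ?powR_gt0// mulrC.
Qed.

End TimeEnergy.

(** * Fields bounded by powers of t with all their derivatives *)

Section PowerBounds.
Variables (R : realType).
Implicit Types (a b e g r s t l C K : R).

Lemma powR_small (b e : R) : 0 < b -> 0 < e -> \forall t \near (0 : R)^'+, t `^ b < e.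
Proof.
move=> b0 e0; near=> t.
have t0 : 0 < t by near: t; exact: nbhs_right_gt.
have -> : e = (e `^ b^-1) `^ b by rewrite -powRrM mulVf ?gt_eqF// powRr1 ?ltW.
apply: gt0_ltr_powR => //; rewrite ?nnegrE ?powR_ge0 ?ltW//.
by near: t; apply: nbhs_right_lt; rewrite powR_gt0.
Unshelve. all: by end_near. Qed.

Lemma powR_small_ex (K b e : R) : 0 < b -> 0 < e ->
  exists2 t, 0 < t <= 1 & K * t `^ b < e.
Proof.
move=> b0 e0; have K1 : 0 < `|K| + 1 by rewrite ltr_wpDl.
have nt : \forall t \near (0 : R)^'+, (0 < t <= 1) /\ K * t `^ b < e.
  near=> t; split.
    by apply/andP; split; near: t; [exact: nbhs_right_gt|exact: nbhs_right_le].
  apply: (@le_lt_trans _ _ ((`|K| + 1) * t `^ b)).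
    by rewrite ler_wpM2r ?powR_ge0// (le_trans (ler_norm K))// lerDl.
  rewrite mulrC -ltr_pdivlMr//; near: t; apply: powR_small => //.
  by rewrite divr_gt0.
by have [t []] := filter_ex nt; exists t.
Unshelve. all: by end_near. Qed.

Lemma powR_bound_eq0 (a K b : R) : 0 < b ->
  (forall t, 0 < t <= 1 -> `|a| <= K * t `^ b) -> a = 0.
Proof.
move=> b0 H; apply/eqP; rewrite -normr_le0; apply/ler_addgt0Pr => e e0.
have [t t1 te] := powR_small_ex K b0 e0.
by rewrite add0r; apply: (le_trans (H t t1)); exact: ltW.
Qed.

Lemma powR_le_exp (t a b : R) : 0 < t <= 1 -> a <= b -> t `^ b <= t `^ a.
Proof. by move=> /andP[t0 t1] ab; apply: ger_powR => //; rewrite t0. Qed.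

(** Comparison of w with a primitive of the bound on its derivative; it serves
    both g < 0 (growth) and g > 0 (convergence as t tends to 0). *)
Lemma increment_powR (w w' : R -> R) (C g : R) : g != 0 ->
  (forall t, 0 < t <= 1 -> is_derive t 1 w (w' t)) ->
  (forall t, 0 < t <= 1 -> `|w' t| <= C * t `^ (g - 1)) ->
  forall s t, 0 < s -> s <= t -> t <= 1 ->
  `|w t - w s| <= C / g * (t `^ g - s `^ g).
Proof.
move=> g0 dw bw s t s0 st t1.
have mono (k : R) : `|k| = 1 -> C / g * s `^ g - k * w s <= C / g * t `^ g - k * w t.
  move=> k1; pose h (r : R) := C / g * r `^ g - k * w r.
  have dh (r : R) : 0 < r <= 1 -> is_derive r (1 : R) h (C * r `^ (g - 1) - k * w' r).
    move=> /[dup] rr /andP[r0 r1]; have d1 := is_derive1_powR g r0; have d2 := dw r rr.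
    have -> : C * r `^ (g - 1) = C / g * (g * r `^ (g - 1)).
      by rewrite mulrA divfK.
    exact: (is_deriveB (is_deriveZ (C / g) d1) (is_deriveZ k d2)).
  have A1 (r : R) : r \in `]s, t[ -> derivable h r 1.
    rewrite in_itv/= => /andP[sr rt].
    by have [] := dh r; [rewrite (lt_trans s0 sr) (le_trans (ltW rt) t1)|].
  have A2 (r : R) : r \in `]s, t[ -> 0 <= h^`()%classic r.
    rewrite in_itv/= => /andP[sr rt].
    have rr : 0 < r <= 1 by rewrite (lt_trans s0 sr) (le_trans (ltW rt) t1).
    rewrite derive1E; have [_ ->] := dh r rr; rewrite subr_ge0.
    apply: le_trans (bw r rr); apply: (le_trans (ler_norm _)).
    by rewrite normrM k1 mul1r.
  have A3 : {within `[s, t], continuous h}.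
    apply: derivable_within_continuous => r; rewrite in_itv/= => /andP[sr rt].
    by have [] := dh r; [rewrite (lt_le_trans s0 sr) (le_trans rt t1)|].
  have ss : s \in `[s, t] by rewrite in_itv/= lexx st.
  have tt : t \in `[s, t] by rewrite in_itv/= lexx st.
  exact: (ger0_derive1_le_cc A1 A2 A3 ss tt st).
have := mono 1 (normr1 _); have := mono (-1); rewrite normrN1 => /(_ erefl).
by rewrite ler_norml mulrBr; lra.
Qed.

Lemma powR_cauchy_limit (w : R -> R) (K b : R) : 0 < b ->
  (forall s t, 0 < s -> s <= t -> t <= 1 -> `|w t - w s| <= K * t `^ b) ->
  exists l, forall t, 0 < t <= 1 -> `|w t - l| <= K * t `^ b.
Proof.
move=> b0 H.
have cw : cvg (w @ (0 : R)^'+).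
  apply/cauchy_cvgP; apply/cauchy_exP => e e0.
  have [t /andP[t0 t1] te] := powR_small_ex K b0 e0.
  have nn : \forall s \near (0 : R)^'+, 0 < s /\ s <= t.
    by near=> s; split; near: s; [exact: nbhs_right_gt|exact: nbhs_right_le].
  exists (w t); change (\forall s \near (0 : R)^'+, ball (w t) e (w s)).
  apply: filterS nn => s [s0 st].
  by rewrite /ball/=; apply: (le_lt_trans _ te); apply: (H s t).
exists (lim (w @ (0 : R)^'+)) => t /andP[t0 t1].
apply/ler_addgt0Pr => e e0.
have /cvgrPdist_le /(_ _ e0) nw := cw.
have [s [h1 [s0 st]]] : exists s, `|lim (w @ (0 : R)^'+) - w s| <= e /\ (0 < s /\ s <= t).
  apply: (@filter_ex _ ((0 : R)^'+)); apply: filterI; first exact: nw.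
  by apply: filterI; [exact: nbhs_right_gt|exact: nbhs_right_le].
rewrite -(subrKA (w s)) (le_trans (ler_normD _ _))// lerD//; first exact: H.
by rewrite distrC.
Unshelve. all: by end_near. Qed.

End PowerBounds.

Section Tame.
Variables (R : realType) (D : nat).
Local Notation V := 'rV[R]_D.
Implicit Types (u w : R -> V -> R) (f : V -> R) (v x : V) (vs : seq V) (s t r b c : R).

(** The same power of t bounds the spatial derivatives of every order. The class
    is therefore stable under them, which makes losses of derivatives free. *)
Definition tame b u := spacetime_smooth u /\ forall vs, exists2 C : R, 0 <= C &
  forall t x, 0 < t <= 1 -> `|iterD vs (u t) x| <= C * t `^ b.

Lemma iterDD vs f (g : V -> R) : torus_smooth f -> torus_smooth g ->
  iterD vs (fun x => f x + g x) = fun x => iterD vs f x + iterD vs g x.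
Proof.
move=> sf sg; elim: vs => [|v vs IH] //=; rewrite IH.
by rewrite (dirDD _ (torus_smooth_iterD vs sf) (torus_smooth_iterD vs sg)).
Qed.

Lemma iterDZ vs c f : torus_smooth f ->
  iterD vs (fun x => c * f x) = fun x => c * iterD vs f x.
Proof.
move=> sf; elim: vs => [|v vs IH] //=; rewrite IH.
by rewrite (dirDZ _ _ (torus_smooth_iterD vs sf)).
Qed.

Lemma tame_eq b u w : (forall t x, 0 < t -> u t x = w t x) -> tame b u -> tame b w.
Proof.
move=> uw [su bu]; split; first exact: (spacetime_smooth_eq uw su).
move=> vs; have [C C0 H] := bu vs; exists C => // t x /[dup] tt /andP[t0 _].
rewrite (_ : w t = u t); first exact: H.
by apply/funext => y; rewrite uw.
Qed.

Lemma tame_le b b' u : b' <= b -> tame b u -> tame b' u.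
Proof.
move=> bb [su bu]; split=> // vs; have [C C0 H] := bu vs; exists C => // t x tt.
by apply: (le_trans (H t x tt)); rewrite ler_wpM2l// powR_le_exp.
Qed.

Lemma tameD b u w : tame b u -> tame b w -> tame b (fun t x => u t x + w t x).
Proof.
move=> [su bu] [sw bw]; split; first exact: (spacetime_smoothD su sw).
move=> vs; have [A A0 uA] := bu vs; have [B B0 wB] := bw vs.
exists (A + B); first exact: addr_ge0.
move=> t x /[dup] tt /andP[t0 _].
rewrite (iterDD _ (spacetime_smooth_slice su t0) (spacetime_smooth_slice sw t0)).
by rewrite (le_trans (ler_normD _ _))// mulrDl lerD//; [exact: uA|exact: wB].
Qed.

Lemma tameZ b c u : tame b u -> tame b (fun t x => c * u t x).
Proof.
move=> [su bu]; split; first exact: (spacetime_smoothZ c su).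
move=> vs; have [A A0 uA] := bu vs.
exists (`|c| * A); first exact: mulr_ge0.
move=> t x /[dup] tt /andP[t0 _].
rewrite (iterDZ _ _ (spacetime_smooth_slice su t0)).
by rewrite normrM -mulrA ler_wpM2l//; exact: uA.
Qed.

Lemma tame_powR b c u : tame b u -> tame (c + b) (fun t x => t `^ c * u t x).
Proof.
move=> [su bu]; split; first exact: (spacetime_smoothM (spacetime_smooth_powR _ c) su).
move=> vs; have [A A0 uA] := bu vs.
exists A => // t x /[dup] tt /andP[t0 _].
rewrite (iterDZ _ _ (spacetime_smooth_slice su t0)) powRD; last first.
  by rewrite (gt_eqF t0) implybT.
by rewrite normrM ger0_norm ?powR_ge0// mulrCA ler_wpM2l ?powR_ge0//; exact: uA.
Qed.

Lemma tame_powR_le b c b' u : tame b u -> b' <= c + b ->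
  tame b' (fun t x => t `^ c * u t x).
Proof. by move=> tu bb; apply: (tame_le bb); exact: tame_powR. Qed.

Lemma tameB b u w : tame b u -> tame b w -> tame b (fun t x => u t x - w t x).
Proof.
move=> tu tw; apply: (tame_eq _ (tameD tu (tameZ (-1) tw))) => t x _.
by rewrite mulN1r.
Qed.

Lemma tame0 b : tame b (fun (_ : R) (_ : V) => 0).
Proof.
split; first exact: spacetime_smooth_cst.
move=> vs; exists 0 => // t x _; rewrite mul0r (_ : iterD _ _ = fun=> 0) ?normr0//.
by elim: vs => //= v vs ->; rewrite dirD_cst.
Qed.

Lemma tame_sum b (I : Type) (r : seq I) (F : I -> R -> V -> R) :
  (forall i, tame b (F i)) -> tame b (fun t x => \sum_(i <- r) F i t x).
Proof.
move=> tF; elim: r => [|i r IH].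
  by apply: (tame_eq _ (tame0 b)) => t x _; rewrite big_nil.
by apply: (tame_eq _ (tameD (tF i) IH)) => t x _; rewrite big_cons.
Qed.

Lemma tame_spaceD b v u : tame b u -> tame b (spaceD v u).
Proof.
move=> [su bu]; split; first exact: (spacetime_smooth_spaceD v su).
move=> vs; have [A A0 uA] := bu (rcons vs v); exists A => // t x tt.
by have := uA t x tt; rewrite /iterD foldr_rcons.
Qed.

Lemma iterD_cat vs ws f : iterD (vs ++ ws) f = iterD vs (iterD ws f).
Proof. by rewrite /iterD foldr_cat. Qed.

Definition spaceDs vs u : R -> V -> R := fun t => iterD vs (u t).

Lemma spacetime_smooth_spaceDs vs u : spacetime_smooth u -> spacetime_smooth (spaceDs vs u).
Proof.
by move=> su; elim: vs => [|v vs IH]; [exact: su|exact: (spacetime_smooth_spaceD v IH)].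
Qed.

Lemma timeD_spaceDs vs u (w : V -> R) t x : spacetime_smooth u -> 0 < t ->
  (forall y, t * timeD u t y = w y) -> t * timeD (spaceDs vs u) t x = iterD vs w x.
Proof.
move=> su t0 E; elim: vs x => [|v vs IH] x; first exact: E.
exact: (timeD_dirD v x (spacetime_smooth_spaceDs vs su) t0 IH).
Qed.

(** The solution of t u' = c u + g is the homogeneous solution t^c, which is
    smaller than t^b, plus an integral of the size of g. *)
Lemma tame_ode b c u g : spacetime_smooth u -> tame b g -> b < c ->
  (forall t x, 0 < t -> t * timeD u t x = c * u t x + g t x) -> tame b u.
Proof.
move=> su [sg bg] bc E; split=> // vs.
have [C C0 gC] := bg vs.
have su' := spacetime_smooth_spaceDs vs su.
have [B uB] := torus_smooth_bounded (spacetime_smooth_slice su' ltr01).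
have B0 : 0 <= B by apply: le_trans (uB 0).
have E' t x : 0 < t ->
    t * timeD (spaceDs vs u) t x = c * spaceDs vs u t x + iterD vs (g t) x.
  move=> t0; rewrite (timeD_spaceDs vs x su t0 (fun y => E t y t0)).
  rewrite (iterDD _ (torus_smoothZ _ (spacetime_smooth_slice su t0))
    (spacetime_smooth_slice sg t0)).
  by rewrite (iterDZ _ _ (spacetime_smooth_slice su t0)).
have cb : 0 < c - b by rewrite subr_gt0.
exists (B + C / (c - b)); first by rewrite addr_ge0// divr_ge0// ltW.
move=> t x /andP[t0 t1].
(* t^(-c) removes the homogeneous part of the equation *)
pose w s := s `^ (- c) * spaceDs vs u s x.
pose w' s := s `^ (- c - 1) * iterD vs (g s) x.
have dw (s : R) : 0 < s <= 1 -> is_derive s 1 w (w' s).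
  move=> /andP[s0 _].
  have d1 := is_derive1_powR (- c) s0; have d2 := spacetime_smooth_is_derive x su' s0.
  have := is_deriveM d1 d2.
  rewrite (_ : _ + _ = w' s)//.
  rewrite /w' -(addrK (c * spaceDs vs u s x) (iterD vs (g s) x)) [_ + c * _]addrC -E'//.
  rewrite -[s `^ (- c)](powR_pred _ s0) /GRing.scale /=; ring.
have bw (s : R) : 0 < s <= 1 -> `|w' s| <= C * s `^ ((b - c) - 1).
  move=> /[dup] ss /andP[s0 _]; rewrite /w' normrM ger0_norm ?powR_ge0//.
  have -> : s `^ (b - c - 1) = s `^ (- c - 1) * s `^ b.
    by rewrite -powRD ?(gt_eqF s0) ?implybT//; congr (_ `^ _); ring.
  by rewrite mulrCA ler_wpM2l ?powR_ge0//; exact: gC.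
have bc0 : b - c != 0 by rewrite lt_eqF// subr_lt0.
have := increment_powR bc0 dw bw t0 t1 (lexx 1).
rewrite /w powR1 mul1r => inc.
have -> : iterD vs (u t) x = t `^ c * (t `^ (- c) * spaceDs vs u t x).
  by rewrite mulrA -powRD ?(gt_eqF t0) ?implybT// subrr powRr0 mul1r.
rewrite normrM ger0_norm ?powR_ge0//.
have tb : t `^ b = t `^ c * t `^ (b - c).
  by rewrite -powRD ?(gt_eqF t0) ?implybT// addrC subrK.
have h1 : `|t `^ (- c) * spaceDs vs u t x| <= B + C / (c - b) * t `^ (b - c).
  rewrite -[X in `|X|](subrK (spaceDs vs u 1 x)) (le_trans (ler_normD _ _))//.
  rewrite addrC lerD//; rewrite distrC; apply: (le_trans inc).
  have -> : C / (b - c) = - (C / (c - b)) by rewrite -[b - c]opprB invrN mulrN.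
  have := divr_ge0 C0 (ltW cb); lra.
apply: (le_trans (ler_wpM2l (powR_ge0 _ _) h1)).
rewrite mulrDr mulrDl; apply: lerD.
  by rewrite mulrC ler_wpM2l// powR_le_exp ?t0// ltW.
by rewrite tb mulrCA.
Qed.

Definition power_limit u (l : V -> R) := exists C b : R, [/\ 0 <= C, 0 < b &
  forall t x, 0 < t <= 1 -> `|u t x - l x| <= C * t `^ b].

Lemma power_limit_continuous u l : spacetime_smooth u -> power_limit u l -> continuous l.
Proof.
move=> su [C [b [C0 b0 ul]]].
suff H (x : V) : l @ x --> l x by move=> x; exact: H.
apply/(cvgrPdist_le (FF := nbhs_filter x)) => e e0; have e3 : 0 < e / 3 by rewrite divr_gt0.
have [t /[dup] tt /andP[t0 _] te] := powR_small_ex C b0 e3.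
have cu := torus_smooth_continuous (spacetime_smooth_slice su t0).
have n : \forall y \near x, `|u t x - u t y| <= e / 3.
  have cux : u t @ x --> u t x := cu x.
  by move/(cvgrPdist_le (FF := nbhs_filter x)) : cux => /(_ _ e3).
apply: filterS n => y h.
have h1 := le_trans (ul t x tt) (ltW te); have h2 := le_trans (ul t y tt) (ltW te).
move: h h1 h2; rewrite !ler_norml => /andP[? ?] /andP[? ?] /andP[? ?].
by apply/andP; split; lra.
Qed.

Lemma MVT_direction f x v (h : R) : torus_smooth f -> exists2 s, `|s| <= `|h| &
  f (h *: v + x) - f x = h * dirD v f (s *: v + x).
Proof.
move=> sf; have df z : derivable f z v by have [] := torus_smooth_is_derive v z sf.
have [h0|h0|<-] := ltgtP 0 h.
- have [s _|s /andP[s0 sh] E] := @MVT_line _ _ f x v h h0; first exact: df.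
  by exists s => //; rewrite !ger0_norm// ltW.
- have nh0 : 0 < - h by rewrite oppr_gt0.
  have [s _|s /andP[s0 sh] E] := @MVT_line _ _ f (h *: v + x) v (- h) nh0.
    exact: df.
  exists (s + h).
    by rewrite (ltr0_norm h0) ler_norml; apply/andP; split; lra.
  move: E; rewrite addrA -scalerDl addNr scale0r add0r addrA -scalerDl => E.
  by rewrite -opprB E mulNr opprK.
- by exists 0; rewrite ?normr0// !scale0r add0r subrr mul0r.
Qed.

(** Uniform convergence of u and of its derivative, at a rate in t: the mean value
    theorem at time t, then t tends to 0. *)
Lemma power_limit_derive u v l l' x : spacetime_smooth u -> power_limit u l ->
  power_limit (spaceD v u) l' -> is_derive x v l (l' x).
Proof.
move=> su [C [b [C0 b0 ul]]] pl'.
have cl' := power_limit_continuous (spacetime_smooth_spaceD v su) pl'.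
have [C' [b' [C'0 b'0 ul']]] := pl'.
suff H : (fun h : R => h^-1 *: ((l \o shift x) (h *: v) - l x)) @ 0^' --> l' x.
  by split; [apply/cvg_ex; exists (l' x)|exact/cvg_lim].
apply/cvgrPdist_le => e e0; have e2 : 0 < e / 2 by rewrite divr_gt0.
have cs : (fun s : R => l' (s *: v + x)) @ 0 --> l' x.
  have e0x : (fun s : R => s *: v + x) 0 = x by rewrite scale0r add0r.
  have c1 : (fun s : R => s *: v + x) @ 0 --> x.
    rewrite -[X in _ --> X]e0x; apply: cvgD; last exact: cvg_cst.
    by apply: cvgZr_tmp; exact: cvg_id.
  by have := cvg_comp _ _ c1 (cl' x); exact.
have /nbhs_ballP[d /= d0 dP] : \forall s \near (0 : R), `|l' x - l' (s *: v + x)| <= e / 2.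
  by move/cvgrPdist_le : cs => /(_ _ e2).
apply/nbhs_ballP; exists d => //= h; rewrite /ball/= sub0r normrN => hd h0.
have Eh (z : R^o) : h * (h^-1 *: z) = z by exact: mulVKf.
rewrite -(ler_pM2l (_ : 0 < `|h|)) ?normr_gt0// -normrM mulrBr Eh.
apply/ler_addgt0Pr => e' e'0.
pose m := Num.min b b'.
have m0 : 0 < m by rewrite lt_min b0.
have [t /[dup] tt /andP[t0 _] te] := powR_small_ex (2 * C + `|h| * C') m0 e'0.
have [s sh E] := MVT_direction x v h (spacetime_smooth_slice su t0).
have b1 : t `^ b <= t `^ m by apply: powR_le_exp => //; rewrite ge_min lexx.
have b2 : t `^ b' <= t `^ m by apply: powR_le_exp => //; rewrite ge_min lexx orbT.
have h1 := ul t (h *: v + x) tt; have h2 := ul t x tt.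
have h3 : `|h * (dirD v (u t) (s *: v + x) - l' (s *: v + x))| <= `|h| * (C' * t `^ b').
  by rewrite normrM ler_wpM2l//; exact: ul'.
have h4 : `|h * (l' x - l' (s *: v + x))| <= `|h| * (e / 2).
  by rewrite normrM ler_wpM2l//; apply: dP; rewrite /ball/= sub0r normrN (le_lt_trans sh).
have C1 := ler_wpM2l C0 b1.
have C2 := ler_wpM2l (mulr_ge0 (normr_ge0 h) C'0) b2.
have he2 : `|h| * e = `|h| * (e / 2) + `|h| * (e / 2).
  by rewrite -mulrDr -splitr.
have he0 : 0 <= `|h| * (e / 2) by rewrite mulr_ge0// ltW.
rewrite /= he2; move: h1 h2 h3 h4 E C1 C2 te.
rewrite !mulrBr mulrDl -!mulrA.
move: (t `^ m) (t `^ b) (t `^ b') (l _) (l _) (u t _) (u t _) (h * dirD _ _ _) (h * l' _) (h * l' _)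
  => T1 T2 T3 lh lx uh ux d1 d2 d3.
rewrite !ler_norml => /andP[? ?] /andP[? ?] /andP[? ?] /andP[? ?] ? ? ? ?.
by apply/andP; split; lra.
Qed.

(** An integrable right-hand side makes u converge, and its derivatives solve
    equations of the same form; this is the stability under differentiation
    that smoothness of the limit requires. *)
Lemma tame_limit b u g : 0 < b -> spacetime_smooth u -> tame b g ->
  (forall t x, 0 < t -> t * timeD u t x = g t x) ->
  exists2 l : V -> R, torus_smooth l & power_limit u l.
Proof.
move=> b0 su tg E.
have exl w h : spacetime_smooth w -> tame b h ->
    (forall t x, 0 < t -> t * timeD w t x = h t x) -> exists l, power_limit w l.
  move=> sw [sh /(_ [::])[C C0 hC]] wh.
  have key x : exists l, forall t, 0 < t <= 1 -> `|w t x - l| <= C / b * t `^ b.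
    apply: (powR_cauchy_limit b0) => s t s0 st t1.
    have b0' : b != 0 by rewrite gt_eqF.
    have dw (r : R) : 0 < r <= 1 -> is_derive r 1 (w^~ x) (timeD w r x).
      by move=> /andP[r0 _]; exact: spacetime_smooth_is_derive.
    have bw (r : R) : 0 < r <= 1 -> `|timeD w r x| <= C * r `^ (b - 1).
      move=> /[dup] rr /andP[r0 _]; rewrite -(ler_pM2l r0) -[X in X * `|_|](gtr0_norm r0).
      by rewrite -normrM wh// mulrCA powR_pred//; exact: hC.
    apply: (le_trans (increment_powR b0' dw bw s0 st t1)).
    by rewrite ler_wpM2l ?divr_ge0 ?(ltW b0)// gerBl powR_ge0.
  have [l lP] := choice key.
  by exists l, (C / b), b; split=> //; [rewrite divr_ge0// ltW|move=> t x; exact: lP].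
have [l ul] := exl u g su tg E; exists l => //.
split.
  move=> i x; apply/eqP; rewrite -subr_eq0; apply/eqP.
  have [C [b' [C0 b'0 H]]] := ul.
  apply: (@powR_bound_eq0 _ _ (2 * C) b') => // t /[dup] tt /andP[t0 _].
  have h1 := H t x tt; have h2 := H t (x + (2 * pi) *: delta_mx 0 i) tt.
  have [pu _] := spacetime_smooth_slice su t0; rewrite pu in h2.
  move: h1 h2; move: (l _) (l _) (u t x) (t `^ b') => l1 l2 u1 T.
  rewrite !ler_norml => /andP[? ?] /andP[? ?]; apply/andP; split; lra.
apply: (@smooth_on_coind _ _ _ (@openT _) (fun l => exists w h,
  [/\ spacetime_smooth w, tame b h,
      forall t x, 0 < t -> t * timeD w t x = h t x & power_limit w l])); last first.
  by exists u, g.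
move=> {u g su tg E l ul} l [w [h [sw th E wl]]].
have dl v : exists2 l', (exists w' h', [/\ spacetime_smooth w', tame b h',
      forall t x, 0 < t -> t * timeD w' t x = h' t x & power_limit w' l']) &
      forall x, is_derive x v l (l' x).
  have sw' := spacetime_smooth_spaceD v sw; have th' := tame_spaceD v th.
  have E' t x : 0 < t -> t * timeD (spaceD v w) t x = spaceD v h t x.
    by move=> t0; apply: (timeD_dirD v x sw t0) => y; exact: E.
  have [l' wl'] := exl _ _ sw' th' E'.
  exists l'; first by exists (spaceD v w), (spaceD v h).
  by move=> x; exact: power_limit_derive sw wl wl'.
split=> [x _|v].
  split; first exact: power_limit_continuous wl x.
  by move=> v; have [l' _ /(_ x)[]] := dl v.
by have [l' Pl' dl'] := dl v; exists l' => // x _; have [] := dl' x.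
Qed.

End Tame.

Section MeanToSup.
Variables (R : realType) (D : nat).
Local Notation V := 'rV[R]_D.
Implicit Types (u f : R -> V -> R) (v x : V) (vs : seq V) (s t r b c : R).

(** The Sobolev inequality costs a fixed number of derivatives, and the hypothesis
    covers them all. *)
Lemma tame_of_mean b u : spacetime_smooth u ->
  (forall vs, exists2 C, 0 <= C & forall t x, 0 < t <= 1 ->
    mean x (fun y => iterD vs (u t) y ^+ 2) <= C * t `^ (2 * b)) ->
  tame b u.
Proof.
move=> su H; split=> // vs.
have [S [L [S0 sob]]] := sobolev R D.
have [K K0 KP] : exists2 K, 0 <= K & forall t x, 0 < t <= 1 ->
    \sum_(ws <- L) mean x (fun y => iterD ws (iterD vs (u t)) y ^+ 2) <= K * t `^ (2 * b).
  elim: L {sob} => [|ws L [K K0 IH]].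
    by exists 0 => // t x tt; rewrite big_nil mul0r.
  have [C C0 HC] := H (ws ++ vs); exists (C + K); first exact: addr_ge0.
  move=> t x tt; rewrite big_cons mulrDl lerD//; last exact: IH.
  by have := HC t x tt; rewrite iterD_cat.
have SK := mulr_ge0 S0 K0.
(* a square root of S * K would do; 1 + S * K also bounds it from above *)
exists (1 + S * K); first by rewrite addr_ge0.
move=> t x /[dup] tt /andP[t0 _].
have tb := powR_ge0 t b.
rewrite -(ler_pXn2r (_ : (0 < 2)%N))// ?nnegrE ?mulr_ge0// ?addr_ge0//.
rewrite -normrX ger0_norm ?sqr_ge0//.
have st := torus_smooth_iterD vs (spacetime_smooth_slice su t0).
apply: (le_trans (sob _ x st)); apply: (le_trans (ler_wpM2l S0 (KP t x tt))).
have -> : t `^ (2 * b) = t `^ b ^+ 2.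
  by rewrite mulrC powRrM powR_mulrn ?powR_ge0.
rewrite exprMn mulrA ler_wpM2r ?sqr_ge0//; nra.
Qed.

Lemma tame_mean b u : tame b u -> forall vs, exists2 C, 0 <= C & forall t x, 0 < t <= 1 ->
    mean x (fun y => iterD vs (u t) y ^+ 2) <= C * t `^ (2 * b).
Proof.
move=> [su H] vs; have [C C0 HC] := H vs; exists (C ^+ 2); first exact: sqr_ge0.
move=> t x tt; apply: le_trans (ler_norm _) _; apply: mean_norm => y.
have -> : t `^ (2 * b) = t `^ b ^+ 2.
  by rewrite mulrC powRrM powR_mulrn ?powR_ge0.
rewrite normrX -exprMn lerXn2r ?nnegrE//; last exact: HC.
by rewrite mulr_ge0// powR_ge0.
Qed.

(** The derivatives of u solve the same equation, so the mean square bound, which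
    is uniform in t, applies to all of them. *)
Lemma tame_elliptic b (s : R -> 'I_D -> R) f u : spacetime_smooth u -> tame b f ->
  (forall t x, 0 < t ->
    u t x - \sum_(a < D) frameD (s t) a (frameD (s t) a (u t)) x = f t x) ->
  tame b u.
Proof.
move=> su tf E; apply: tame_of_mean => // vs.
have [C C0 HC] := tame_mean tf vs; exists C => // t x /[dup] tt /andP[t0 _].
apply: le_trans (HC t x tt).
have su' := spacetime_smooth_slice su t0; have sf' := spacetime_smooth_slice tf.1 t0.
have Evs y : iterD vs (u t) y -
    \sum_(a < D) frameD (s t) a (frameD (s t) a (iterD vs (u t))) y = iterD vs (f t) y.
  elim: vs {C C0 HC} y => [|v vs IH] y; first exact: E.
  have sv := torus_smooth_iterD vs su'.
  have sl := torus_smooth_sum (index_enum _)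
    (fun a => torus_smooth_frameD (s t) a (torus_smooth_frameD (s t) a sv)).
  have -> : iterD (v :: vs) (f t) = dirD v (fun y => iterD vs (u t) y -
      \sum_(a < D) frameD (s t) a (frameD (s t) a (iterD vs (u t))) y).
    by rewrite /=; congr dirD; apply/funext => z; rewrite IH.
  by rewrite (dirDB _ sv sl) (dirD_laplacian _ _ sv).
have sv := torus_smooth_iterD vs su'.
apply: le_trans (elliptic_mean x (torus_smooth_iterD vs sf') sv Evs).
rewrite lerDl mulr_ge0// sumr_ge0// => a _.
have se := torus_smooth_frameD (s t) a sv.
by apply: (mean_ge0 _ (torus_smoothM se se)) => y; exact: sqr_ge0.
Qed.

End MeanToSup.

Section Crude.
Variables (R : realType) (D : nat) (p : 'I_D -> R) (pphi : R).
Local Notation V := 'rV[R]_D.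

(** The selected component of a differentiated solution is the derivative of the
    component, so the energies of the differentiated solutions bound
    derivatives of all orders. *)
Lemma component_tame : exists A : R, forall sel : fields R D -> V -> R,
  (forall v F, sel (fieldsD v F) = dirD v (sel F)) ->
  (forall (d : config R D) y, sel d.1.2 y ^+ 2 <= energy_density d.1.1 d.1.2 y) ->
  forall F, frame_solution p pphi F -> spacetime_smooth (fun t => sel (F t)) ->
  tame (- A) (fun t => sel (F t)).
Proof.
have [N N0 growth] := energy_growth p pphi.
(* the energy is quadratic, hence half of its exponent *)
exists (N / 2) => sel selD selE F sF ssel; apply: tame_of_mean => // vs.
pose Fvs t := foldr (@fieldsD R D) (F t) vs.
have [sFvs selvs] : frame_solution p pphi Fvs /\ forall t, sel (Fvs t) = iterD vs (sel (F t)).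
  rewrite {}/Fvs; elim: vs => [|v vs [IH1 IH2]]; first by split.
  split; first exact: (frame_solutionD v IH1).
  by move=> t /=; rewrite selD IH2.
have [sG _] := timeD_energy_density 0 sFvs ltr01.
have [B BP] := torus_smooth_bounded (spacetime_smooth_slice sG ltr01).
have B0 : 0 <= B by apply: le_trans (BP 0).
exists B => // t x /[dup] tt /andP[t0 _].
have -> : 2 * - (N / 2) = - N by rewrite mulrN mulrC divfK.
rewrite -selvs.
have s1 : torus_smooth (sel (Fvs t)).
  by rewrite selvs; exact: (torus_smooth_iterD vs (spacetime_smooth_slice ssel t0)).
apply: (@le_trans _ _ (mean x (energy_density (scale p t) (Fvs t)))).
  apply: (mean_le _ (torus_smoothM s1 s1) (spacetime_smooth_slice sG t0)) => y.
  exact: (selE (scale p t, Fvs t, x)).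
apply: (le_trans (growth _ sFvs x t tt)); rewrite mulrC ler_wpM2r ?powR_ge0//.
apply: (le_trans (ler_norm _)); exact: mean_norm.
Qed.

Lemma frame_solution_tame : exists A : R, forall F, frame_solution p pphi F ->
  [/\ forall i j, tame (- A) (fun t => fH (F t) i j),
      forall i j, tame (- A) (fun t => fL (F t) i j),
      tame (- A) (fun t => fphi (F t)) & tame (- A) (fun t => fpsi (F t))].
Proof.
have [A AP] := component_tame; exists A => F sF.
have S0 (h : 'I_D -> R) : 0 <= \sum_(a < D) h a ^+ 2 by exact: sum_sqr_ge0.
split=> [i j|i j||].
- apply: (AP (fun F => fH F i j)) => // [d y|]; last exact: (fs_H sF).
  apply: le_trans (energy_density_geH d i j y).
  by rewrite -addrA lerDl addr_ge0 ?sqr_ge0 ?S0.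
- apply: (AP (fun F => fL F i j)) => // [d y|]; last exact: (fs_L sF).
  apply: le_trans (energy_density_geH d i j y).
  by rewrite addrAC lerDr addr_ge0 ?sqr_ge0 ?S0.
- apply: (AP (fun F => fphi F)) => // [d y|]; last exact: (fs_phi sF).
  apply: le_trans (energy_density_gephi d y).
  by rewrite -addrA lerDl addr_ge0 ?sqr_ge0 ?S0.
- apply: (AP (fun F => fpsi F)) => // [d y|]; last exact: (fs_psi sF).
  apply: le_trans (energy_density_gephi d y).
  by rewrite addrAC lerDr addr_ge0 ?sqr_ge0 ?S0.
Qed.

End Crude.

(** * From the coordinate components to the frame *)

Section FrameOfSolution.
Variables (R : realType) (D : nat) (p : 'I_D -> R) (pphi : R).
Variables (S : R -> state R D) (nu : R -> 'rV[R]_D -> R).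
Hypothesis solS : smooth_solution p pphi S nu.
Local Notation V := 'rV[R]_D.
Implicit Types (i j a b : 'I_D) (t : R) (x : V).

Definition eta_st i j : R -> V -> R := fun t => Defs.eta p t (S t) i j.
Definition curvK_st i j : R -> V -> R := fun t => curvK p t (S t) i j.

(** The weight t^(p_j - p_i) turns the coordinate component with lower index i
    and upper index j into the frame component. *)
Definition frame_fields t : fields R D := Fields
  (fun i j x => t `^ (p j - p i) * eta_st i j t x)
  (fun i j x => t `^ (p j - p i) * curvK_st i j t x)
  (st_phi (S t)) (st_psi (S t)) (nu t).

Lemma eta_st_smooth i j : spacetime_smooth (eta_st i j).
Proof.
have [[sh _ _ _ _] _] := solS.
exact: (spacetime_smoothM (spacetime_smoothZ (- 2^-1) (spacetime_smooth_powR D (- (2 * p j))))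
  (sh i j)).
Qed.

Lemma curvK_st_smooth i j : spacetime_smooth (curvK_st i j).
Proof.
have [[sh sk _ _ _] _] := solS.
exact: (spacetime_smoothM (spacetime_smooth_powR D (- (2 * p j)))
  (spacetime_smoothD (sk i j) (spacetime_smoothZ (p i) (sh i j)))).
Qed.

Lemma st_phi_smooth : spacetime_smooth (fun t => st_phi (S t)).
Proof. by have [[_ _ s _ _] _] := solS. Qed.
Lemma st_psi_smooth : spacetime_smooth (fun t => st_psi (S t)).
Proof. by have [[_ _ _ s _] _] := solS. Qed.
Lemma nu_smooth : spacetime_smooth nu.
Proof. by have [[_ _ _ _ s] _] := solS. Qed.

Let sHt i j t : 0 < t -> torus_smooth (eta_st i j t).
Proof. exact: (spacetime_smooth_slice (eta_st_smooth i j)). Qed.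
Let sKt i j t : 0 < t -> torus_smooth (curvK_st i j t).
Proof. exact: (spacetime_smooth_slice (curvK_st_smooth i j)). Qed.
Let sphit t : 0 < t -> torus_smooth (st_phi (S t)).
Proof. exact: (spacetime_smooth_slice st_phi_smooth). Qed.
Let snut t : 0 < t -> torus_smooth (nu t).
Proof. exact: (spacetime_smooth_slice nu_smooth). Qed.

Let q i t : R := t `^ (p i).
Lemma powR_sub (t a b : R) : 0 < t -> t `^ (a - b) = t `^ a / t `^ b.
Proof. by move=> t0; rewrite powRD ?powRN// (gt_eqF t0) implybT. Qed.

Let q0 i t : 0 < t -> q i t != 0.
Proof. by move=> t0; rewrite gt_eqF ?powR_gt0. Qed.
Let powB i j t : 0 < t -> t `^ (p j - p i) = q j t / q i t.
Proof. exact: powR_sub. Qed.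
Let powM2 i t : 0 < t -> t `^ (- (2 * p i)) = (q i t ^+ 2)^-1.
Proof. by move=> t0; rewrite powRN mulrC powRrM powR_mulrn ?powR_ge0. Qed.
Let pow22 i t : 0 < t -> t `^ (2 - 2 * p i) = t ^+ 2 / q i t ^+ 2.
Proof. by move=> t0; rewrite powRD ?(gt_eqF t0) ?implybT// powM2// powR_mulrn// ltW. Qed.
Let scaleE i t : 0 < t -> scale p t i = t / q i t.
Proof. by move=> t0; rewrite /scale powR_sub// powRr1// ltW. Qed.

Lemma partialE : @partial R D = fun i => dirD (delta_mx 0 i). Proof. by []. Qed.

Lemma frameD_frameD (s : 'I_D -> R) a b f x : torus_smooth f ->
  frameD s a (frameD s b f) x = s a * s b * partial a (partial b f) x.
Proof.
by move=> sf; rewrite /frameD (dirDZ _ _ (torus_smooth_dirD _ sf)) mulrA.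
Qed.

Lemma frameD_frameD_swap (s : 'I_D -> R) a b f x : torus_smooth f ->
  frameD s a (frameD s b f) x = s a * s b * partial b (partial a f) x.
Proof. by move=> sf; rewrite frameDC// (frameD_frameD _ _ _ _ sf) [s b * _]mulrC. Qed.

Lemma frameD_frameDZ (s : 'I_D -> R) a b c f x : torus_smooth f ->
  frameD s a (frameD s b (fun y => c * f y)) x = s a * s b * c * partial a (partial b f) x.
Proof.
move=> sf; rewrite (frameDZ _ _ _ sf) (frameDZ _ _ _ (torus_smooth_frameD _ _ sf)).
by rewrite (frameD_frameD _ _ _ _ sf) mulrCA mulrA.
Qed.

Lemma trH_frame_fields t : 0 < t -> trH (frame_fields t) = tensor_trace (Defs.eta p t (S t)).
Proof.
move=> t0; apply/funext => x; apply: eq_bigr => a _ /=.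
by rewrite subrr powRr0 mul1r.
Qed.

Let s_trace t : 0 < t -> torus_smooth (tensor_trace (Defs.eta p t (S t))).
Proof. by move=> t0; exact: (torus_smooth_sum _ (fun a => sHt a a t0)). Qed.

Lemma frame_laplacian f t x : torus_smooth f -> 0 < t ->
  \sum_(a < D) frameD (scale p t) a (frameD (scale p t) a f) x = t ^+ 2 * laplacian p t f x.
Proof.
move=> sf t0; rewrite mulr_sumr; apply: eq_bigr => a _.
rewrite (frameD_frameD _ _ _ _ sf) !scaleE// powM2// [RHS]mulrA; congr (_ * _).
by have := q0 a t0; move: (q a t) => qa h1; field.
Qed.

Lemma frame_symH i j t x : 0 < t ->
  fH (frame_fields t) i j x = fH (frame_fields t) j i x.
Proof.
move=> t0; have [_ /(_ t t0)[_ _ [_ _ _ symh _]]] := solS.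
rewrite /= /eta_st /Defs.eta symh !powM2// !powB//.
by have := q0 i t0; have := q0 j t0; move: (q i t) (q j t) => qi qj *; field; apply/andP.
Qed.

Lemma frame_div_div s i j t x : 0 < t -> s = scale p t ->
  frameD s j (divH s (frame_fields t) i) x =
  \sum_(b < D) t ^+ 2 / (q j t * q i t) * partial j (partial b (Defs.eta p t (S t) i b)) x.
Proof.
move=> t0 ->.
have sF a : torus_smooth (fH (frame_fields t) a i) by exact: (torus_smoothZ _ (sHt a i t0)).
rewrite /divH (frameD_sum _ _ _ (fun a => torus_smooth_frameD _ _ (sF a))).
apply: eq_bigr => b _.
have -> : fH (frame_fields t) b i = fun y => t `^ (p b - p i) * eta_st i b t y.
  by apply/funext => y; rewrite frame_symH.
rewrite (frameD_frameDZ _ _ _ _ _ (sHt i b t0)) !scaleE// powB//; congr (_ * _).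
have := q0 i t0; have := q0 j t0; have := q0 b t0.
by move: (q i t) (q j t) (q b t) => qi qj qb h1 h2 h3; field; rewrite h1 h2 h3.
Qed.

Lemma frame_constraints_of_solution t : 0 < t ->
  frame_constraints p pphi (scale p t) (frame_fields t).
Proof.
move=> t0; have [_ /(_ t t0)[_ lap [_ _ mom symh symk]]] := solS.
split=> [i j x|i j x|i x|x]; first exact: frame_symH.
- rewrite /= /eta_st /curvK_st /Defs.eta /curvK (symh j i) (symk j i) !powM2// !powB//.
  have := q0 i t0; have := q0 j t0.
  by move: (q i t) (q j t) => qi qj h1 h2; field; rewrite h1 h2.
- have -> : \sum_(j < D) frameD (scale p t) j (fL (frame_fields t) i j) x =
      scale p t i * \sum_(j < D) partial j (curvK p t (S t) i j) x.
    rewrite mulr_sumr; apply: eq_bigr => j _ /=.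
    rewrite (frameDZ _ _ _ (sKt i j t0)) /frameD mulrA; congr (_ * _).
    rewrite !scaleE// powB//; have := q0 i t0; have := q0 j t0.
    by move: (q i t) (q j t) => qi qj h1 h2; field; rewrite h1 h2.
  rewrite -mulrDr; apply/eqP; rewrite mulf_eq0; apply/orP; right.
  rewrite -[X in _ == X](mom i x) -addrA; apply/eqP; congr (_ + _).
  have s1 a := torus_smoothZ (p a) (sHt a a t0).
  have s2 := torus_smoothD (torus_smoothN (torus_smooth_sum (index_enum _) s1))
    (torus_smoothZ (2 * pphi) (sphit t0)).
  rewrite partialE -[p i * _](congr1 (fun f => f x) (dirDZ _ (p i) (s_trace t0))).
  have := dirDD (delta_mx 0 i) s2 (torus_smoothZ (p i) (s_trace t0)).
  move/(congr1 (fun f => f x)) => h; rewrite -[RHS]h; congr (dirD _ _ x).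
  apply/funext => y; rewrite /momentum_source addrAC; congr (_ + _).
  rewrite /tensor_trace mulr_sumr addrC -sumrB; apply: eq_bigr => a _ /=.
  by rewrite subrr powRr0 mul1r mulrBl.
- rewrite (frame_laplacian _ (snut t0) t0) [LHS](lap x).
  have sdiv a : torus_smooth (divH (scale p t) (frame_fields t) a).
    apply: torus_smooth_sum => b; apply: torus_smooth_frameD.
    exact: (torus_smoothZ _ (sHt b a t0)).
  have sfl a : frameD (scale p t) a (lapse_flux (scale p t) (frame_fields t) a) x =
     -2 * (t ^+ 2 * (t `^ (- (2 * p a)) * partial a (partial a (tensor_trace (Defs.eta p t (S t)))) x))
     + 2 * \sum_(b < D) t `^ (2 - 2 * p a) * partial b (partial a (Defs.eta p t (S t) a b)) x.
    have sft := torus_smooth_frameD (scale p t) a (s_trace t0).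
    have Ediv : frameD (scale p t) a (divH (scale p t) (frame_fields t) a) x =
        \sum_(b < D) t `^ (2 - 2 * p a) * partial b (partial a (Defs.eta p t (S t) a b)) x.
      rewrite (frame_div_div _ _ _ t0 erefl); apply: eq_bigr => b _.
      have C := congr1 (fun f => f x) (dirDC (delta_mx 0 a) (delta_mx 0 b) (sHt a b t0)).
      rewrite (pow22 a t0) expr2; exact: (congr1 (fun z => t * t / (q a t * q a t) * z) C).
    have Elap : frameD (scale p t) a (frameD (scale p t) a (tensor_trace (Defs.eta p t (S t)))) x =
        t ^+ 2 * (t `^ (- (2 * p a)) * partial a (partial a (tensor_trace (Defs.eta p t (S t)))) x).
      rewrite (frameD_frameD _ _ _ _ (s_trace t0)) !scaleE// powM2// [RHS]mulrA; congr (_ * _).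
      by have := q0 a t0; move: (q a t) => qa h1; field.
    rewrite /lapse_flux trH_frame_fields// (frameDD _ _ (torus_smoothZ _ sft)
      (torus_smoothZ _ (sdiv a))) (frameDZ _ _ _ sft) (frameDZ _ _ _ (sdiv a)).
    by rewrite Ediv Elap.
  rewrite (eq_bigr _ (fun a _ => sfl a)) big_split /= -!mulr_sumr.
  by rewrite mulrA.
Qed.

Lemma timeD_weighted (c : R) (u : R -> V -> R) (w : V -> R) t x : spacetime_smooth u ->
  0 < t -> t * timeD u t x = w x ->
  t * timeD (fun t x => t `^ c * u t x) t x = t `^ c * w x + c * (t `^ c * u t x).
Proof.
move=> su t0 E.
have := timeDM x (spacetime_smooth_powR D c) su t0; rewrite (timeD_powR _ x t0) => ->.
rewrite -E -(powR_pred c t0); ring.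
Qed.

(** The comparison of the two forms of the L equation, with the spatial
    derivatives abstracted to real numbers. *)
Lemma rateL_algebra (t qi qj c K L1 L2 L3 P1 P2 d : R) : qi != 0 -> qj != 0 ->
  qj / qi * d = d ->
  qj / qi * (t ^+ 2 * (L1 + qj ^- 2 * P1 - L2 - qj ^- 2 * L3)
     - t ^+ 2 / qj ^+ 2 * P2 + d) + c * (qj / qi * K) =
  c * (qj / qi * K) + qj / qi * (t ^+ 2 * L1) +
  (t / qj * (t / qi) * P1 - t ^+ 2 / (qj * qi) * L3 - t / qj * (t / qi) * P2) -
  qj / qi * (t ^+ 2 * L2) + d.
Proof.
by move=> hi hj Ed; rewrite [X in X + _ = _]mulrDr Ed; field; rewrite hi hj.
Qed.

(** The identities are matched by writing all powers through q_i = t^(p_i). *)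
Lemma frame_of_solution : frame_solution p pphi frame_fields.
Proof.
have [_ sol] := solS.
split.
- by move=> i j; exact: (spacetime_smoothM (spacetime_smooth_powR D _) (eta_st_smooth i j)).
- by move=> i j; exact: (spacetime_smoothM (spacetime_smooth_powR D _) (curvK_st_smooth i j)).
- exact: st_phi_smooth.
- exact: st_psi_smooth.
- exact: nu_smooth.
- exact: frame_constraints_of_solution.
- move=> t x i j t0; have [[evH _ _ _] _ _] := sol t t0.
  have E : t * timeD (eta_st i j) t x = curvK_st i j t x + 2 * (p i - p j) * eta_st i j t x
      - p i * (i == j)%:R * nu t x := evH i j x.
  rewrite [LHS](timeD_weighted (p j - p i) (w := fun x => curvK_st i j t x +
    2 * (p i - p j) * eta_st i j t x - p i * (i == j)%:R * nu t x) (eta_st_smooth i j) t0 E).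
  rewrite /rateH /=; have [<-|ij] := eqVneq i j; first by rewrite subrr powRr0; ring.
  by rewrite mulr0n !mulr0 !mul0r; ring.
- move=> t x i j t0; have [[_ evK _ _] _ _] := sol t t0.
  pose w x := t ^+ 2 * (laplacian p t (Defs.eta p t (S t) i j) x
     + t `^ (- (2 * p j)) * partial i (partial j (tensor_trace (Defs.eta p t (S t)))) x
     - \sum_(a < D) t `^ (- (2 * p a)) * partial i (partial a (Defs.eta p t (S t) a j)) x
     - t `^ (- (2 * p j)) * \sum_(b < D) partial j (partial b (Defs.eta p t (S t) i b)) x)
    - t `^ (2 - 2 * p j) * partial i (partial j (nu t)) x
    + p i * (i == j)%:R * nu t x.
  have E : t * timeD (curvK_st i j) t x = w x := evK i j x.
  rewrite [LHS](timeD_weighted (p j - p i) (curvK_st_smooth i j) t0 E).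
  have s1 := torus_smooth_frameD (scale p t) i (s_trace t0).
  have s2 : torus_smooth (divH (scale p t) (frame_fields t) i).
    apply: torus_smooth_sum => b; apply: torus_smooth_frameD.
    exact: (torus_smoothZ _ (sHt b i t0)).
  have s3 := torus_smooth_frameD (scale p t) i (snut t0).
  rewrite /rateL /potential trH_frame_fields//.
  rewrite (frameDB _ _ (torus_smoothB s1 s2) s3) (frameDB _ _ s1 s2).
  rewrite (frameD_frameD_swap _ _ _ _ (s_trace t0)) (frameD_frameD_swap _ _ _ _ (snut t0)).
  have -> : frameD (scale p t) j (divH (scale p t) (frame_fields t) i) x =
      t ^+ 2 / (q j t * q i t) *
      \sum_(b < D) partial j (partial b (Defs.eta p t (S t) i b)) x.
    by rewrite (frame_div_div _ _ _ t0 erefl) mulr_sumr.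
  have -> : \sum_(a < D) frameD (scale p t) a (frameD (scale p t) a (fH (frame_fields t) i j)) x
      = t `^ (p j - p i) * (t ^+ 2 * laplacian p t (Defs.eta p t (S t) i j) x).
    rewrite -(frame_laplacian _ (sHt i j t0) t0) mulr_sumr; apply: eq_bigr => a _.
    have sD2 := torus_smooth_frameD (scale p t) a (sHt i j t0).
    exact: (congr1 (fun f => f x) (etrans (congr1 _ (frameDZ _ _ _ (sHt i j t0)))
      (frameDZ _ _ _ sD2))).
  have -> : frameD (scale p t) i (divH (scale p t) (frame_fields t) j) x =
      t `^ (p j - p i) * (t ^+ 2 * \sum_(a < D) t `^ (- (2 * p a)) *
         partial i (partial a (Defs.eta p t (S t) a j)) x).
    have sF a : torus_smooth (fH (frame_fields t) a j) by exact: (torus_smoothZ _ (sHt a j t0)).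
    rewrite /divH (frameD_sum _ _ _ (fun a => torus_smooth_frameD _ _ (sF a))) !mulr_sumr.
    apply: eq_bigr => a _.
    rewrite (frameD_frameDZ _ _ _ _ _ (sHt a j t0)) !mulrA; congr (_ * _).
    rewrite !scaleE// !powB// powM2//.
    have := q0 a t0; have := q0 i t0; have := q0 j t0.
    by move: (q a t) (q i t) (q j t) => qa qi qj h1 h2 h3; field; rewrite ?h1 ?h2 ?h3.
  rewrite /w (scaleE i t0) (scaleE j t0) (powM2 j t0) (pow22 j t0) (powB i j t0) /=.
  rewrite (powB i j t0); apply: rateL_algebra; rewrite ?q0// -(powB i j t0).
  by have [->|ij] := eqVneq i j; rewrite ?subrr ?powRr0 ?mul1r// mulr0n !mulr0 !mul0r mulr0.
- move=> t x t0; have [[_ _ evphi _] _ _] := sol t t0; exact: evphi.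
- move=> t x t0; have [[_ _ _ evpsi] _ _] := sol t t0.
  have -> : t * timeD (fun s => fpsi (frame_fields s)) t x =
    t ^+ 2 * laplacian p t (st_phi (S t)) x - pphi * nu t x := evpsi x.
  by rewrite -(frame_laplacian _ (sphit t0) t0).
Qed.

End FrameOfSolution.

(** * Subcriticality improves the decay of the sources *)

Lemma positive_lower_bound (R : realType) (I : finType) (h : I -> R) :
  (forall i, 0 < h i) -> exists2 e, 0 < e & forall i, e <= h i.
Proof.
move=> h0; suff [e e0 eP] : exists2 e, 0 < e & forall i, i \in enum I -> e <= h i.
  by exists e => // i; apply: eP; rewrite mem_enum.
elim: (enum I) => [|i r [e e0 IH]]; first by exists 1.
exists (Num.min (h i) e); first by rewrite lt_min h0.
by move=> j; rewrite inE ge_min => /orP[/eqP ->|/IH ->]; rewrite ?lexx ?orbT.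
Qed.

(** Finitely many strict inequalities, hence a common margin. The second item is
    the case k = j of the third, which exists because D is at least 2.
    The last one separates distinct exponents, so that errors of size t^(e/2)
    are smaller than the homogeneous solutions t^(2 (p_i - p_j)). *)
Definition margin (R : realType) (D : nat) (p : 'I_D -> R) (e : R) : Prop :=
  [/\ 0 < e, forall i, e <= 1 - p i,
      forall i j k, i != j -> e <= 1 - (p i + p j - p k)
    & forall i j, p j < p i -> e <= p i - p j].

Lemma subcritical_margin (R : realType) (D : nat) (p : 'I_D -> R) :
  (2 <= D)%N -> subcritical p -> exists e, margin p e.
Proof.
move=> D2 sub.
have [|e1 e10 h1] := @positive_lower_bound R ('I_D * 'I_D * 'I_D)%type
  (fun z => if z.1.1 != z.1.2 then 1 - (p z.1.1 + p z.1.2 - p z.2) else 1).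
  by move=> [[i j] k] /=; case: ifP => // ij; rewrite subr_gt0; exact: sub.
have [|e2 e20 h2] := @positive_lower_bound R ('I_D * 'I_D)%type
  (fun z => if p z.2 < p z.1 then p z.1 - p z.2 else 1).
  by move=> [i j] /=; case: ifP => // ij; rewrite subr_gt0.
have h1' i j k : i != j -> e1 <= 1 - (p i + p j - p k).
  by move=> ij; have := h1 (i, j, k); rewrite /= ij.
exists (Num.min e1 e2); split.
- by rewrite lt_min e10.
- move=> i; have [j ij] : exists j : 'I_D, i != j.
    case: D p D2 sub i {h1 h2 h1'} => [|[|n]]// p _ _ i.
    have [->|i0] := eqVneq i ord0; first by exists ord_max.
    by exists ord0.
  by rewrite ge_min; have := h1' i j j ij; rewrite addrK => ->.
- by move=> i j k ij; rewrite ge_min h1'.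
- by move=> i j ij; rewrite ge_min; have := h2 (i, j); rewrite /= ij => ->; rewrite orbT.
Qed.

Section Bootstrap.
Variables (R : realType) (D : nat) (p : 'I_D -> R) (pphi : R).
Variables (S : R -> state R D) (nu : R -> 'rV[R]_D -> R) (e : R).
Hypothesis solS : smooth_solution p pphi S nu.
Hypothesis marg : margin p e.
Local Notation V := 'rV[R]_D.
Local Notation eta_st := (eta_st p S).
Local Notation curvK_st := (curvK_st p S).
Implicit Types (i j a b : 'I_D) (t : R) (x : V) (B : R).

Let phi_st : R -> V -> R := fun t => st_phi (S t).
Let psi_st : R -> V -> R := fun t => st_psi (S t).

Definition logD (u : R -> V -> R) : R -> V -> R := fun t x => t * timeD u t x.

Definition hessian a b (u : R -> V -> R) : R -> V -> R :=
  spaceD (delta_mx 0 a) (spaceD (delta_mx 0 b) u).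

Lemma tame_hessian (c r r' : R) i j (u : R -> V -> R) : tame r u -> r' <= c + r ->
  tame r' (fun t x => t `^ c * hessian i j u t x).
Proof. by move=> tu; exact/tame_powR_le/tame_spaceD/tame_spaceD. Qed.

Definition trace_st : R -> V -> R := fun t x => \sum_(a < D) eta_st a a t x.

(** Only the components with p_j <= p_i are expected to be almost bounded; the
    symmetry of h expresses the others through them, with a negative power of t. *)
Definition boot B : Prop :=
  (forall i j, p j <= p i -> tame (- B) (eta_st i j)) /\ tame (- B) phi_st.

Lemma eta_swap i j t x : 0 < t ->
  eta_st i j t x = t `^ (2 * p i - 2 * p j) * eta_st j i t x.
Proof.
move=> t0; have [_ /(_ t t0)[_ _ [_ _ _ symh _]]] := solS.
have E : t `^ (- (2 * p j)) = t `^ (2 * p i - 2 * p j) * t `^ (- (2 * p i)).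
  by rewrite -powRD ?(gt_eqF t0) ?implybT//; congr (_ `^ _); ring.
rewrite /eta_st /Defs.eta (symh i j) E; ring.
Qed.

(** All components of h_ij are almost of the size of t^(2 min(p_i, p_j)). *)
Lemma boot_eta B i j : boot B ->
  tame (2 * Num.min (p i) (p j) - 2 * p j - B) (eta_st i j).
Proof.
move=> [H _]; have [pji|/ltW pij] := leP (p j) (p i).
  have -> : 2 * p j - 2 * p j - B = - B by ring.
  exact: H.
have tp := tame_powR (2 * p i - 2 * p j) (H j i pij).
by apply: (tame_eq _ tp) => t x t0; rewrite -eta_swap.
Qed.

Lemma boot_trace B : boot B -> tame (- B) trace_st.
Proof. by move=> [H _]; apply: tame_sum => a; exact: H. Qed.

Lemma pow_sqr_shift c t : 0 < t -> t ^+ 2 * t `^ (- c) = t `^ (2 - c).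
Proof. by move=> t0; rewrite powRD ?(gt_eqF t0) ?implybT// powR_mulrn// ltW. Qed.

Lemma margin_le a : e <= 2 - 2 * p a.
Proof. by have [e0 /(_ a) h _ _] := marg; lra. Qed.

(** The net exponent is 2 - 2 max(p_a, p_j), which is positive as all p_i are
    smaller than 1. *)
Lemma tame_boot_div B a j k : boot B -> tame (e - B)
  (fun t x => t `^ (2 - 2 * p a) * hessian k a (eta_st a j) t x).
Proof.
move=> bB; apply: (tame_hessian _ _ (boot_eta a j bB)).
have := margin_le a; have := margin_le j.
by have [h|h] := leP (p a) (p j); lra.
Qed.

Lemma tame_lapse B : boot B -> tame (e - B) nu.
Proof.
move=> bB; pose f : R -> V -> R := fun t x =>
  -2 * (\sum_(a < D) t `^ (2 - 2 * p a) * hessian a a trace_st t x)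
  + 2 * (\sum_(a < D) \sum_(i < D) t `^ (2 - 2 * p a) * hessian i a (eta_st a i) t x).
have tf : tame (e - B) f.
  apply: tameD; apply: tameZ; apply: tame_sum => a.
    by apply: (tame_hessian _ _ (boot_trace bB)); have := margin_le a; lra.
  by apply: tame_sum => i; exact: tame_boot_div.
apply: (tame_elliptic (s := scale p) (nu_smooth solS) tf) => t x t0.
have snu := spacetime_smooth_slice (nu_smooth solS) t0.
rewrite (frame_laplacian p _ snu t0).
have [_ /(_ t t0)[_ lap _]] := solS.
rewrite [LHS](lap x) /f; congr (_ + _); rewrite -mulrA; congr (_ * _).
rewrite mulr_sumr; apply: eq_bigr => a _.
by rewrite mulrA (pow_sqr_shift _ t0).
Qed.

Lemma tame_logD_psi B : boot B -> tame (e - B) (logD psi_st).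
Proof.
move=> bB; have tn := tame_lapse bB.
have tt : tame (e - B) (fun t x =>
    (\sum_(a < D) t `^ (2 - 2 * p a) * hessian a a phi_st t x) - pphi * nu t x).
  apply: tameB; last exact: tameZ.
  apply: tame_sum => a; apply: (tame_hessian _ _ bB.2).
  by have := margin_le a; lra.
apply: (tame_eq _ tt) => t x t0.
have [_ /(_ t t0)[[_ _ _ evpsi] _ _]] := solS.
rewrite [RHS](evpsi x); congr (_ - _).
rewrite mulr_sumr; apply: eq_bigr => a _.
by rewrite mulrA (pow_sqr_shift _ t0).
Qed.

Lemma curvK_evolution i j t x : 0 < t -> logD (curvK_st i j) t x =
  (\sum_(a < D) t `^ (2 - 2 * p a) * hessian a a (eta_st i j) t x)
  + t `^ (2 - 2 * p j) * hessian i j trace_st t x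
  - (\sum_(a < D) t `^ (2 - 2 * p a) * hessian i a (eta_st a j) t x)
  - (\sum_(b < D) t `^ (2 - 2 * p j) * hessian j b (eta_st i b) t x)
  - t `^ (2 - 2 * p j) * hessian i j nu t x
  + p i * (i == j)%:R * nu t x.
Proof.
move=> t0; have [_ /(_ t t0)[[_ evK _ _] _ _]] := solS.
rewrite [LHS](evK i j x) !mulrBr mulrDr.
rewrite [X in X + _ - _ - _ - _ + _]mulr_sumr [X in _ + _ - X - _ - _ + _]mulr_sumr.
rewrite [X in _ + X - _ - _ - _ + _]mulrA [X in _ + _ - _ - X - _ + _]mulrA.
rewrite (pow_sqr_shift _ t0) [X in _ + _ - _ - X - _ + _]mulr_sumr.
congr (_ + _ - _ - _ - _ + _); apply: eq_bigr => a _;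
  by rewrite mulrA (pow_sqr_shift _ t0).
Qed.

(** The only exponent that uses the full subcriticality is the one of the fourth
    sum, 2 - 2 p_j - 2 p_b + 2 p_i when p_i < p_b; then j and b are distinct
    because p_j <= p_i. *)
Lemma tame_logD_curvK B i j : boot B -> p j <= p i -> tame (e - B) (logD (curvK_st i j)).
Proof.
move=> bB pji; have tn := tame_lapse bB; have [e0 _ m3 _] := marg.
have mj := margin_le j.
have tt : tame (e - B) (fun t x =>
  (\sum_(a < D) t `^ (2 - 2 * p a) * hessian a a (eta_st i j) t x)
  + t `^ (2 - 2 * p j) * hessian i j trace_st t x
  - (\sum_(a < D) t `^ (2 - 2 * p a) * hessian i a (eta_st a j) t x)
  - (\sum_(b < D) t `^ (2 - 2 * p j) * hessian j b (eta_st i b) t x)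
  - t `^ (2 - 2 * p j) * hessian i j nu t x
  + p i * (i == j)%:R * nu t x).
  apply: tameD; last exact: tameZ.
  apply: tameB; last by apply: (tame_hessian _ _ tn); lra.
  apply: tameB; last first.
    apply: tame_sum => b; apply: (tame_hessian _ _ (boot_eta i b bB)).
    have [pib|pbi] := ltP (p i) (p b); last by lra.
    have jb : j != b by apply: contraTneq pib => <-; rewrite -leNgt.
    by have := m3 j b i jb; lra.
  apply: tameB; last by apply: tame_sum => a; exact: tame_boot_div.
  apply: tameD; last by apply: (tame_hessian _ _ (boot_trace bB)); lra.
  apply: tame_sum => a; apply: (tame_hessian _ _ (bB.1 i j pji)).
  by have := margin_le a; lra.
by apply: (tame_eq _ tt) => t x t0; rewrite curvK_evolution.
Qed.

Lemma eta_evolution i j t x : 0 < t -> t * timeD (eta_st i j) t x =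
  2 * (p i - p j) * eta_st i j t x + (curvK_st i j t x - p i * (i == j)%:R * nu t x).
Proof.
move=> t0; have [_ /(_ t t0)[[evH _ _ _] _ _]] := solS.
by rewrite [LHS](evH i j x) addrAC addrC.
Qed.

Lemma phi_evolution t x : 0 < t -> t * timeD phi_st t x = psi_st t x + pphi * nu t x.
Proof. by move=> t0; have [_ /(_ t t0)[[_ _ evphi _] _ _]] := solS; exact: evphi. Qed.

(** The sources gain t^e over the unknowns. As long as they still blow up, the
    homogeneous solutions of the equations, t^c with c nonnegative, do not
    limit the gain. *)
Lemma boot_step B : boot B -> e < B -> boot (B - e).
Proof.
move=> bB eB; rewrite /boot opprB; have tn := tame_lapse bB.
have eB0 : e - B < 0 by rewrite subr_lt0.
split=> [i j pji|].
  have tK : tame (e - B) (curvK_st i j).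
    apply: (tame_ode (curvK_st_smooth solS i j) (tame_logD_curvK bB pji) eB0).
    by move=> t x t0; rewrite mul0r add0r.
  have c0 : e - B < 2 * (p i - p j).
    by apply: (lt_le_trans eB0); rewrite mulr_ge0// subr_ge0.
  have tg := tameB tK (tameZ (p i * (i == j)%:R) tn).
  exact: (tame_ode (eta_st_smooth solS i j) tg c0 (eta_evolution i j)).
have tpsi : tame (e - B) psi_st.
  apply: (tame_ode (st_psi_smooth solS) (tame_logD_psi bB) eB0).
  by move=> t x t0; rewrite mul0r add0r.
apply: (tame_ode (st_phi_smooth solS) (tameD tpsi (tameZ pphi tn)) eB0).
by move=> t x t0; rewrite mul0r add0r phi_evolution.
Qed.

(** For p_j <= p_i the weight relating the coordinate component to the frame
    component is at most 1. *)
Lemma boot_start : exists B, boot B.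
Proof.
have [A /(_ _ (frame_of_solution solS))[tH _ tphi _]] := frame_solution_tame p pphi.
exists A; split=> [i j pji|]; last exact: tphi.
have tp := tame_powR_le (b' := - A) (c := p i - p j) (tH i j).
apply: (tame_eq _ (tp _)) => [t x t0|]; last by rewrite lerDr subr_ge0.
by rewrite /= mulrA -powRD ?(gt_eqF t0) ?implybT// subrKA subrr powRr0 mul1r.
Qed.

Lemma boot_le B B' : B <= B' -> boot B -> boot B'.
Proof.
move=> BB [h1 h2]; have BN : - B' <= - B by rewrite lerN2.
by split=> [i j pji|]; [exact: (tame_le BN (h1 i j pji))|exact: (tame_le BN h2)].
Qed.

(** Stopping at an odd multiple of e/2 keeps all intermediate exponents away from
    0, where a logarithm would appear. *)
Lemma boot_end : boot (e / 2).
Proof.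
have [e0 _ _ _] := marg; have [A bA] := boot_start.
have e20 : 0 < e / 2 by rewrite divr_gt0.
have [n nP] : exists n : nat, A <= n%:R * e + e / 2.
  exists (Num.bound `|A / e|).
  have := le_lt_trans (ler_norm _) (archi_boundP (normr_ge0 (A / e))).
  by rewrite ltr_pdivrMr// => h; lra.
have : boot (n%:R * e + e / 2) by exact: boot_le bA.
elim: n {nP} => [|n IH]; first by rewrite mul0r add0r.
move=> bn; apply: IH; have -> : n%:R * e + e / 2 = n.+1%:R * e + e / 2 - e.
  by rewrite -natr1; ring.
apply: boot_step => //; rewrite -natr1 mulrDl mul1r.
have : 0 <= n%:R * e by rewrite mulr_ge0// ltW.
by lra.
Qed.

End Bootstrap.

(** * Asymptotics *)

Section Vanishing.
Variables (R : realType) (D : nat).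
Local Notation V := 'rV[R]_D.
Implicit Types (u w : R -> V -> R) (x : V) (t b c m : R).

Lemma ln_powR_bound m t : 0 < m -> 0 < t <= 1 -> `|ln t| <= m^-1 * t `^ (- m).
Proof.
move=> m0 /andP[t0 t1]; rewrite ler0_norm ?ln_le0//.
rewrite -(ler_pM2l m0) mulrA divff ?gt_eqF// mul1r mulrN -mulNr -ln_powR.
by apply: ltW; apply: ln_sublinear; rewrite powR_gt0.
Qed.

Lemma tame_ln b b' u : tame b u -> b' < b -> tame b' (fun t x => ln t * u t x).
Proof.
move=> [su bu] bb; split; first exact: (spacetime_smoothM (spacetime_smooth_ln R D) su).
move=> vs; have [C C0 H] := bu vs; have m0 : 0 < b - b' by rewrite subr_gt0.
exists ((b - b')^-1 * C); first by rewrite mulr_ge0// invr_ge0 ltW.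
move=> t x /[dup] tt /andP[t0 _].
rewrite (iterDZ _ _ (spacetime_smooth_slice su t0)) normrM.
apply: (le_trans (ler_pM (normr_ge0 _) (normr_ge0 _) (ln_powR_bound m0 tt) (H t x tt))).
have -> : t `^ b' = t `^ (- (b - b')) * t `^ b.
  by rewrite -powRD ?(gt_eqF t0) ?implybT//; congr (_ `^ _); ring.
by rewrite mulrACA.
Qed.

(** A power of t to spare absorbs the logarithms that multiply limits. *)
Definition vanishing u := power_limit u (fun=> 0).

Lemma power_limit_vanishing u (l : V -> R) : power_limit u l -> vanishing (fun t x => u t x - l x).
Proof.
move=> [C [b [C0 b0 H]]]; exists C, b; split=> // t x tt.
by rewrite subr0; exact: H.
Qed.

Lemma tame_vanishing b u : 0 < b -> tame b u -> vanishing u.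
Proof.
move=> b0 [_ /(_ [::])[C C0 H]]; exists C, b; split=> // t x tt.
by rewrite subr0; exact: H.
Qed.

Lemma vanishingZ c u : vanishing u -> vanishing (fun t x => c * u t x).
Proof.
move=> [C [b [C0 b0 H]]]; exists (`|c| * C), b; split=> //; first exact: mulr_ge0.
by move=> t x tt; have := H t x tt; rewrite !subr0 normrM -mulrA; exact: ler_wpM2l.
Qed.

Lemma vanishingD u w : vanishing u -> vanishing w -> vanishing (fun t x => u t x + w t x).
Proof.
move=> [C [b [C0 b0 H]]] [C' [b' [C'0 b'0 H']]].
exists (C + C'), (Num.min b b'); split; [exact: addr_ge0|by rewrite lt_min b0|].
move=> t x tt; rewrite subr0 (le_trans (ler_normD _ _))// mulrDl.
have h1 := H t x tt; have h2 := H' t x tt; rewrite !subr0 in h1 h2.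
have b1 : t `^ b <= t `^ Num.min b b' by apply: powR_le_exp => //; rewrite ge_min lexx.
have b2 : t `^ b' <= t `^ Num.min b b' by apply: powR_le_exp => //; rewrite ge_min lexx orbT.
by apply: lerD; [apply: (le_trans h1)|apply: (le_trans h2)]; exact: ler_wpM2l.
Qed.

Lemma vanishing_ln u : vanishing u -> vanishing (fun t x => ln t * u t x).
Proof.
move=> [C [b [C0 b0 H]]]; have b2 : 0 < b / 2 by rewrite divr_gt0.
exists ((b / 2)^-1 * C), (b / 2); split=> //; first by rewrite mulr_ge0// invr_ge0 ltW.
move=> t x /[dup] tt /andP[t0 _]; rewrite subr0 normrM.
have h := H t x tt; rewrite subr0 in h.
apply: (le_trans (ler_pM (normr_ge0 _) (normr_ge0 _) (ln_powR_bound b2 tt) h)).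
have -> : t `^ (b / 2) = t `^ (- (b / 2)) * t `^ b.
  rewrite -powRD ?(gt_eqF t0) ?implybT//; congr (_ `^ _).
  by rewrite [X in _ = - _ + X]splitr addKr.
by rewrite mulrACA.
Qed.

Lemma vanishing_little_o u w (g : R -> R) : vanishing w ->
  (forall t x, 0 < t -> u t x = g t * w t x) -> little_o_at0 u g.
Proof.
move=> [C [b [C0 b0 H]]] E eps eps0.
have C1 : 0 < C + 1 by rewrite ltr_wpDl.
near=> t => x.
have t0 : 0 < t by near: t; exact: nbhs_right_gt.
have t1 : t <= 1 by near: t; exact: nbhs_right_le.
have tb : t `^ b < eps / (C + 1).
  by near: t; apply: powR_small => //; rewrite divr_gt0.
rewrite E// normrM mulrC ler_wpM2r//.
have := H t x; rewrite subr0 t0 t1 => /(_ erefl) /le_trans; apply.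
rewrite ltr_pdivlMr// in tb; apply: ltW; apply: le_lt_trans tb.
by rewrite mulrC ler_wpM2l ?powR_ge0// lerDl.
Unshelve. all: by end_near. Qed.

End Vanishing.

Section Asymptotics.
Variables (R : realType) (D : nat) (p : 'I_D -> R) (pphi : R).
Variables (S : R -> state R D) (nu : R -> 'rV[R]_D -> R) (e : R).
Hypothesis solS : smooth_solution p pphi S nu.
Hypothesis marg : margin p e.
Local Notation V := 'rV[R]_D.
Local Notation eta_st := (eta_st p S).
Local Notation curvK_st := (curvK_st p S).
Local Notation phi_st := (fun t => st_phi (S t)).
Local Notation psi_st := (fun t => st_psi (S t)).
Implicit Types (i j : 'I_D) (t : R) (x : V).

Let e0 : 0 < e. Proof. by case: marg. Qed.
Let e2 : 0 < e / 2. Proof. by rewrite divr_gt0. Qed.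
Let ee : e - e / 2 = e / 2. Proof. by rewrite {1}[e]splitr addrK. Qed.
Let e4 : e / 4 < e / 2. Proof. by rewrite ltr_pM2l// ltf_pV2 ?posrE// ltr_nat. Qed.
Let e40 : 0 < e / 4. Proof. by rewrite divr_gt0. Qed.

Let bt := boot_end solS marg.
Let tnu : tame (e / 2) nu. Proof. by rewrite -ee; exact: (tame_lapse solS marg bt). Qed.
Let tpsi : tame (e / 2) (logD psi_st).
Proof. by rewrite -ee; exact: (tame_logD_psi solS marg bt). Qed.
Let tK i j : p j <= p i -> tame (e / 2) (logD (curvK_st i j)).
Proof. by move=> h; rewrite -ee; exact: (tame_logD_curvK solS marg bt h). Qed.

Lemma curvK_limit i j : p j <= p i ->
  exists2 l : V -> R, torus_smooth l & power_limit (curvK_st i j) l.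
Proof. by move=> h; exact: (tame_limit e2 (curvK_st_smooth solS i j) (tK h)). Qed.

Lemma psi_limit : exists2 l : V -> R, torus_smooth l & power_limit psi_st l.
Proof. exact: (tame_limit e2 (st_psi_smooth solS) tpsi). Qed.

(** The combination satisfies t d/dt (u - ln t w) = g - ln t (t dw/dt), in which
    the logarithm costs an arbitrarily small power of t. *)
Lemma log_limit (u w g : R -> V -> R) : spacetime_smooth u -> spacetime_smooth w ->
  tame (e / 2) (logD w) -> tame (e / 2) g ->
  (forall t x, 0 < t -> t * timeD u t x = w t x + g t x) ->
  exists2 l : V -> R, torus_smooth l & power_limit (fun t x => u t x - ln t * w t x) l.
Proof.
move=> su sw tw tg E.
have tr : tame (e / 4) (fun t x => g t x - ln t * logD w t x).
  by apply: tameB; [exact: (tame_le (ltW e4) tg)|exact: (tame_ln tw e4)].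
have slw := spacetime_smoothM (spacetime_smooth_ln R D) sw.
apply: (tame_limit e40 (spacetime_smoothB su slw) tr) => t x t0.
rewrite (timeDD x su (spacetime_smoothN slw) t0).
have -> : timeD (fun t x => - (ln t * w t x)) t x = - timeD (fun t x => ln t * w t x) t x.
  rewrite -mulN1r -(timeDZ (-1) x slw t0); apply: timeD_eq => // s y _.
  by rewrite mulN1r.
have := timeDM x (spacetime_smooth_ln R D) sw t0; rewrite (timeD_ln x t0) => ->.
rewrite mulrDr (E t x t0) /logD; have t0' : t != 0 by rewrite gt_eqF.
by field.
Qed.

Lemma phi_limit : exists2 l : V -> R, torus_smooth l &
  power_limit (fun t x => phi_st t x - ln t * psi_st t x) l.
Proof.
exact: (log_limit (st_phi_smooth solS) (st_psi_smooth solS) tpsi (tameZ pphi tnu)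
  (phi_evolution solS)).
Qed.

Lemma eta_limit i j : p i = p j -> exists2 l : V -> R, torus_smooth l &
  power_limit (fun t x => eta_st i j t x - ln t * curvK_st i j t x) l.
Proof.
move=> pij; have tKij : tame (e / 2) (logD (curvK_st i j)) by apply: tK; rewrite pij.
apply: (log_limit (eta_st_smooth solS i j) (curvK_st_smooth solS i j) tKij
  (tameZ (- (p i * (i == j)%:R)) tnu)) => t x t0.
by rewrite (eta_evolution solS)// pij subrr mulr0 mul0r add0r mulNr.
Qed.

(** The combination v = 2 (p_i - p_j) eta + K solves
    t v' = 2 (p_i - p_j) v + t K', because the lapse only enters the diagonal. *)
Lemma eta_curvK_vanishing i j : p j < p i ->
  vanishing (fun t x => 2 * (p i - p j) * eta_st i j t x + curvK_st i j t x).
Proof.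
move=> pji; have tKij := tK (ltW pji).
have [_ _ _ /(_ i j pji) ec] := marg.
have ij : (i == j) = false by apply/negP => /eqP ij; move: pji; rewrite ij ltxx.
have sZ := spacetime_smoothZ (2 * (p i - p j)) (eta_st_smooth solS i j).
apply: (tame_vanishing e2); apply: (tame_ode (c := 2 * (p i - p j)) _ tKij).
- exact: (spacetime_smoothD sZ (curvK_st_smooth solS i j)).
- by apply: lt_le_trans (_ : e <= _); [rewrite ltr_pdivrMr// ltr_pMr// ltr1n|have := e0; lra].
- move=> t x t0; rewrite (timeDD x sZ (curvK_st_smooth solS i j) t0).
  rewrite (timeDZ _ x (eta_st_smooth solS i j) t0) mulrDr mulrCA (eta_evolution solS)// ij.
  by rewrite mulr0n mulr0 mul0r subr0.
Qed.

Lemma st_h_eta i j t x : 0 < t -> st_h (S t) i j x = t `^ (2 * p j) * (- 2 * eta_st i j t x).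
Proof.
move=> t0; rewrite /eta_st /Defs.eta powRN; have : t `^ (2 * p j) != 0 by rewrite gt_eqF ?powR_gt0.
by move: (t `^ _) => T T0; field.
Qed.

Lemma st_kappa_eta i j t x : 0 < t ->
  st_kappa (S t) i j x = t `^ (2 * p j) * (curvK_st i j t x + 2 * p i * eta_st i j t x).
Proof.
move=> t0; rewrite /eta_st /Defs.eta /curvK_st /curvK powRN.
have : t `^ (2 * p j) != 0 by rewrite gt_eqF ?powR_gt0.
by move: (t `^ _) => T T0; field.
Qed.

Lemma st_symmetric i j t x : 0 < t ->
  st_h (S t) i j x = st_h (S t) j i x /\ st_kappa (S t) i j x = st_kappa (S t) j i x.
Proof. by move=> t0; have [_ /(_ t t0)[_ _ [_ _ _ sh sk]]] := solS. Qed.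

Lemma diagonal_asymptotics i j (K U : V -> R) : p i = p j ->
  power_limit (curvK_st i j) K ->
  power_limit (fun t x => eta_st i j t x - ln t * curvK_st i j t x) U ->
  little_o_at0 (fun t x => st_kappa (S t) i j x
      - ((K x + 2 * p i * U x) * t `^ (2 * p i)
         + 2 * p i * K x * t `^ (2 * p i) * ln t)) (fun t => t `^ (2 * p i)) /\
  little_o_at0 (fun t x => st_h (S t) i j x
      - (- 2 * (K x * ln t + U x) * t `^ (2 * p j))) (fun t => t `^ (2 * p j)).
Proof.
move=> pij /power_limit_vanishing vK /power_limit_vanishing vU.
have vE := vanishingD vU (vanishing_ln vK).
split.
- apply: (vanishing_little_o (vanishingD vK (vanishingZ (2 * p i) vE))) => t x t0.
  by rewrite st_kappa_eta// -pij; ring.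
- apply: (vanishing_little_o (vanishingZ (- 2) vE)) => t x t0.
  by rewrite st_h_eta//; ring.
Qed.

(** With d = p_i - p_j, the remainders are the combinations of K - K_inf and of
    2 d eta + K, both of which vanish. *)
Lemma offdiagonal_asymptotics i j (K : V -> R) : p j < p i ->
  power_limit (curvK_st i j) K ->
  little_o_at0 (fun t x => st_kappa (S t) i j x - - (p j / (p i - p j)) * K x * t `^ (2 * p j))
    (fun t => t `^ (2 * p j)) /\
  little_o_at0 (fun t x => st_h (S t) i j x - K x / (p i - p j) * t `^ (2 * p j))
    (fun t => t `^ (2 * p j)).
Proof.
move=> pji /power_limit_vanishing vK; have vE := eta_curvK_vanishing pji.
have d0 : p i - p j != 0 by rewrite gt_eqF// subr_gt0.
split.
- apply: (vanishing_little_o (vanishingD (vanishingZ (- (p j / (p i - p j))) vK)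
    (vanishingZ (p i / (p i - p j)) vE))) => t x t0.
  by rewrite st_kappa_eta//; move: d0 => d0; field.
- apply: (vanishing_little_o (vanishingD (vanishingZ ((p i - p j)^-1) vK)
    (vanishingZ (- (p i - p j)^-1) vE))) => t x t0.
  by rewrite st_h_eta//; move: d0 => d0; field.
Qed.

End Asymptotics.

Lemma little_o_at0_eq (R : realType) (D : nat) (u w : R -> 'rV[R]_D -> R) (g : R -> R) :
  (forall t x, 0 < t -> u t x = w t x) -> little_o_at0 u g -> little_o_at0 w g.
Proof.
move=> uw H eps eps0; near=> t => x.
by rewrite -uw; [move: x; near: t; exact: H|near: t; exact: nbhs_right_gt].
Unshelve. all: by end_near. Qed.

Theorem theorem1p2 (R : realType) (D : nat) (p : 'I_D -> R) (pphi : R)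
    (S0 : state R D) (S : R -> state R D) (nu : R -> 'rV[R]_D -> R)
    (D_ge2 : (2 <= D)%N)
    (p_kasner : kasner_exponents p pphi)
    (p_subcritical : subcritical p)
    (S0_smooth : state_smooth S0)
    (S0_constraints : constraints p pphi 1 S0)
    (S_solution : smooth_solution p pphi S nu)
    (S_data : S 1 = S0) :
  exists (Ups Kinf : tensor R D) (psiinf varphiinf : 'rV[R]_D -> R),
    [/\ tensor_smooth Ups, tensor_smooth Kinf,
        torus_smooth psiinf & torus_smooth varphiinf] /\
    [/\ forall i j : 'I_D, p i = p j ->
          little_o_at0
            (fun t x => st_kappa (S t) i j x
               - ((Kinf i j x + 2 * p i * Ups i j x) * t `^ (2 * p i)
                  + 2 * p i * Kinf i j x * t `^ (2 * p i) * ln t))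
            (fun t => t `^ (2 * p i)) /\
          little_o_at0
            (fun t x => st_h (S t) i j x
               - (- 2 * (Kinf i j x * ln t + Ups i j x) * t `^ (2 * p j)))
            (fun t => t `^ (2 * p j)),
        forall i j : 'I_D, p i <> p j ->
          little_o_at0
            (fun t x => st_kappa (S t) i j x
               - (- (p j / (p i - p j)) * Kinf i j x * t `^ (2 * p j)
                  + (p i / (p i - p j) * Kinf i j x + 2 * p i * Ups j i x)
                    * t `^ (2 * p i)))
            (fun t => t `^ Num.min (2 * p i) (2 * p j)) /\
          little_o_at0
            (fun t x => st_h (S t) i j x
               - (- (Kinf i j x / (p i - p j) + 2 * Ups i j x) * t `^ (2 * p i)
                  + Kinf i j x / (p i - p j) * t `^ (2 * p j)))
            (fun t => t `^ Num.min (2 * p i) (2 * p j)),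
        little_o_at0 (fun t x => st_psi (S t) x - psiinf x) (fun=> 1)
      & little_o_at0
          (fun t x => st_phi (S t) x - (psiinf x * ln t + varphiinf x))
          (fun=> 1)].
Proof.
have [e marg] := subcritical_margin D_ge2 p_subcritical.
have zero_smooth := torus_smooth_cst (R := R) D 0.
have exK (ij : 'I_D * 'I_D) : exists l : 'rV[R]_D -> R, [/\ torus_smooth l,
    p ij.2 <= p ij.1 -> power_limit (curvK_st p S ij.1 ij.2) l &
    p ij.1 < p ij.2 -> l = fun=> 0].
  have [h|h] := leP (p ij.2) (p ij.1); last by exists (fun=> 0).
  by have [l sl ul] := curvK_limit S_solution marg h; exists l.
have exU (ij : 'I_D * 'I_D) : exists l : 'rV[R]_D -> R, torus_smooth l /\
    (p ij.1 = p ij.2 -> power_limit (fun t x =>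
      eta_st p S ij.1 ij.2 t x - ln t * curvK_st p S ij.1 ij.2 t x) l).
  have [h|h] := eqVneq (p ij.1) (p ij.2); last first.
    by exists (fun=> 0); split=> // h'; rewrite h' eqxx in h.
  by have [l sl ul] := eta_limit S_solution marg h; exists l.
have [K KP] := choice exK; have [U UP] := choice exU.
have [psiinf spsi psiP] := psi_limit S_solution marg.
have [varphi svarphi varphiP] := phi_limit S_solution marg.
pose Kinf : tensor R D := fun i j => K (i, j).
(* For p_i <> p_j, only the leading power t^(2 min(p_i, p_j)) is visible at the
   stated precision. Ups is chosen to cancel the coefficient of the other one. *)
pose Ups : tensor R D := fun i j =>
  if p i == p j then U (i, j)
  else if p j < p i then (fun x => - (2 * (p i - p j))^-1 * K (i, j) x)
  else (fun x => - (2 * (p j - p i))^-1 * K (j, i) x).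
exists Ups, Kinf, psiinf, varphi; split.
  split; [|by move=> i j; have [] := KP (i, j)|exact: spsi|exact: svarphi].
  move=> i j; rewrite /Ups; case: ifP => _; first by have [] := UP (i, j).
  have [sK1 _ _] := KP (i, j); have [sK2 _ _] := KP (j, i).
  by case: ifP => _; [exact: (torus_smoothZ _ sK1)|exact: (torus_smoothZ _ sK2)].
split.
- move=> i j pij; have pji : p j <= p i by rewrite pij.
  have [_ /(_ pji) KL _] := KP (i, j); have [_ /(_ pij) UL] := UP (i, j).
  have UE : Ups i j = U (i, j) by rewrite /Ups pij eqxx.
  by rewrite UE; exact: (diagonal_asymptotics pij KL UL).
- move=> i j /eqP pij.
  have [pji|pji|pji] := ltgtP (p j) (p i); last by rewrite pji eqxx in pij.
  + have [_ /(_ (ltW pji)) KL _] := KP (i, j).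
    have [ok oh] := offdiagonal_asymptotics S_solution marg pji KL.
    have d0 : p i - p j != 0 by rewrite subr_eq0.
    have -> : Num.min (2 * p i) (2 * p j) = 2 * p j.
      by rewrite min_r// ler_pM2l// ltW.
    have UE1 x : Ups i j x = - (2 * (p i - p j))^-1 * Kinf i j x.
      by rewrite /Ups (negbTE pij) pji.
    have UE2 x : Ups j i x = - (2 * (p i - p j))^-1 * Kinf i j x.
      by rewrite /Ups eq_sym (negbTE pij) ltNge (ltW pji).
    split.
      by apply: (little_o_at0_eq _ ok) => t x t0; rewrite UE2 /Kinf; field.
    by apply: (little_o_at0_eq _ oh) => t x t0; rewrite UE1 /Kinf; field.
  + have [_ /(_ (ltW pji)) KL _] := KP (j, i); have [_ _ /(_ pji) K0] := KP (i, j).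
    have [ok oh] := offdiagonal_asymptotics S_solution marg pji KL.
    have d0 : p i - p j != 0 by rewrite subr_eq0.
    have d1 : p j - p i != 0 by rewrite subr_eq0 eq_sym.
    have -> : Num.min (2 * p i) (2 * p j) = 2 * p i.
      by rewrite min_l// ler_pM2l// ltW.
    have UE1 x : Ups i j x = - (2 * (p j - p i))^-1 * Kinf j i x.
      by rewrite /Ups (negbTE pij) ltNge (ltW pji).
    have UE2 x : Ups j i x = - (2 * (p j - p i))^-1 * Kinf j i x.
      by rewrite /Ups eq_sym (negbTE pij) pji.
    have KE x : Kinf i j x = 0 by rewrite /Kinf K0.
    split.
      apply: (little_o_at0_eq _ ok) => t x t0.
      have [_ ->] := st_symmetric S_solution i j x t0.
      by rewrite UE2 KE /Kinf; field; rewrite d0 d1.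
    apply: (little_o_at0_eq _ oh) => t x t0.
    have [-> _] := st_symmetric S_solution i j x t0.
    by rewrite UE1 KE /Kinf; field; rewrite d0 d1.
- apply: (vanishing_little_o (power_limit_vanishing psiP)) => t x t0.
  by rewrite mul1r.
- apply: (vanishing_little_o (vanishingD (power_limit_vanishing varphiP)
    (vanishing_ln (power_limit_vanishing psiP)))) => t x t0.
  by rewrite mul1r; ring.
Qed.
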